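(* Let $F=\mathrm{Diag}(a_1,\dots,a_d)\in M_d(\mathbb Z)$ with all $a_j>0$, $N=\det F=\prod_{j=1}^da_j$, and $G\in M_d(\mathbb Z)$ with $\det G\ne0$. For $k\in\mathbb N$ let $$\mathcal A_k=\overline{\mathrm{span}}\{S_\alpha U^\nu S_\beta^* : \alpha,\beta\in\mathfrak I(F)^k,\ \nu\in\mathbb Z^d\}\subseteq\mathcal O_{F,G}(\mathbb T^d).$$ Then $\mathcal A_k\cong C(\mathbb T^d)\otimes M_{N^k}(\mathbb C)$.
   Context: For $F\in M_d(\mathbb Z)$, $\sigma_F$ is the endomorphism of $\mathbb T^d$ given by $\sigma_F(e^{2\pi it})=e^{2\pi iFt}$, $t\in\mathbb R^d$. For $F,G\in M_d(\mathbb Z)$ with nonzero determinants let $\Omega_{F,G}(\mathbb T^d)=\{(x,y)\in\mathbb T^d\times\mathbb T^d:\sigma_F(y)=\sigma_G(x)\}$. The $C^*$-correspondence $\mathcal E=\mathcal E_{F,G}(\mathbb T^d)$ over $C(\mathbb T^d)$ is $C(\Omega_{F,G}(\mathbb T^d))$ with actions $(a\cdot\xi\cdot b)(x,y)=a(y)\xi(x,y)b(x)$ and inner product $\langle\xi,\eta\rangle(x)=\frac1{|\det F|}\sum_{\sigma_F(y)=\sigma_G(x)}\overline{\xi(x,y)}\eta(x,y)$. $\mathcal O_{F,G}(\mathbb T^d)$ is its Cuntz-Pimsner algebra, i.e. the $C^*$-algebra generated by the universal pair $(T,\pi)$ ($T$ linear on $\mathcal E$, $\pi$ a $*$-homomorphism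 of $A=C(\mathbb T^d)$) with $T(\xi)^*T(\eta)=\pi(\langle\xi,\eta\rangle)$, $T(a\cdot\xi)=\pi(a)T(\xi)$ and $\Psi_T(\phi(a))=\pi(a)$ for $a\in\phi^{-1}(\mathcal K(\mathcal E))\cap(\ker\phi)^\perp$, where $\phi$ is the left action, $(\ker\phi)^\perp=\{a:ab=0\ \forall b\in\ker\phi\}$, and $\Psi_T(\theta_{\xi,\eta})=T(\xi)T(\eta)^*$, $\theta_{\xi,\eta}(\zeta)=\xi\langle\eta,\zeta\rangle$. Here $\mathfrak I(F)=\{\nu\in\mathbb Z^d:0\le\nu_j\le a_j-1\}$; $U_j\in\mathcal O_{F,G}(\mathbb T^d)$ is the image of the coordinate function $y\mapsto y_j$ (a unitary with full spectrum $\mathbb T$; the map $C(\mathbb T^d)\to\mathcal O_{F,G}(\mathbb T^d)$ is injective); $U^\nu=\prod_jU_j^{\nu_j}$ for $\nu\in\mathbb Z^d$; $S=T(1)$, the image of the constant function $1\in C(\Omega_{F,G}(\mathbb T^d))$; $S_\nu=U^\nu S$ for $\nu\in\mathfrak I(F)$; and $S_\alpha=S_{\alpha_1}\cdots S_{\alpha_k}$ for $\alpha=(\alpha_1,\dots,\alpha_k)\in\mathfrak I(F)^k$. Equivalently, $\mathcal O_{F,G}(\mathbb T^d)$ is the universal $C^*$-algebra generated by commuting unitaries $U_1,\dots,U_d$ and an isometry $S$ with $S^*U^\nu S=\delta_0^\nu$ ($\nu\in\mathfrak I(F)$), $U_j^{a_j}S=SU^{G_j}$ ($G_j$ the $j$-th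 row of $G$), and $\sum_{\nu\in\mathfrak I(F)}U^\nu SS^*U^{-\nu}=1$. *)

(* Defs.v *)
(* The complex numbers over R : realType are R[i]; they carry their norm topology
   as the regular module (R[i])^o. *)
From HB Require Import structures.
From mathcomp Require Import all_boot all_order all_algebra.
From mathcomp Require Import finmap.
From mathcomp Require Import all_classical all_reals all_analysis.
From mathcomp Require Import complex.
Set Implicit Arguments.
Unset Strict Implicit.
Unset Printing Implicit Defensive.
Import Order.TTheory GRing.Theory Num.Theory numFieldNormedType.Exports.
Local Open Scope classical_set_scope.
Local Open Scope ring_scope.
Local Open Scope complex_scope.

Reserved Notation "x ** y" (at level 40, left associativity).

(* Algebras and *-homomorphisms are not required to be unital, hence no ring
   structure on the carrier. *)
HB.mixin Record Lmodule_isStarAlgebra (C : numClosedFieldType) A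
    & GRing.Lmodule C A := {
  smul : A -> A -> A;
  star : A -> A;
  smulA : associative smul;
  smulDl : left_distributive smul +%R;
  smulDr : right_distributive smul +%R;
  smulZl : forall (c : C) (x y : A), smul (c *: x) y = c *: smul x y;
  smulZr : forall (c : C) (x y : A), smul x (c *: y) = c *: smul x y;
  starK : involutive star;
  starD : {morph star : x y / x + y};
  starZ : forall (c : C) (x : A), star (c *: x) = Num.conj c *: star x;
  starM : forall x y : A, star (smul x y) = smul (star y) (star x)
}.
#[short(type="starAlgType")]
HB.structure Definition StarAlgebra (C : numClosedFieldType) :=
  {A of GRing.Lmodule C A & Lmodule_isStarAlgebra C A}.
Notation "x ** y" := (smul x y) : ring_scope.

HB.mixin Record StarAlgebra_isCStarAlgebra (R : realType) A
    & CompleteNormedModule R[i] A & StarAlgebra R[i] A := {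
  norm_smul_le : forall x y : A, `|x ** y| <= `|x| * `|y|;
  norm_star_smul : forall x : A, `|star x ** x| = `|x| ^+ 2
}.
#[short(type="cstarAlgType")]
HB.structure Definition CStarAlgebra (R : realType) :=
  {A of CompleteNormedModule R[i] A & StarAlgebra R[i] A &
        StarAlgebra_isCStarAlgebra R A}.

Section cplx.
Variable R : realType.
Notation C := (R[i])^o.

Lemma cadd_continuous (X : topologicalType) (f g : X -> C) :
  continuous f -> continuous g -> continuous (fun x => f x + g x : C).
Proof. move=> cf cg x; exact: (cvgD (cf x) (cg x)). Qed.

Lemma cmul_continuous (X : topologicalType) (f g : X -> C) :
  continuous f -> continuous g -> continuous (fun x => (f x * g x : R[i]) : C).
Proof. move=> cf cg x; exact: (@cvgM (R[i] : numFieldType) _ _ _ f g _ _ (cf x)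
    (cg x)). Qed.

Lemma cconj_continuous (X : topologicalType) (f : X -> C) :
  continuous f -> continuous (fun x => Num.conj (f x : R[i]) : C).
Proof.
move=> cf x; apply/cvgrPdist_lt => e e0.
have := cf x; move/cvgrPdist_lt => /(_ e e0); apply: filterS => y /=.
by rewrite -rmorphB norm_conjC.
Qed.

Lemma cinv_continuous (X : topologicalType) (f : X -> C) :
  continuous f -> (forall x, f x != 0) -> continuous (fun x => (f x : R[i])^-1 : C).
Proof. move=> cf f0 x; exact: (@cvgV (R[i] : numFieldType) _ _ _ f _ (f0 x)
    (cf x)). Qed.

Lemma rc_continuous : continuous (real_complex R : R -> C).
Proof.
move=> x; apply/cvgrPdist_lt => e e0.
have e0' : 0 < complex.Re e by move: e0; rewrite ltcE => /andP[].
have eE : e = (complex.Re e)%:C by rewrite RRe_real// gtr0_real.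
near=> y; rewrite -rmorphB/= normc_def/= expr0n/= addr0 sqrtr_sqr eE ltcR.
near: y; exact: (@cvgr_dist_lt _ _ _ _ _ id x _ _ e0').
Unshelve. all: by end_near.
Qed.
End cplx.

Definition circle (R : realType) : set (R[i])^o := [set z | `|z| = 1].
Definition torus (R : realType) (d : nat) := {ptws 'I_d -> @circle R}.
HB.instance Definition _ (R : realType) (d : nat) := Topological.on (torus R d).

Section torus.
Variable R : realType.
Notation C := (R[i])^o.

Lemma circleP (z : @circle R) : `|set_val z| = 1 :> R[i].
Proof. exact: set_valP z. Qed.

Lemma circle_neq0 (z : @circle R) : (set_val z : R[i]) != 0.
Proof. by rewrite -normr_eq0 circleP oner_eq0. Qed.

Definition mkcircle (z : R[i]) (hz : `|z| = 1) : @circle R :=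
  exist _ (z : C) (mem_set hz).

Lemma mkcircleK z hz : set_val (@mkcircle z hz) = z. Proof. by []. Qed.

Lemma circle_inj (z w : @circle R) : set_val z = set_val w -> z = w.
Proof. by move=> h; apply: val_inj. Qed.

Lemma normrXz (z : R[i]) (m : int) : `|z ^ m| = `|z| ^ m.
Proof. by case: m => n; rewrite /exprz ?normfV normrX. Qed.

Lemma sigma_subproof (d : nat) (F : 'M[int]_d) (t : torus R d) (i : 'I_d) :
  `|\prod_(j < d) (set_val (t j) : R[i]) ^ F i j| = 1.
Proof.
rewrite normr_prod big1// => j _.
by rewrite normrXz circleP exp1rz.
Qed.

(* On e^(2 pi i t) this is e^(2 pi i F t), see sigma_expT. *)
Definition sigma (d : nat) (F : 'M[int]_d) (t : torus R d) : torus R d :=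
  fun i => mkcircle (sigma_subproof F t i).

Definition cis (s : R) : R[i] := cos (2 * pi * s) +i* sin (2 * pi * s).

Lemma norm_cis s : `|cis s| = 1.
Proof. by rewrite normc_def/= cos2Dsin2 sqrtr1. Qed.

Definition expT (d : nat) (t : 'cV[R]_d) : torus R d :=
  fun j => mkcircle (norm_cis (t j 0)).

Lemma cisD s t : cis (s + t) = cis s * cis t.
Proof.
rewrite /cis !mulrDr cosD sinD; apply/eqP; rewrite eq_complex/=.
by rewrite eqxx/= addrC [X in X + _]mulrC mulrC eqxx.
Qed.

Lemma cis0 : cis 0 = 1.
Proof. by rewrite /cis mulr0 cos0 sin0. Qed.

Lemma cis_neq0 s : cis s != 0.
Proof. by rewrite -normr_eq0 norm_cis oner_eq0. Qed.

Lemma cisMn (n : nat) s : cis (n%:R * s) = cis s ^+ n.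
Proof.
elim: n => [|n IH]; first by rewrite mul0r cis0.
by rewrite exprS -IH -cisD -[n.+1%:R]natr1 mulrDl mul1r addrC.
Qed.

Lemma cisN s : cis (- s) = (cis s)^-1.
Proof.
apply: (mulfI (cis_neq0 s)); rewrite mulfV ?cis_neq0//.
by rewrite -cisD subrr cis0.
Qed.

Lemma cisMz (m : int) s : cis (m%:~R * s) = cis s ^ m.
Proof.
case: m => n; first by rewrite -pmulrn cisMn.
by rewrite NegzE -exprnN mulrNz mulNr cisN -pmulrn cisMn.
Qed.

Lemma cis_sum (I : finType) (f : I -> R) :
  cis (\sum_i f i) = \prod_i cis (f i).
Proof.
by apply: (big_morph cis); [exact: cisD | exact: cis0].
Qed.

Lemma sigma_expT (d : nat) (F : 'M[int]_d) (t : 'cV[R]_d) :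
  sigma F (expT t) = expT (map_mx intr F *m t).
Proof.
apply/funext => i; apply: circle_inj; rewrite !mkcircleK mxE cis_sum.
by apply: eq_bigr => j _; rewrite !mkcircleK mxE cisMz.
Qed.

Lemma cis_surj (z : R[i]) : `|z| = 1 -> exists2 s, `[-1, 1]%classic s & cis s = z.
Proof.
case: z => a b; rewrite normc_def/= => /complexI h.
have ab : a ^+ 2 + b ^+ 2 = 1.
  by rewrite -[LHS]sqr_sqrtr ?h ?expr1n// addr_ge0 ?sqr_ge0.
have a1 : -1 <= a <= 1.
  by rewrite -ler_norml -(@ler_pXn2r _ 2)// ?nnegrE// expr1n real_normK ?num_real// -ab lerDl sqr_ge0.
have ca : cos (acos a) = a by rewrite acosK// in_itv.
have sa : sin (acos a) = `|b|.
  by rewrite sin_acos// -ab addrAC subrr add0r sqrtr_sqr.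
have p0 : (0 : R) < 2 * pi by rewrite mulr_gt0// pi_gt0.
have q : 0 <= acos a / (2 * pi) <= 1.
  rewrite divr_ge0 ?acos_ge0//= ?(ltW p0)// ler_pdivrMr// mul1r.
  by rewrite (le_trans (acos_lepi a1))// ler_peMl ?ler1n// pi_ge0.
have e : 2 * pi * (acos a / (2 * pi)) = acos a by rewrite mulrC divfK// gt_eqF.
have /andP[q0 q1] := q.
have [b0|b0] := leP 0 b.
  exists (acos a / (2 * pi)); last by rewrite /cis e ca sa ger0_norm.
  by rewrite /= in_itv/= q1 andbT (le_trans _ q0)// lerN10.
exists (- (acos a / (2 * pi))).
  by rewrite /= in_itv/= lerN2 q1/= (le_trans _ ler01)// oppr_le0.
by rewrite /cis mulrN e cosN sinN ca sa ltr0_norm// opprK.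
Qed.

Lemma expT_surj d (t : torus R d) : exists u, expT u = t.
Proof.
have h j : exists s, cis s = (set_val (t j) : R[i]).
  by have [s _ e] := cis_surj (circleP (t j)); exists s.
have [u hu] := choice h.
by exists (\col_j u j); apply/funext => j; apply: circle_inj; rewrite mkcircleK mxE.
Qed.

Lemma cis_continuous : continuous (cis : R -> C).
Proof.
have -> : cis = (fun s => (cos (2 * pi * s))%:C + 'i * (sin (2 * pi * s))%:C).
  by apply/funext => s; rewrite [LHS]complexE.
have lin : continuous (fun s : R => 2 * pi * s).
  by move=> s; apply: cvgM; [exact: cvg_cst|exact: cvg_id].
have cc : continuous (fun s => (cos (2 * pi * s))%:C : C).
  move=> s; apply: (@continuous_comp _ _ _ (fun s : R => cos (2 * pi * s))
      (real_complex R : R -> C)); last exact: rc_continuous.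
  apply: (@continuous_comp _ _ _ (fun s : R => 2 * pi * s) cos); first exact: lin.
  exact: continuous_cos.
have cs : continuous (fun s => (sin (2 * pi * s))%:C : C).
  move=> s; apply: (@continuous_comp _ _ _ (fun s : R => sin (2 * pi * s))
      (real_complex R : R -> C)); last exact: rc_continuous.
  apply: (@continuous_comp _ _ _ (fun s : R => 2 * pi * s) sin); first exact: lin.
  exact: continuous_sin.
exact: (cadd_continuous cc (cmul_continuous (@cst_continuous R C 'i) cs)).
Qed.

Lemma continuous_to_subtype (X Y : topologicalType) (A : set Y) (f : X -> A) :
  continuous (fun x => set_val (f x) : Y) -> continuous f.
Proof. by move=> cf; apply: (@continuous_comp_initial _ _ _ (@set_val _ A)). Qed.

Lemma pair_continuous (X Y Z : topologicalType) (f : X -> Y) (g : X -> Z) :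
  continuous f -> continuous g -> continuous (fun x => (f x, g x)).
Proof. by move=> cf cg x; exact: (cvg_pair (cf x) (cg x)). Qed.

Lemma set_val_continuous (Y : topologicalType) (A : set Y) :
  continuous (set_val : A -> Y).
Proof. exact: initial_continuous. Qed.

Lemma circle_compact : compact [set: @circle R].
Proof.
have -> : [set: @circle R] = (fun s => mkcircle (norm_cis s)) @` `[-1, 1]%classic.
  apply/seteqP; split => // z _.
  have [s s1 e] := cis_surj (circleP z).
  by exists s => //; apply: circle_inj.
apply: continuous_compact; last exact: segment_compact.
apply: continuous_subspaceT; apply: continuous_to_subtype.
exact: cis_continuous.
Qed.

Lemma circle_hausdorff : hausdorff_space (@circle R).
Proof.
move=> z w zw; apply: circle_inj.
apply: (@norm_hausdorff _ C) => A B nA nB.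
have [|| v [Av Bv]] := zw (set_val @^-1` A) (set_val @^-1` B).
- exact: (set_val_continuous nA).
- exact: (set_val_continuous nB).
by exists (set_val v).
Qed.

Lemma torus_compact d : compact [set: torus R d].
Proof.
have -> : [set: torus R d] = [set f : 'I_d -> @circle R | forall i, [set: @circle R]
    (f i)].
  by apply/seteqP; split.
exact: (@tychonoff 'I_d (fun _ => @circle R) _ (fun _ => circle_compact)).
Qed.

Lemma torus_hausdorff d : hausdorff_space (torus R d).
Proof. exact: (@hausdorff_product 'I_d (fun _ => @circle R)
    (fun _ => circle_hausdorff)). Qed.

Lemma coord_continuous d (j : 'I_d) : continuous (fun t : torus R d => set_val
    (t j) : C).
Proof.
move=> t; apply: (@continuous_comp _ _ _ (fun t : torus R d => t j) set_val);
    last first.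
  exact: set_val_continuous.
exact: (@proj_continuous _ (fun _ : 'I_d => @circle R : topologicalType) j).
Qed.

Lemma continuous_to_torus (X : topologicalType) d (f : X -> torus R d) :
  (forall j, continuous (fun x => set_val (f x j) : C)) -> continuous f.
Proof.
move=> cf x; apply/cvg_sup => j.
apply: (@continuous_comp_initial _ _ _ (fun g : 'I_d -> @circle R => g j) f).
exact/continuous_to_subtype/cf.
Qed.

Lemma cexpz_continuous (X : topologicalType) (f : X -> C) (m : int) :
  continuous f -> (forall x, f x != 0) -> continuous (fun x => (f x : R[i]) ^ m : C).
Proof.
move=> cf f0.
have cX n : continuous (fun x => (f x : R[i]) ^+ n : C).
  elim: n => [|n IH]; first exact: cst_continuous.
  have -> : (fun x => (f x : R[i]) ^+ n.+1) = (fun x => (f x : R[i]) *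
      (f x : R[i]) ^+ n).
    by apply/funext => x; rewrite exprS.
  exact: (cmul_continuous cf IH).
case: m => n; first exact: cX.
apply: cinv_continuous; first exact: cX.
by move=> x; rewrite expf_neq0.
Qed.

Lemma cprod_continuous (X : topologicalType) (I : Type) (s : seq I) (f : I -> X -> C) :
  (forall i, continuous (f i)) -> continuous (fun x => \prod_(i <- s)
      (f i x : R[i]) : C).
Proof.
move=> cf; elim: s => [|i s IH].
  by under eq_fun do rewrite big_nil; exact: cst_continuous.
under eq_fun do rewrite big_cons.
exact: (cmul_continuous (cf i) IH).
Qed.

Lemma sigma_continuous d (F : 'M[int]_d) : continuous (@sigma d F).
Proof.
apply: continuous_to_torus => i /=.
apply: cprod_continuous => j; apply: cexpz_continuous; first exact: coord_continuous.
by move=> t; exact: circle_neq0.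
Qed.

Lemma tmul_subproof d (s t : torus R d) j :
  `|(set_val (s j) : R[i]) * set_val (t j)| = 1.
Proof. by rewrite normrM !circleP mulr1. Qed.
Definition tmul d (s t : torus R d) : torus R d := fun j => mkcircle
    (tmul_subproof s t j).

Lemma tinv_subproof d (s : torus R d) j : `|(set_val (s j) : R[i])^-1| = 1.
Proof. by rewrite normfV circleP invr1. Qed.
Definition tinv d (s : torus R d) : torus R d := fun j => mkcircle (tinv_subproof s j).

Definition tone d : torus R d := fun=> mkcircle (normr1 R[i]).
Arguments tone d : clear implicits.

Lemma torusP d (s t : torus R d) : (forall j, set_val (s j) = set_val
    (t j) :> R[i]) -> s = t.
Proof. by move=> h; apply/funext => j; apply: circle_inj. Qed.

Lemma tmulK d (s : torus R d) : cancel (tmul s) (tmul (tinv s)).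
Proof. by move=> t; apply: torusP => j; rewrite !mkcircleK mulKf// circle_neq0. Qed.
Lemma tmulVK d (s : torus R d) : cancel (tmul (tinv s)) (tmul s).
Proof. by move=> t; apply: torusP => j; rewrite !mkcircleK mulVKf// circle_neq0. Qed.

Lemma sigmaM d (F : 'M[int]_d) (s t : torus R d) :
  sigma F (tmul s t) = tmul (sigma F s) (sigma F t).
Proof.
apply: torusP => j; rewrite !mkcircleK -big_split; apply: eq_bigr => i _.
by rewrite mkcircleK exprzMl ?unitfE ?circle_neq0.
Qed.

Lemma sigmaV d (F : 'M[int]_d) (s : torus R d) : sigma F (tinv s) = tinv (sigma F s).
Proof.
apply: torusP => j; rewrite !mkcircleK -prodfV; apply: eq_bigr => i _.
by rewrite mkcircleK exprz_inv invr_expz.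
Qed.

Lemma tmulV d (s : torus R d) : tmul (tinv s) s = tone d.
Proof. by apply: torusP => j; rewrite !mkcircleK mulVf ?circle_neq0. Qed.

Lemma tmul1 d (s : torus R d) : tmul s (tone d) = s.
Proof. by apply: torusP => j; rewrite !mkcircleK mulr1. Qed.

Lemma sigma_comp d (F G : 'M[int]_d) (t : torus R d) : sigma F (sigma G t) = sigma
    (F *m G) t.
Proof.
by have [u <-] := expT_surj t; rewrite !sigma_expT mulmxA map_mxM.
Qed.

Lemma sigma_surj d (F : 'M[int]_d) (t : torus R d) : \det F != 0 ->
  exists s, sigma F s = t.
Proof.
move=> F0; have [u <-] := expT_surj t.
have FU : map_mx intr F \in unitmx (R := R).
  by rewrite unitmxE det_map_mx unitfE intr_eq0.
exists (expT (invmx (map_mx intr F) *m u)).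
by rewrite sigma_expT mulKVmx.
Qed.

Definition ker_sigma d (F : 'M[int]_d) := [set t : torus R d | sigma F t = tone d].

Lemma ker_sigma_finite d (F : 'M[int]_d) : \det F != 0 -> finite_set (ker_sigma F).
Proof.
move=> F0; pose n := `|\det F|%N.
have n0 : (0 < n)%N by rewrite absz_gt0.
have root1 t j : ker_sigma F t -> (set_val (t j) : R[i]) ^+ n = 1.
  move=> ht; have : sigma (\adj F) (sigma F t) = tone d.
    by rewrite ht; apply: torusP => i; rewrite !mkcircleK big1// => k _;
        rewrite mkcircleK exp1rz.
  rewrite sigma_comp mul_adj_mx => /(congr1 (fun s : torus R d => set_val
      (s j) : R[i])).
  rewrite !mkcircleK (bigD1 j)//= big1 ?mulr1; last first.
    by move=> i ij; rewrite mxE eq_sym (negbTE ij) expr0z.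
  rewrite mxE eqxx mulr1n /n.
  case: (\det F) => m; first by [].
  by rewrite NegzE abszN/= -exprnN => /eqP; rewrite invr_eq1 => /eqP.
pose p : {poly R[i]} := 'X^n - 1.
have p0 : p != 0 by rewrite -size_poly_eq0 size_XnsubC.
have [s hs] : exists s : seq R[i], forall z, root p z -> z \in s.
  have [s ps] := closed_field_poly_normal p.
  exists s => z; rewrite ps rootZ ?lead_coef_eq0//.
  by rewrite root_prod_XsubC.
pose g (f : {ffun 'I_d -> 'I_(size s)}) : torus R d := fun j =>
  if eqP is ReflectT h then mkcircle (h : `|s`_(f j)| = 1) else tone d j.
apply: (@sub_finite_set _ _ (range g)); last first.
  exact/finite_image/finite_finset.
move=> t ht /=.
have ts j : (set_val (t j) : R[i]) \in s.
  by apply: hs; rewrite rootE !hornerE root1// subrr.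
exists [ffun j => Ordinal (eq_ind_r is_true (ts j) (index_mem _ _))] => //.
apply: torusP => j; rewrite /g; case: eqP => [h|];
    rewrite ?mkcircleK ffunE/= nth_index//.
by rewrite circleP.
Qed.

End torus.
Arguments tone {R} d.

Definition cfun (R : realType) (X : topologicalType) := continuousType X (R[i])^o.

Section cfun.
Variables (R : realType) (X : topologicalType).
Notation C := (R[i])^o.
Notation cfun := (cfun R X).

HB.instance Definition _ := Choice.on cfun.

Definition mkC (f : X -> C) (cf : continuous f) : cfun := mkcts cf.

Lemma cfunP (f g : cfun) : (forall x, f x = g x) -> f = g.
Proof. by move=> h; apply/continuousEP. Qed.

Implicit Types f g h : cfun.

Lemma copp_continuous f : continuous (fun x => - f x : C).
Proof. by move=> x; apply: cvgN; exact: cts_fun. Qed.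

Lemma cscale_continuous (c : R[i]) f : continuous (fun x => (c * f x : R[i]) : C).
Proof. by apply: cmul_continuous; [exact: cst_continuous | exact: cts_fun]. Qed.

Definition cfun_add f g : cfun := mkC (cadd_continuous (@cts_fun _ _ f)
    (@cts_fun _ _ g)).
Definition cfun_opp f : cfun := mkC (@copp_continuous f).
Definition cfun_const (c : R[i]) : cfun := mkC (@cst_continuous X C c).
Definition cfun_scale (c : R[i]) f : cfun := mkC (@cscale_continuous c f).
Definition cfun_mul f g : cfun := mkC (cmul_continuous (@cts_fun _ _ f)
    (@cts_fun _ _ g)).
Definition cfun_conj f : cfun := mkC (cconj_continuous (@cts_fun _ _ f)).

Fact cfun_addA : associative cfun_add.
Proof. by move=> f g h; apply: cfunP => x; exact: addrA. Qed.
Fact cfun_addC : commutative cfun_add.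
Proof. by move=> f g; apply: cfunP => x; exact: addrC. Qed.
Fact cfun_add0 : left_id (cfun_const 0) cfun_add.
Proof. by move=> f; apply: cfunP => x; exact: add0r. Qed.
Fact cfun_addN : left_inverse (cfun_const 0) cfun_opp cfun_add.
Proof. by move=> f; apply: cfunP => x; exact: addNr. Qed.
HB.instance Definition _ :=
  GRing.isZmodule.Build cfun cfun_addA cfun_addC cfun_add0 cfun_addN.

Fact cfun_scaleA (c e : R[i]) f : cfun_scale c (cfun_scale e f) = cfun_scale (c * e) f.
Proof. by apply: cfunP => x; exact: mulrA. Qed.
Fact cfun_scale1 : left_id 1 cfun_scale.
Proof. by move=> f; apply: cfunP => x; exact: mul1r. Qed.
Fact cfun_scaleDr : right_distributive cfun_scale +%R.
Proof. by move=> c f g; apply: cfunP => x; exact: mulrDr. Qed.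
Fact cfun_scaleDl f : {morph cfun_scale^~ f : c e / c + e}.
Proof. by move=> c e; apply: cfunP => x; exact: mulrDl. Qed.
HB.instance Definition _ := GRing.Zmodule_isLmodule.Build R[i] cfun
  cfun_scaleA cfun_scale1 cfun_scaleDr cfun_scaleDl.

Fact cfun_mulA : associative cfun_mul.
Proof. by move=> f g h; apply: cfunP => x; exact: mulrA. Qed.
Fact cfun_mulDl : left_distributive cfun_mul +%R.
Proof. by move=> f g h; apply: cfunP => x; exact: mulrDl. Qed.
Fact cfun_mulDr : right_distributive cfun_mul +%R.
Proof. by move=> f g h; apply: cfunP => x; exact: mulrDr. Qed.
Fact cfun_mulZl (c : R[i]) f g : cfun_mul (c *: f) g = c *: cfun_mul f g.
Proof. by apply: cfunP => x; symmetry; exact: mulrA. Qed.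
Fact cfun_mulZr (c : R[i]) f g : cfun_mul f (c *: g) = c *: cfun_mul f g.
Proof. by apply: cfunP => x; exact: mulrCA. Qed.
Fact cfun_conjK : involutive cfun_conj.
Proof. by move=> f; apply: cfunP => x; exact: conjCK. Qed.
Fact cfun_conjD : {morph cfun_conj : f g / f + g}.
Proof. by move=> f g; apply: cfunP => x; exact: rmorphD. Qed.
Fact cfun_conjZ (c : R[i]) f : cfun_conj (c *: f) = Num.conj c *: cfun_conj f.
Proof. by apply: cfunP => x; exact: rmorphM. Qed.
Fact cfun_conjM f g : cfun_conj (cfun_mul f g) = cfun_mul (cfun_conj g) (cfun_conj f).
Proof. by apply: cfunP => x; rewrite -[RHS]mulrC; exact: rmorphM. Qed.
HB.instance Definition _ := Lmodule_isStarAlgebra.Build R[i] cfun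
  cfun_mulA cfun_mulDl cfun_mulDr cfun_mulZl cfun_mulZr
  cfun_conjK cfun_conjD cfun_conjZ cfun_conjM.

End cfun.
Arguments cfun_const {R X} c.

Section correspondence.
Variables (R : realType) (d : nat) (F G : 'M[int]_d).
Notation C := (R[i])^o.
Notation torus := (torus R d).

(* Points are pairs (x, y), so that pr1 is x and pr2 is y. *)
Definition Omega : set (torus * torus) := [set p | sigma F p.2 = sigma G p.1].

Definition pr1 (p : Omega) : torus := (set_val p).1.
Definition pr2 (p : Omega) : torus := (set_val p).2.

Lemma pr1_continuous : continuous pr1.
Proof.
move=> p; apply: (@continuous_comp _ _ _ set_val fst); first exact: set_val_continuous.
exact: cvg_fst.
Qed.

Lemma pr2_continuous : continuous pr2.
Proof.
move=> p; apply: (@continuous_comp _ _ _ set_val snd); first exact: set_val_continuous.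
exact: cvg_snd.
Qed.

Definition corr := cfun R (set_type Omega).
HB.instance Definition _ := GRing.Lmodule.on corr.

Lemma lact_continuous (a : cfun R torus) (xi : corr) :
  continuous (fun p => (a (pr2 p) * xi p : R[i]) : C).
Proof.
apply: cmul_continuous; last exact: cts_fun.
by move=> p; apply: (@continuous_comp _ _ _ pr2 (a : torus -> C));
    [exact: pr2_continuous | exact: cts_fun].
Qed.

Lemma ract_continuous (xi : corr) (b : cfun R torus) :
  continuous (fun p => (xi p * b (pr1 p) : R[i]) : C).
Proof.
apply: cmul_continuous; first exact: cts_fun.
by move=> p; apply: (@continuous_comp _ _ _ pr1 (b : torus -> C));
    [exact: pr1_continuous | exact: cts_fun].
Qed.

Definition lact (a : cfun R torus) (xi : corr) : corr := mkC (@lact_continuous a xi).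
Definition ract (xi : corr) (b : cfun R torus) : corr := mkC (@ract_continuous xi b).

(* For \det F != 0 the fibre of pr1 over x is finite; for \det F = 0 the scalar
   factor is 0^-1 = 0. *)
Definition inner_fun (xi eta : corr) (x : torus) : C :=
  (`|\det F|%:~R : R[i])^-1 *
    \sum_(p \in [set p : Omega | pr1 p = x]) Num.conj (xi p : R[i]) * eta p.

Lemma Omega_closed : closed Omega.
Proof.
have -> : Omega = [set p | forall j : 'I_d,
    [set p : torus * torus | set_val (sigma F p.2 j) - set_val
        (sigma G p.1 j) = 0 :> C] p].
  apply/seteqP; split => p; rewrite /Omega /=; first by move=> -> j; rewrite subrr.
  by move=> h; apply: torusP => j; apply/eqP; rewrite -subr_eq0 h.
have -> : [set p | forall j : 'I_d,
    [set p : torus * torus | set_val (sigma F p.2 j) - set_val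
        (sigma G p.1 j) = 0 :> C] p]
   = \bigcap_(j in [set: 'I_d]) [set p : torus * torus | set_val
       (sigma F p.2 j) - set_val (sigma G p.1 j) = 0 :> C].
  by apply/seteqP; split => p h j; [move=> _|]; apply: h.
apply: closed_bigI => j _.
have cF : continuous (fun p : torus * torus => set_val (sigma F p.2 j) : C).
  move=> p; apply: (@continuous_comp _ _ _ snd (fun t : torus => set_val
      (sigma F t j) : C)).
    exact: cvg_snd.
  apply: (@continuous_comp _ _ _ (@sigma R d F) (fun t : torus => set_val (t j) : C)).
    exact: sigma_continuous.
  exact: coord_continuous.
have cG : continuous (fun p : torus * torus => set_val (sigma G p.1 j) : C).
  move=> p; apply: (@continuous_comp _ _ _ fst (fun t : torus => set_val
      (sigma G t j) : C)).
    exact: cvg_fst.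
  apply: (@continuous_comp _ _ _ (@sigma R d G) (fun t : torus => set_val (t j) : C)).
    exact: sigma_continuous.
  exact: coord_continuous.
have -> : [set p : torus * torus | set_val (sigma F p.2 j) - set_val
    (sigma G p.1 j) = 0 :> C]
  = (fun p : torus * torus => set_val (sigma F p.2 j) - set_val
      (sigma G p.1 j) : C) @^-1` [set 0] by [].
apply: preimage_closed; last first.
  apply: accessible_closed_set1; apply: hausdorff_accessible; exact:
      (@norm_hausdorff _ C).
by move=> p _; apply: cvgB; [exact: cF | exact: cG].
Qed.

Lemma fiber_shift_subproof (k : torus) (hk : sigma F k = tone d) (p : Omega) :
  (pr1 p, tmul (pr2 p) k) \in Omega.
Proof.
apply/mem_set; rewrite /Omega /= sigmaM hk tmul1.
exact: (set_valP p).
Qed.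
Definition fiber_shift k hk (p : Omega) : Omega := exist (fun q => q \in Omega) _
    (@fiber_shift_subproof k hk p).

Lemma fiber_shift_continuous k hk : continuous (@fiber_shift k hk).
Proof.
apply: continuous_to_subtype.
apply: (@pair_continuous _ _ _ pr1 (fun p => tmul (pr2 p) k : torus));
    first exact: pr1_continuous.
apply: continuous_to_torus => j.
apply: cmul_continuous; last exact: cst_continuous.
move=> p; apply: (@continuous_comp _ _ _ pr2 (fun t : torus => set_val (t j) : C)).
  exact: pr2_continuous.
exact: coord_continuous.
Qed.

Lemma inner_continuous (xi eta : corr) : continuous (inner_fun xi eta).
Proof.
have [F0|F0] := eqVneq (\det F) 0.
  have -> : inner_fun xi eta = cst 0.
    by apply/funext => x; rewrite /inner_fun F0 normr0 invr0 mul0r.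
  exact: cst_continuous.
pose g (p : Omega) : R[i] := Num.conj (xi p : R[i]) * eta p.
have cg : continuous (g : Omega -> C).
  apply: cmul_continuous; last exact: cts_fun.
  exact/cconj_continuous/cts_fun.
pose gk (k : torus) (p : Omega) : C :=
  if eqP is ReflectT hk then g (@fiber_shift k hk p) else 0.
have cgk k : continuous (gk k).
  rewrite /gk; case: eqP => [hk|_]; last exact: cst_continuous.
  move=> p; apply: (@continuous_comp _ _ _ (fiber_shift hk) (g : Omega -> C));
      first exact: fiber_shift_continuous.
  exact: cg.
pose h (p : Omega) : C := (`|\det F|%:~R : R[i])^-1 * \sum_(k \in ker_sigma F) gk k p.
have ch : continuous h.
  apply: cmul_continuous; first exact: cst_continuous.
  have -> : (fun p => \sum_(k \in ker_sigma F) gk k p) =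
     (fun p => \sum_(k <- enum_fset (fset_set (ker_sigma F : set torus))) gk k p).
    by apply/funext => p; rewrite fsbig_finite//; exact: ker_sigma_finite.
  elim: (enum_fset _) => [|k s IH].
    by under eq_fun do rewrite big_nil; exact: cst_continuous.
  by under eq_fun do rewrite big_cons; exact: (cadd_continuous (cgk k) IH).
have hE p : inner_fun xi eta (pr1 p) = h p.
  congr (_ * _).
  pose f k : Omega := if eqP is ReflectT hk then @fiber_shift k hk p else p.
  rewrite (@reindex_fsbig _ _ _ _ _ f (ker_sigma F)); last first.
    split.
    - by move=> k /= hk; rewrite /f; case: eqP.
    - move=> k l /set_mem hk /set_mem hl; rewrite /f.
      case: eqP => // hk'; case: eqP => // hl' e.
      have e' : tmul (pr2 p) k = tmul (pr2 p) l := congr1 (@pr2 : Omega -> torus) e.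
      by rewrite -[k](tmulK (pr2 p)) -[l](tmulK (pr2 p)) e'.
    - move=> q /= hq.
      have hk : sigma F (tmul (tinv (pr2 p)) (pr2 q)) = tone d.
        rewrite sigmaM sigmaV.
        have -> : sigma F (pr2 q) = sigma F (pr2 p).
          by rewrite (set_valP q : sigma F (pr2 q) = sigma G (pr1 q)) hq
                     (set_valP p : sigma F (pr2 p) = sigma G (pr1 p)).
        exact: tmulV.
      exists (tmul (tinv (pr2 p)) (pr2 q)) => //.
      rewrite /f; case: eqP => // hk'; apply: val_inj => /=.
      by rewrite tmulVK -hq; exact: (esym (surjective_pairing (set_val q))).
  apply: eq_fsbigr => k /set_mem hk; rewrite /gk /f.
  by case: eqP.
apply/continuous_closedP => D cD.
have [V oV hV] : exists2 V : set (torus * torus), open V & set_val @^-1` V = h @^-1`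
    (~` D).
  have : open (h @^-1` (~` D)).
    by apply: open_comp (closed_openC cD) => x _; exact: ch.
  by case=> V oV hV; exists V.
have -> : inner_fun xi eta @^-1` D = fst @` (Omega `&` ~` V).
  apply/seteqP; split => [x /= Dx|x /= [[y z] [yz nV] /= <-]].
    have [y hy] := sigma_surj (sigma G x) F0.
    pose p : Omega := exist (fun q => q \in Omega) (x, y) (mem_set hy).
    exists (x, y) => //; split => // Vxy.
    have : (h @^-1` (~` D)) p by rewrite -hV.
    by apply; rewrite -hE.
  pose p : Omega := exist (fun q => q \in Omega) (y, z) (mem_set yz).
  rewrite (_ : y = pr1 p)// hE; apply: contrapT => nD.
  by apply: nV; have : (set_val @^-1` V) p by rewrite hV.
apply: compact_closed; first exact: torus_hausdorff.
apply: continuous_compact.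
  by apply: continuous_subspaceT => p; exact: cvg_fst.
apply: (@subclosed_compact _ _ [set: torus * torus]) => //.
  by apply: closedI; [exact: Omega_closed | exact: open_closedC].
by rewrite -setXTT; apply: compact_setX; exact: torus_compact.
Qed.

Definition inner (xi eta : corr) : cfun R torus := mkC (@inner_continuous xi eta).

End correspondence.

Section hom.
Variable C : numClosedFieldType.

Definition star_hom (A B : starAlgType C) (f : A -> B) : Prop :=
  [/\ linear f, {morph f : x y / x ** y} & {morph f : x / star x}].

(* For C*-algebras, an injective *-homomorphism is automatically isometric, so
   this is the isomorphism of A with the C*-subalgebra S of B. *)
Definition star_iso_onto (A B : starAlgType C) (S : set B) : Prop :=
  exists f : A -> B, [/\ star_hom f, injective f & range f = S].

Definition lspan (V : lmodType C) (X : set V) : set V :=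
  [set v | exists2 s : seq (C * V),
     (forall p, p \in s -> X p.2) & v = \sum_(p <- s) p.1 *: p.2].

End hom.
Arguments star_iso_onto {C} A {B} S.

Section matrices.
Variables (C : numClosedFieldType) (n : nat) (A : starAlgType C).

(* M_n(A), which is the tensor product of A with M_n(C): the elementary tensors
   are the elements [tens a M] below, with universal property [tens_universal].
   As M_n(C) has finite dimension, no completion is needed and the C*-norm on
   M_n(A) is unique when A is a C*-algebra. *)
Definition mxalg := 'M[A]_n.
HB.instance Definition _ := GRing.Zmodule.on mxalg.

Implicit Types M P Q : mxalg.

Definition mxalg_scale (c : C) M : mxalg := \matrix_(i, j) (c *: M i j).
Definition mxalg_mul M P : mxalg := \matrix_(i, j) \sum_k M i k ** P k j.
Definition mxalg_star M : mxalg := \matrix_(i, j) star (M j i).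

Fact mxalg_scaleA c e M : mxalg_scale c (mxalg_scale e M) = mxalg_scale (c * e) M.
Proof. by apply/matrixP => i j; rewrite !mxE scalerA. Qed.
Fact mxalg_scale1 : left_id 1 mxalg_scale.
Proof. by move=> M; apply/matrixP => i j; rewrite !mxE scale1r. Qed.
Fact mxalg_scaleDr : right_distributive mxalg_scale +%R.
Proof. by move=> c M P; apply/matrixP => i j; rewrite !mxE scalerDr. Qed.
Fact mxalg_scaleDl M : {morph mxalg_scale^~ M : c e / c + e}.
Proof. by move=> c e; apply/matrixP => i j; rewrite !mxE scalerDl. Qed.
HB.instance Definition _ := GRing.Zmodule_isLmodule.Build C mxalg
  mxalg_scaleA mxalg_scale1 mxalg_scaleDr mxalg_scaleDl.

Lemma smul0 (x : A) : x ** 0 = 0.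
Proof. by rewrite -[X in _ ** X](scale0r (0 : A)) smulZr scale0r. Qed.
Lemma smul0r (x : A) : 0 ** x = 0.
Proof. by rewrite -[X in X ** _](scale0r (0 : A)) smulZl scale0r. Qed.
Lemma star0 : star (0 : A) = 0.
Proof. by rewrite -[X in star X](scale0r (0 : A)) starZ rmorph0 scale0r. Qed.
Lemma smul_suml (I : finType) (f : I -> A) x : (\sum_i f i) ** x = \sum_i f i ** x.
Proof. by apply: (big_morph (fun y => y ** x)) => [y z|]; rewrite ?smulDl ?smul0r. Qed.
Lemma smul_sumr (I : finType) (f : I -> A) x : x ** (\sum_i f i) = \sum_i x ** f i.
Proof. by apply: (big_morph (fun y => x ** y)) => [y z|]; rewrite ?smulDr ?smul0. Qed.
Lemma star_sum (I : finType) (f : I -> A) : star (\sum_i f i) = \sum_i star (f i).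
Proof. by apply: (big_morph star) => [y z|]; rewrite ?starD ?star0. Qed.

Fact mxalg_mulA : associative mxalg_mul.
Proof.
move=> M P Q; apply/matrixP => i j; rewrite !mxE.
under eq_bigr do rewrite mxE smul_sumr.
rewrite exchange_big; apply: eq_bigr => k _; rewrite mxE smul_suml.
by apply: eq_bigr => l _; rewrite smulA.
Qed.
Fact mxalg_mulDl : left_distributive mxalg_mul +%R.
Proof.
move=> M P Q; apply/matrixP => i j; rewrite !mxE -big_split; apply: eq_bigr => k _.
by rewrite mxE smulDl.
Qed.
Fact mxalg_mulDr : right_distributive mxalg_mul +%R.
Proof.
move=> M P Q; apply/matrixP => i j; rewrite !mxE -big_split; apply: eq_bigr => k _.
by rewrite mxE smulDr.
Qed.
Fact mxalg_mulZl (c : C) M P : mxalg_mul (c *: M) P = c *: mxalg_mul M P.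
Proof.
apply/matrixP => i j; rewrite !mxE scaler_sumr; apply: eq_bigr => k _.
by rewrite mxE smulZl.
Qed.
Fact mxalg_mulZr (c : C) M P : mxalg_mul M (c *: P) = c *: mxalg_mul M P.
Proof.
apply/matrixP => i j; rewrite !mxE scaler_sumr; apply: eq_bigr => k _.
by rewrite mxE smulZr.
Qed.
Fact mxalg_starK : involutive mxalg_star.
Proof. by move=> M; apply/matrixP => i j; rewrite !mxE starK. Qed.
Fact mxalg_starD : {morph mxalg_star : M P / M + P}.
Proof. by move=> M P; apply/matrixP => i j; rewrite !mxE starD. Qed.
Fact mxalg_starZ (c : C) M : mxalg_star (c *: M) = Num.conj c *: mxalg_star M.
Proof. by apply/matrixP => i j; rewrite !mxE starZ. Qed.
Fact mxalg_starM M P : mxalg_star (mxalg_mul M P) = mxalg_mul (mxalg_star P)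
    (mxalg_star M).
Proof.
apply/matrixP => i j; rewrite !mxE star_sum; apply: eq_bigr => k _.
by rewrite !mxE starM.
Qed.
HB.instance Definition _ := Lmodule_isStarAlgebra.Build C mxalg
  mxalg_mulA mxalg_mulDl mxalg_mulDr mxalg_mulZl mxalg_mulZr
  mxalg_starK mxalg_starD mxalg_starZ mxalg_starM.

Definition tens (a : A) (M : 'M[C]_n) : mxalg := \matrix_(i, j) (M i j *: a).

Lemma tens_mul a b (M P : 'M[C]_n) : tens a M ** tens b P = tens (a ** b) (M *m P).
Proof.
apply/matrixP => i j; rewrite !mxE scaler_suml; apply: eq_bigr => k _.
by rewrite !mxE smulZl smulZr scalerA.
Qed.

Lemma tens_star a (M : 'M[C]_n) :
  star (tens a M) = tens (star a) (\matrix_(i, j) Num.conj (M j i)).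
Proof. by apply/matrixP => i j; rewrite !mxE starZ. Qed.

Lemma tens_universal (V : lmodType C) (beta : A -> 'M[C]_n -> V) :
  (forall a, linear (beta a)) -> (forall M : 'M[C]_n, linear (beta^~ M)) ->
  exists! phi : mxalg -> V, linear phi /\ forall a (M : 'M[C]_n), phi
      (tens a M) = beta a M.
Proof.
move=> bl br.
have bl0 a : beta a 0 = 0.
  by have := bl a (-1) 0 0; rewrite scaler0 addr0 scaleN1r addNr.
have br0 (M : 'M[C]_n) : beta 0 M = 0.
  by have := br M (-1) 0 0; rewrite scaler0 addr0 scaleN1r addNr.
exists (fun M => \sum_i \sum_j beta (M i j) (delta_mx i j)); split.
  split.
    move=> c M P; rewrite scaler_sumr -big_split; apply: eq_bigr => i _.
    rewrite scaler_sumr -big_split; apply: eq_bigr => j _.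
    by rewrite !mxE br.
  move=> a M; rewrite {2}[M]matrix_sum_delta.
  rewrite (big_morph (beta a) (id1 := 0) (op1 := +%R)) => [|x y|//]; last first.
    by have := bl a 1 x y; rewrite !scale1r.
  apply: eq_bigr => i _.
  rewrite (big_morph (beta a) (id1 := 0) (op1 := +%R)) => [|x y|//]; last first.
    by have := bl a 1 x y; rewrite !scale1r.
  apply: eq_bigr => j _; rewrite mxE.
  have := br (delta_mx i j) (M i j) a 0; rewrite addr0 br0 addr0 => ->.
  by have := bl a (M i j) (delta_mx i j) 0; rewrite addr0 bl0 addr0 => ->.
move=> phi [pl pt]; apply/funext => M.
have p0 : phi 0 = 0 by have := pl (-1) 0 0; rewrite scaler0 addr0 scaleN1r addNr.
have pD : {morph phi : x y / x + y} by move=> x y; have := pl 1 x y; rewrite !scale1r.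
have -> : M = \sum_i \sum_j tens (M i j) (delta_mx i j).
  apply/matrixP => k l; rewrite summxE (bigD1 k)//= [X in _ + X]big1 ?addr0; last first.
    move=> i ik; rewrite summxE big1// => j _.
    by rewrite !mxE eq_sym (negbTE ik) scale0r.
  rewrite summxE (bigD1 l)//= [X in _ + X]big1 ?addr0; last first.
    by move=> j jl; rewrite !mxE eqxx eq_sym (negbTE jl) scale0r.
  by rewrite !mxE !eqxx scale1r.
rewrite (big_morph phi pD p0).
apply: eq_bigr => i _; rewrite (big_morph phi pD p0); apply: eq_bigr => j _.
rewrite pt; congr (beta _ _).
rewrite summxE (bigD1 i)//= [X in _ + X]big1 ?addr0; last first.
  move=> k ik; rewrite summxE big1// => l _.
  by rewrite !mxE eq_sym (negbTE ik) scale0r.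
rewrite summxE (bigD1 j)//= [X in _ + X]big1 ?addr0; last first.
  by move=> l jl; rewrite !mxE eqxx eq_sym (negbTE jl) scale0r.
by rewrite !mxE !eqxx scale1r.
Qed.

End matrices.

Section cuntz_pimsner.
Variables (R : realType) (d : nat) (F G : 'M[int]_d).
Notation A := (cfun R (torus R d)).
Notation E := (corr R F G).

Definition supnorm (f : A) : R := sup [set complex.Re `|f x : R[i]| | x in setT].

Definition Enorm (xi : E) : R := Num.sqrt (supnorm (inner xi xi)).

Definition theta (xi eta zeta : E) : E := ract xi (inner eta zeta).

(* The norm closure of the span of the operators theta xi eta; scalars are
   absorbed in xi, and a norm limit of such operators is adjointable. *)
Definition compact_op (k : E -> E) : Prop :=
  forall e : R, 0 < e -> exists s : seq (E * E), forall zeta,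
    Enorm (k zeta - \sum_(p <- s) theta p.1 p.2 zeta) <= e * Enorm zeta.

Definition adjoint (k k' : E -> E) : Prop :=
  forall xi eta, inner (k xi) eta = inner xi (k' eta).

(* A *-homomorphism on the algebra of compact operators; its values elsewhere are
   irrelevant. It is unique there, being automatically norm continuous. *)
Record is_Psi (B : cstarAlgType R) (T : E -> B) (Psi : (E -> E) -> B) : Prop := {
  PsiD : forall k l, compact_op k -> compact_op l ->
    Psi (fun xi => k xi + l xi) = Psi k + Psi l;
  PsiZ : forall (c : R[i]) k, compact_op k ->
    Psi (fun xi => c *: k xi) = c *: Psi k;
  PsiM : forall k l, compact_op k -> compact_op l -> Psi (k \o l) = Psi k ** Psi l;
  PsiS : forall k k', compact_op k -> adjoint k k' -> Psi k' = star (Psi k);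
  Psi_theta : forall xi eta, Psi (theta xi eta) = T xi ** star (T eta)
}.

Definition ker_lact : set A := [set b | forall xi : E, lact b xi = 0].

Definition covariant (B : cstarAlgType R) (T : E -> B) (pi : A -> B) : Prop :=
  exists2 Psi, is_Psi T Psi &
    forall a, compact_op (lact a) -> (forall b, ker_lact b -> a ** b = 0) ->
      Psi (lact a) = pi a.

Record covariant_pair (B : cstarAlgType R) (T : E -> B) (pi : A -> B) : Prop := {
  T_linear : linear T;
  pi_hom : star_hom pi;
  T_inner : forall xi eta, star (T xi) ** T eta = pi (inner xi eta);
  T_lact : forall a xi, T (lact a xi) = pi a ** T xi;
  T_covariant : covariant T pi
}.

Record cstar_subalgebra (B : cstarAlgType R) (P : set B) : Prop := {
  subalg0 : P 0;
  subalgD : forall x y, P x -> P y -> P (x + y);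
  subalgZ : forall (c : R[i]) x, P x -> P (c *: x);
  subalgM : forall x y, P x -> P y -> P (x ** y);
  subalgS : forall x, P x -> P (star x);
  subalg_closed : closed P
}.

(* Uniqueness of rho follows from cp_generated. *)
Record cuntz_pimsner (O : cstarAlgType R) (T : E -> O) (pi : A -> O) : Prop := {
  cp_pair : covariant_pair T pi;
  cp_generated : forall P : set O, cstar_subalgebra P ->
    (forall xi, P (T xi)) -> (forall a, P (pi a)) -> P = setT;
  cp_universal : forall (B : cstarAlgType R) (T' : E -> B) (pi' : A -> B),
    covariant_pair T' pi' ->
    exists rho : O -> B, [/\ star_hom rho,
      forall xi, rho (T xi) = T' xi & forall a, rho (pi a) = pi' a]
}.

End cuntz_pimsner.

Section elements.
Variables (R : realType) (d : nat) (a : 'rV[int]_d) (G : 'M[int]_d).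
Notation A := (cfun R (torus R d)).
Notation F := (diag_mx a).
Notation E := (corr R F G).

Definition frakI : set 'rV[int]_d := [set nu | forall j, 0 <= nu 0 j <= a 0 j - 1].

Variables (O : cstarAlgType R) (T : E -> O) (pi : A -> O).

(* The unit of O: since T xi = T (ract xi 1) and T (lact 1 xi) = T xi, pi 1 acts as
   the identity on the generators. *)
Definition unitO : O := pi (cfun_const 1).

Definition genU (j : 'I_d) : O := pi (mkC (@coord_continuous R d j)).

(* Integer powers of a unitary u, with inverse star u. *)
Definition upow (u : O) (m : int) : O :=
  match m with
  | Posz n => iter n (smul u) unitO
  | Negz n => iter n.+1 (smul (star u)) unitO
  end.

Definition Upow (nu : 'rV[int]_d) : O := \big[smul/unitO]_(j < d) upow (genU j)
    (nu 0 j).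

Definition genS : O := T (cfun_const 1).

Definition S_ (nu : 'rV[int]_d) : O := Upow nu ** genS.

Definition Sword k (alpha : k.-tuple 'rV[int]_d) : O :=
  \big[smul/unitO]_(i < k) S_ (tnth alpha i).

Definition calA (k : nat) : set O := closure (lspan
  [set x | exists alpha beta : k.-tuple 'rV[int]_d, exists nu : 'rV[int]_d,
    [/\ forall i, frakI (tnth alpha i), forall i, frakI (tnth beta i) &
        x = Sword alpha ** Upow nu ** star (Sword beta)]]).

End elements.

(* Main.v *)
Require Import Defs.
From HB Require Import structures.
From mathcomp Require Import all_boot all_order all_algebra.
From mathcomp Require Import finmap.
From mathcomp Require Import all_classical all_reals all_analysis.
From mathcomp Require Import showcase.summability.
From mathcomp Require Import complex.
From mathcomp Require Import ring lra zify.
Set Implicit Arguments.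
Unset Strict Implicit.
Unset Printing Implicit Defensive.
Import Order.TTheory GRing.Theory Num.Theory numFieldNormedType.Exports.
Local Open Scope classical_set_scope.
Local Open Scope ring_scope.
Local Open Scope complex_scope.

(** Since S_nu^* S_mu = delta pi(1), the words W_alpha of length k are orthogonal isometries, and M |-> sum W_alpha pi(M_alpha,beta) W_beta^* is a *-homomorphism on M_(N^k)(C(T^d)), injective as soon as pi is. Its range contains the generators of A_k, and is closed because an injective *-homomorphism on C(T^d) is isometric; it is contained in A_k because Laurent polynomials are dense in C(T^d).

Injectivity of pi follows from universality and one covariant representation in which C(T^d) acts faithfully. It lives on l^2 of the set of sequences p in T^d with sigma_F(p_n) = sigma_G(p_(n+1)): functions act by multiplication through p_0, and T(xi) sends the point mass at p to N^(-1/2) times the sum, over the N solutions y of sigma_F(y) = sigma_G(p_0), of xi(p_0, y) times the point mass at (y, p_0, p_1, ...). *)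

(** * Real-valued norms and completeness *)

(** What makes the algebra computable is that the monomials [y ^ k], with [k] in I(F), form an
    orthonormal basis of the right module: on a fibre they are, up to a unimodular factor, the
    characters of a product of cyclic groups. Hence a compact operator is a finite sum of rank one
    operators, [Psi] has a closed formula, and a pair is covariant as soon as the sum of
    [T (frame k) ** star (T (frame k))] acts as a unit on the range of [pi]. Universality speaks
    about C*-algebras only, so the bounded operators on l^2 must first be given a complete C*-norm.
    Counting measure on all paths is used because a point mass then detects the value of a function
    at any given point. Paths have no end because on finite ones the shortest would lie outside the
    range of every [T xi], which breaks the relation above; [\det G != 0] lets every point start a
    path. The closed range is the delicate step, as it requires an injective homomorphism to be
    isometric. Spectral theory is replaced by the norm bound for unitary functions, the C*-identity
    and powers of a single function. *)

Section real_norm.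
Variable R : realType.
Notation C := R[i].

(** A fixed rate of convergence: completeness is stated for sequences with
    [|u n - u m| <= r n + r m], whose limits satisfy [|u n - x| <= r n]. The same rate serves
    scalars, l^2, operators and the range of [pi]. *)
Definition inv_succ (n : nat) : R := n.+1%:R^-1.
Local Notation r := inv_succ.

Lemma inv_succ_gt0 n : 0 < r n.
Proof. by rewrite invr_gt0. Qed.

Lemma inv_succ_ge0 n : 0 <= r n.
Proof. by rewrite invr_ge0. Qed.

Lemma inv_succ_lt (e : R) : 0 < e -> exists n, r n < e.
Proof.
move=> e0; exists (Num.bound e^-1).
rewrite /r invf_plt ?posrE// (lt_trans (archi_boundP _)) ?invr_ge0 ?ltW//.
by rewrite ltr_nat.
Qed.

Lemma le_inv_succ (c x y : R) : (forall n, x <= y + c * r n) -> x <= y.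
Proof.
move=> h; apply/ler_addgt0Pr => e e0.
have c0 : 0 < `|c| + 1 by rewrite ltr_wpDl.
have [n rn] := inv_succ_lt (divr_gt0 e0 c0).
apply: (le_trans (h n)); rewrite lerD2l.
apply: (@le_trans _ _ ((`|c| + 1) * r n)).
  apply: ler_wpM2r; first exact/ltW/inv_succ_gt0.
  by rewrite (le_trans (ler_norm _))// lerDl.
by rewrite mulrC -ler_pdivlMr// ltW.
Qed.

(** By hypothesis every [u n - r n] lies below every [u m + r m], so the supremum of the former is
    within [r n] of each [u n]. *)
Lemma real_fast_limit (u : nat -> R) :
  (forall n m, `|u n - u m| <= r n + r m) -> exists x, forall n, `|u n - x| <= r n.
Proof.
move=> h; pose S := [set u n - r n | n in [set: nat]].
have ub m : ubound S (u m + r m).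
  move=> _ [n _ <-]; have := h n m; rewrite ler_norml => /andP[_ ?]; lra.
have hs : has_sup S by split; [exists (u 0 - r 0), 0 | exists (u 0 + r 0); exact: ub].
exists (sup S) => n; rewrite ler_distl; apply/andP; split.
  by rewrite lerBlDr; apply: ge_sup; [case: hs | exact: ub].
by rewrite -lerBlDr; apply: sup_upper_bound => //; exists n.
Qed.

Section nrm.
Variable V : normedZmodType C.
Implicit Types x y z : V.

(** Norms are complex numbers that happen to be real; taking the real part moves all estimates to
    the ordered field [R], where linear arithmetic and suprema are available. *)
Definition nrm x : R := complex.Re `|x|.

Lemma nrmE x : `|x| = (nrm x)%:C.
Proof. by rewrite /nrm RRe_real// ger0_real. Qed.

Lemma nrm_ge0 x : 0 <= nrm x.
Proof. by have := normr_ge0 x; rewrite nrmE ler0c. Qed.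

Lemma nrm_le x (c : R) : (`|x| <= c%:C) = (nrm x <= c).
Proof. by rewrite nrmE lecR. Qed.

Lemma nrmD x y : nrm (x + y) <= nrm x + nrm y.
Proof. by rewrite -lecR rmorphD /= -!nrmE ler_normD. Qed.

Lemma nrmB x y : nrm (x - y) = nrm (y - x).
Proof. by rewrite /nrm distrC. Qed.

Lemma nrmN x : nrm (- x) = nrm x.
Proof. by rewrite /nrm normrN. Qed.

Lemma nrm_dist x y z : nrm (x - z) <= nrm (x - y) + nrm (y - z).
Proof. by rewrite -[x - z](subrKA y) nrmD. Qed.

Lemma nrm0 : nrm (0 : V) = 0.
Proof. by rewrite /nrm normr0. Qed.

Lemma nrm0_eq0 x : nrm x = 0 -> x = 0.
Proof. by move=> x0; apply/eqP; rewrite -normr_eq0 nrmE x0. Qed.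

Lemma nrm_sum (I : Type) (s : seq I) (f : I -> V) :
  nrm (\sum_(i <- s) f i) <= \sum_(i <- s) nrm (f i).
Proof.
elim: s => [|i s IH]; first by rewrite !big_nil nrm0.
by rewrite !big_cons (le_trans (nrmD _ _))// lerD2l.
Qed.

End nrm.

Lemma nrmZ (V : normedModType C) (c : C) (x : V) : nrm (c *: x) = nrm c * nrm x.
Proof. by apply: complexI; rewrite rmorphM /= -!nrmE normrZ. Qed.

Lemma nrmM (z w : C) : nrm (z * w) = nrm z * nrm w.
Proof. by apply: complexI; rewrite rmorphM /= -!nrmE normrM. Qed.

Lemma nrm_conj (z : C) : nrm (Num.conj z) = nrm z.
Proof. by rewrite /nrm norm_conjC. Qed.

Lemma nrm_real (x : R) : nrm (x%:C : C) = `|x|.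
Proof. by rewrite /nrm normc_def /= expr0n addr0 sqrtr_sqr. Qed.

Lemma conj_mul (z : C) : Num.conj z * z = (nrm z ^+ 2)%:C.
Proof. by rewrite rmorphXn /= -nrmE normCK mulrC. Qed.

Lemma Re_le_nrm (z : C) : `|complex.Re z| <= nrm z.
Proof.
case: z => a b; rewrite /nrm normc_def /=.
by rewrite -sqrtr_sqr ler_sqrt ?addr_ge0 ?sqr_ge0// lerDl sqr_ge0.
Qed.

Lemma Im_le_nrm (z : C) : `|complex.Im z| <= nrm z.
Proof.
case: z => a b; rewrite /nrm normc_def /=.
by rewrite -sqrtr_sqr ler_sqrt ?addr_ge0 ?sqr_ge0// lerDr sqr_ge0.
Qed.

Lemma nrm_le_ReIm (z : C) : nrm z <= `|complex.Re z| + `|complex.Im z|.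
Proof.
have -> : z = (complex.Re z)%:C + 'i%C * (complex.Im z)%:C by exact: complexE.
apply: (le_trans (nrmD _ _)); rewrite nrmM !nrm_real.
by case: z => a b /=; rewrite !mul0r !mul1r !subr0 !addr0 !add0r /nrm normc_def /=
  expr0n expr1n add0r sqrtr1 mul1r.
Qed.

Lemma complex_fast_limit (u : nat -> C) :
  (forall n m, nrm (u n - u m) <= r n + r m) -> exists z, forall n, nrm (u n - z) <= r n.
Proof.
move=> h.
have [x hx] : exists x, forall n, `|complex.Re (u n) - x| <= r n.
  apply: (@real_fast_limit (fun n => complex.Re (u n))) => n m.
  by rewrite -raddfB (le_trans (Re_le_nrm _)).
have [y hy] : exists x, forall n, `|complex.Im (u n) - x| <= r n.
  apply: (@real_fast_limit (fun n => complex.Im (u n))) => n m.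
  by rewrite -raddfB (le_trans (Im_le_nrm _)).
have h2 m : nrm (u m - (x +i* y)) <= 2 * r m.
  apply: (le_trans (nrm_le_ReIm _)); rewrite !raddfB /= mulr_natl mulr2n.
  by rewrite lerD.
(* The coordinates alone give only the rate [2 * r]. Passing through [u m] costs
   [r n + r m + 2 * r m], and letting [m] grow restores the rate [r n]. *)
exists (x +i* y) => n; apply: (@le_inv_succ 3) => m.
apply: (le_trans (nrm_dist _ (u m) _)).
by apply: (le_trans (lerD (h n m) (h2 m))); rewrite -addrA lerD2l; lra.
Qed.

Lemma Re_continuous : continuous (fun z : C^o => complex.Re z : R).
Proof.
move=> z; apply/(@cvgrPdist_lt _ _ _ _ (nbhs_filter (z : C^o))) => e e0.
have e0' : 0 < e%:C by rewrite ltcR.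
have zz : (fun w : C^o => w) @ (z : C^o) --> (z : C^o) by exact: cvg_id.
have := (@cvgrPdist_lt _ _ _ _ (nbhs_filter (z : C^o)) _ _).1 zz _ e0'.
apply: (@filterS _ _ (nbhs_filter (z : C^o))) => w zw.
by rewrite -raddfB (le_lt_trans (Re_le_nrm _))// -ltcR -nrmE.
Qed.

End real_norm.

(** * The Hilbert space of square-summable families *)

Section complex_limits.
Variables (R : realType) (T : Type) (F : set_system T) (FF : Filter F).
Local Notation C := R[i].
Implicit Types f g : T -> C^o.

Lemma ccvgD f g (a b : C^o) : f @ F --> a -> g @ F --> b ->
  (fun t => f t + g t : C^o) @ F --> (a + b : C^o).
Proof. exact: cvgD. Qed.

Lemma ccvgB f g (a b : C^o) : f @ F --> a -> g @ F --> b ->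
  (fun t => f t - g t : C^o) @ F --> (a - b : C^o).
Proof. exact: cvgB. Qed.

Lemma ccvgMl (c : C) f (a : C^o) : f @ F --> a ->
  (fun t => c * f t : C^o) @ F --> (c * a : C^o).
Proof.
move=> fa; exact: (@cvgM (C : numFieldType) _ _ _ (fun=> c) f _ _ (@cvg_cst C^o _ _ _ _) fa).
Qed.

Lemma ccvg_real (f : T -> R) (a : R) : f @ F --> a ->
  (fun t => (f t)%:C : C^o) @ F --> (a%:C : C^o).
Proof.
move=> fa; apply: (@cvg_comp _ _ _ f (real_complex R : R -> C^o) _ _ _ fa).
exact: rc_continuous.
Qed.

End complex_limits.

Section square_summable.
Variables (R : realType) (Y : choiceType).
Notation C := R[i].
#[local] Existing Instance totally_filter.

Definition sqsum (A : {fset Y}) (x : Y -> C^o) : R := \sum_(i <- A) nrm (x i : C) ^+ 2.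

Lemma sqsum_ge0 A x : 0 <= sqsum A x.
Proof. by apply: sumr_ge0 => i _; exact: sqr_ge0. Qed.

Lemma sqsum_sub (A B : {fset Y}) x : (A `<=` B)%fset -> sqsum A x <= sqsum B x.
Proof.
move=> AB; rewrite /sqsum (big_fsetID _ (mem A) B) /=.
have -> : [fset i | i in B & i \in A]%fset = A.
  by apply/fsetP => i; rewrite !inE /=; apply: andb_idl => /(fsubsetP AB).
by rewrite lerDl sumr_ge0// => i _; exact: sqr_ge0.
Qed.

Definition l2_pred : {pred Y -> C^o} :=
  fun x => `[< exists M : R, forall A, sqsum A x <= M >].

Lemma nrm_sqrD (V : normedZmodType C) (z w : V) :
  nrm (z + w) ^+ 2 <= 2 * (nrm z ^+ 2 + nrm w ^+ 2).
Proof.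
have h := nrmD z w; have z0 := nrm_ge0 z; have w0 := nrm_ge0 w.
have p0 := nrm_ge0 (z + w).
apply: (@le_trans _ _ ((nrm z + nrm w) ^+ 2)).
  by rewrite ler_pXn2r// nnegrE ?addr_ge0.
have := sqr_ge0 (nrm z - nrm w); rewrite !expr2; lra.
Qed.

Lemma sqsumD A x y : sqsum A (x + y) <= 2 * (sqsum A x + sqsum A y).
Proof.
rewrite /sqsum -big_split /= mulr_sumr; apply: ler_sum => i _.
exact: nrm_sqrD.
Qed.

Lemma sqsumZ A (c : C) x : sqsum A (c *: x) = nrm c ^+ 2 * sqsum A x.
Proof.
rewrite /sqsum mulr_sumr; apply: eq_bigr => i _.
by rewrite -exprMn -nrmM.
Qed.

Lemma l2_submod : submod_closed l2_pred.
Proof.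
split.
  apply/asboolP; exists 0 => A; rewrite /sqsum big1// => i _.
  by rewrite /= nrm0 expr0n.
move=> c x y /asboolP[M hM] /asboolP[N hN]; apply/asboolP.
exists (2 * (nrm c ^+ 2 * M + N)) => A; apply: (le_trans (sqsumD _ _ _)).
by rewrite ler_wpM2l// lerD// sqsumZ ler_wpM2l// sqr_ge0.
Qed.
HB.instance Definition _ := GRing.isSubmodClosed.Build C (Y -> C^o) l2_pred l2_submod.

Record l2 := L2 { l2val :> Y -> C^o; l2valP : l2val \in l2_pred }.
HB.instance Definition _ := [isSub for l2val].
HB.instance Definition _ := [Choice of l2 by <:].
HB.instance Definition _ := [SubChoice_isSubLmodule of l2 by <:].

Implicit Types x y z : l2.

Lemma l2P x y : (forall i, x i = y i) -> x = y.
Proof. by move=> h; apply: val_inj; apply/funext. Qed.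

Lemma l2DE x y i : (x + y) i = x i + y i. Proof. by []. Qed.
Lemma l2_sumE (I : Type) (s : seq I) (f : I -> l2) i :
  (\sum_(k <- s) f k) i = \sum_(k <- s) f k i.
Proof. by elim: s => [|k s IH]; rewrite ?big_nil ?big_cons// l2DE IH. Qed.

Lemma sqsum_cvg x :
  exists s : R, [/\ (sqsum A x @[A --> totally] --> s), forall A, sqsum A x <= s &
    forall M, (forall A, sqsum A x <= M) -> s <= M].
Proof.
have [M hM] := asboolW (l2valP x).
pose S := [set sqsum A x | A in [set: {fset Y}]].
have hs : has_sup S.
  split; first by exists (sqsum fset0 x), fset0.
  by exists M => _ [A _ <-].
have ub A : sqsum A x <= sup S by apply: sup_upper_bound => //; exists A.
exists (sup S); split=> //; last first.
  by move=> N hN; apply: ge_sup; [case: hs | move=> _ [A _ <-]].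
apply/cvgrPdist_lt => e e0.
have [_ [A _ <-] hA] := sup_adherent e0 hs.
exists A => // B /= AB.
rewrite ger0_norm ?subr_ge0//.
by rewrite ltrBlDr -ltrBlDl (lt_le_trans hA)// sqsum_sub.
Qed.

Definition hsq x : R := sval (cid (sqsum_cvg x)).
Lemma hsq_cvg x : sqsum A x @[A --> totally] --> hsq x.
Proof. by rewrite /hsq; case: cid => s []. Qed.
Lemma sqsum_le_hsq x A : sqsum A x <= hsq x.
Proof. by rewrite /hsq; case: cid => s []. Qed.
Lemma hsq_le x M : (forall A, sqsum A x <= M) -> hsq x <= M.
Proof. by rewrite /hsq; case: cid => s []/= _ _; apply. Qed.

Lemma hsq_ge0 x : 0 <= hsq x.
Proof. exact: le_trans (sqsum_ge0 fset0 x) (sqsum_le_hsq _ _). Qed.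

Lemma nrm_sqr_le_hsq x i : nrm (x i : C) ^+ 2 <= hsq x.
Proof. by apply: le_trans (sqsum_le_hsq x [fset i]%fset); rewrite /sqsum big_seq_fset1. Qed.

Definition ipsum (A : {fset Y}) x y : C^o := \sum_(i <- A) Num.conj (x i : C) * y i.

(** Square sums are monotone in the finite index set, hence converge; this identity transfers their
    convergence to the sums that define the inner product. *)
Lemma polarization (a b : C) : Num.conj a * b =
  4^-1 * ((nrm (a + b) ^+ 2)%:C - (nrm (a - b) ^+ 2)%:C
   - 'i * ((nrm (a + 'i * b) ^+ 2)%:C - (nrm (a - 'i * b) ^+ 2)%:C)).
Proof.
rewrite -!conj_mul !(rmorphB, rmorphD, rmorphM) /=.
have -> : Num.conj ('i : C) = - 'i by apply/eqP; rewrite eq_complex /= oppr0 !eqxx.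
have i2 : ('i : C) * 'i = -1 by rewrite -expr2 sqr_i.
by field: i2.
Qed.

Lemma ipsum_cvg_ex x y : exists s : C^o, ipsum A x y @[A --> totally] --> s.
Proof.
exists (4^-1 * (((hsq (x + y))%:C : C^o) - ((hsq (x - y))%:C : C^o)
   - 'i * (((hsq (x + 'i *: y))%:C : C^o) - ((hsq (x - 'i *: y))%:C : C^o)))).
have -> : ipsum ^~ x ^~ y = fun A => (4^-1 * (((sqsum A (x + y))%:C : C^o)
   - ((sqsum A (x - y))%:C : C^o)
   - 'i * (((sqsum A (x + 'i *: y))%:C : C^o) - ((sqsum A (x - 'i *: y))%:C : C^o))) : C^o).
  apply/funext => A; rewrite /sqsum !rmorph_sum /= -!sumrB !mulr_sumr -sumrB mulr_sumr.
  by apply: eq_bigr => i _; rewrite polarization.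
apply: ccvgMl; apply: ccvgB.
  by apply: ccvgB; apply: ccvg_real; exact: hsq_cvg.
by apply: ccvgMl; apply: ccvgB; apply: ccvg_real; exact: hsq_cvg.
Qed.

Definition ip x y : C := sval (cid (ipsum_cvg_ex x y)).
Lemma ip_cvg x y : ipsum A x y @[A --> totally] --> (ip x y : C^o).
Proof. by rewrite /ip; case: cid. Qed.

Lemma ip_unique x y (s : C^o) : ipsum A x y @[A --> totally] --> s -> ip x y = s.
Proof. exact: (@cvg_unique C^o (@norm_hausdorff _ C^o) _ _ _ _ (@ip_cvg x y)). Qed.

Lemma ipDr x y z : ip x (y + z) = ip x y + ip x z.
Proof.
apply: ip_unique.
have -> : (fun A => ipsum A x (y + z)) = (fun A => ipsum A x y + ipsum A x z).
  by apply/funext => A; rewrite /ipsum -big_split; apply: eq_bigr => i _; exact: mulrDr.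
by apply: ccvgD; exact: ip_cvg.
Qed.

Lemma ipZr (c : C) x y : ip x (c *: y) = c * ip x y.
Proof.
apply: ip_unique.
have -> : (fun A => ipsum A x (c *: y)) = (fun A => c * ipsum A x y : C^o).
  by apply/funext => A; rewrite /ipsum mulr_sumr; apply: eq_bigr => i _; exact: mulrCA.
by apply: ccvgMl; exact: ip_cvg.
Qed.

Lemma conj_swap (a b : C) : Num.conj b * a = Num.conj (Num.conj a * b).
Proof. by rewrite rmorphM /= conjCK mulrC. Qed.

Lemma ip_conj x y : ip y x = Num.conj (ip x y).
Proof.
apply: ip_unique.
have -> : (fun A => ipsum A y x) = (fun A => Num.conj (ipsum A x y : C) : C^o).
  apply/funext => A; rewrite /ipsum rmorph_sum; apply: eq_bigr => i _.
  exact: conj_swap.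
apply: (@cvg_comp _ _ _ (fun A => ipsum A x y) (fun z : C^o => Num.conj (z : C) : C^o)).
  exact: ip_cvg.
exact: (@cconj_continuous _ C^o id (fun=> cvg_id)).
Qed.

Lemma ipxx x : ip x x = (hsq x)%:C.
Proof.
apply: ip_unique.
have -> : (fun A => ipsum A x x) = (fun A => (sqsum A x)%:C : C^o).
  apply/funext => A; rewrite /ipsum /sqsum rmorph_sum; apply: eq_bigr => i _.
  by rewrite conj_mul.
by apply: ccvg_real; exact: hsq_cvg.
Qed.

End square_summable.

Section fast_complete.
Variables (R : realType) (V : normedModType R[i]).
Local Notation r := (@inv_succ R).

(** A Cauchy filter has, for every [n], a ball of radius [r n] among its members. Two such balls
    meet, so their centres form a sequence as in the hypothesis, and its limit is the limit of the
    filter. *)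
Lemma fast_complete :
  (forall u : nat -> V, (forall n m, nrm (u n - u m) <= r n + r m) ->
     exists x, forall n, nrm (u n - x) <= r n) ->
  forall F : set_system V, ProperFilter F -> cauchy F -> cvg F.
Proof.
move=> h F FF /cauchyP Fc.
have rc n : 0 < (r n)%:C by rewrite ltcR inv_succ_gt0.
have [u hu] := choice (fun n => Fc _ (rc n)).
have [|x hx] := h u.
  move=> n m; have [z [zn zm]] := filter_ex (filterI (hu n) (hu m)).
  rewrite -ball_normE /= in zn; rewrite -ball_normE /= in zm.
  apply: (le_trans (nrm_dist _ z _)); apply: lerD.
    by rewrite -nrm_le ltW.
  by rewrite nrmB -nrm_le ltW.
apply/cvg_ex; exists x; apply/cvgrPdist_lt => e e0.
have e0' : 0 < complex.Re e by move: e0; rewrite ltcE => /andP[].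
have eE : e = (complex.Re e)%:C by rewrite RRe_real// gtr0_real.
have [n rn] := inv_succ_lt (divr_gt0 e0' (ltr0n _ 2)).
apply: filterS (hu n) => z; rewrite -ball_normE /= => zn.
rewrite eE nrmE ltcR; apply: (le_lt_trans (nrm_dist _ (u n) _)).
rewrite [ltRHS]splitr ler_ltD//.
  by rewrite nrmB (le_trans (hx n))// ltW.
by rewrite -ltcR -nrmE (lt_trans zn)// ltcR.
Qed.
End fast_complete.

Section hilbert.
Variables (R : realType) (Y : choiceType).
Notation C := R[i].
Notation H := (l2 R Y).
Notation r := (@inv_succ R).
Implicit Types x y z : H.

Lemma ipDl x y z : ip (x + y) z = ip x z + ip y z.
Proof. by rewrite ip_conj ipDr rmorphD /= -!ip_conj. Qed.
Lemma ipZl (c : C) x z : ip (c *: x) z = Num.conj c * ip x z.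
Proof. by rewrite ip_conj ipZr rmorphM /= -ip_conj. Qed.
Lemma ipNr x z : ip x (- z) = - ip x z.
Proof. by rewrite -scaleN1r ipZr mulN1r. Qed.
Lemma ipNl x z : ip (- x) z = - ip x z.
Proof. by rewrite ip_conj ipNr rmorphN /= -ip_conj. Qed.
Lemma ipBr x y z : ip x (y - z) = ip x y - ip x z.
Proof. by rewrite ipDr ipNr. Qed.
Lemma ip0r x : ip x 0 = 0.
Proof. by rewrite -(scale0r 0) ipZr mul0r. Qed.
Lemma ip0l x : ip 0 x = 0.
Proof. by rewrite ip_conj ip0r rmorph0. Qed.

Lemma hsq0_eq0 x : hsq x = 0 -> x = 0.
Proof.
move=> x0; apply: l2P => i; apply: nrm0_eq0; apply/eqP.
rewrite -sqrf_eq0 eq_le sqr_ge0 andbT -x0; exact: nrm_sqr_le_hsq.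
Qed.

Lemma conj_real (a : R) : Num.conj (a%:C : C) = a%:C.
Proof. by apply/eqP; rewrite eq_complex /= oppr0 !eqxx. Qed.

Lemma ip_cauchy_schwarz x y : nrm (ip x y) ^+ 2 <= hsq x * hsq y.
Proof.
set a := hsq x; set c := ip x y.
have [a0|a0] := eqVneq a 0.
  by rewrite a0 /c (hsq0_eq0 a0) ip0l nrm0 expr0n mul0r.
have ap : 0 < a by rewrite lt_neqAle eq_sym a0 hsq_ge0.
(* This vector is [hsq x] times the component of [y] orthogonal to [x]; the scaling avoids a
   division. *)
have : 0 <= hsq (a%:C *: y - c *: x) by exact: hsq_ge0.
have -> : hsq (a%:C *: y - c *: x) = a * (a * hsq y - nrm c ^+ 2).
  apply: complexI; rewrite -ipxx.
  rewrite !(ipDl, ipDr, ipNl, ipNr, ipZl, ipZr) !ipxx (ip_conj x y) -/c conj_real -/a.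
  by have := conj_mul c; move: (nrm c ^+ 2) => n e; rewrite !(rmorphM, rmorphB) /= -e; ring.
by rewrite pmulr_rge0// subr_ge0.
Qed.

Definition hn x : R := Num.sqrt (hsq x).

Lemma hn_ge0 x : 0 <= hn x. Proof. exact: sqrtr_ge0. Qed.
Lemma hn_sqr x : hn x ^+ 2 = hsq x. Proof. by rewrite sqr_sqrtr ?hsq_ge0. Qed.

Lemma sqr_le_le (a b : R) : 0 <= b -> a ^+ 2 <= b ^+ 2 -> a <= b.
Proof.
move=> b0 ab; have [a0|a0] := leP a 0; first exact: le_trans a0 b0.
by rewrite -(@ler_pXn2r _ 2)// nnegrE ltW.
Qed.

Lemma nrm_ip x y : nrm (ip x y) <= hn x * hn y.
Proof.
apply: sqr_le_le; first by rewrite mulr_ge0 ?hn_ge0.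
by rewrite exprMn !hn_sqr ip_cauchy_schwarz.
Qed.

Lemma hnD x y : hn (x + y) <= hn x + hn y.
Proof.
apply: sqr_le_le; first by rewrite addr_ge0 ?hn_ge0.
have e : hsq (x + y) = hsq x + hsq y + 2 * complex.Re (ip x y).
  apply: complexI; rewrite -ipxx !(ipDl, ipDr) !ipxx (ip_conj x y).
  move: (ip x y) => [a b]; apply/eqP; rewrite eq_complex /=.
  by apply/andP; split; apply/eqP; ring.
rewrite hn_sqr e sqrrD !hn_sqr.
have := le_trans (ler_norm _) (le_trans (Re_le_nrm _) (nrm_ip x y)).
by rewrite mulr_natl; lra.
Qed.

Lemma hnZ (c : C) x : hn (c *: x) = nrm c * hn x.
Proof.
rewrite /hn -[nrm c in RHS]ger0_norm ?nrm_ge0// -sqrtr_sqr -sqrtrM ?sqr_ge0//.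
congr Num.sqrt; apply: complexI; rewrite -ipxx ipZl ipZr ipxx mulrA conj_mul.
by rewrite -rmorphM.
Qed.

Lemma hnN x : hn (- x) = hn x.
Proof. by rewrite -scaleN1r hnZ /nrm normrN1 mul1r. Qed.
Lemma hnB x y : hn (x - y) = hn (y - x).
Proof. by rewrite -hnN opprB. Qed.
Lemma hn_dist x y z : hn (x - z) <= hn (x - y) + hn (y - z).
Proof. by rewrite -[x - z](subrKA y) hnD. Qed.
Lemma hn0 : hn 0 = 0.
Proof. by rewrite -(scale0r 0) hnZ nrm0 mul0r. Qed.
Lemma hn0_eq0 x : hn x = 0 -> x = 0.
Proof. by move=> x0; apply: hsq0_eq0; rewrite -hn_sqr x0 expr0n. Qed.

Lemma nrm_coord x i : nrm (x i : C) <= hn x.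
Proof. by apply: sqr_le_le; rewrite ?hn_ge0// hn_sqr nrm_sqr_le_hsq. Qed.

Lemma ip_ext y z : (forall x, ip x y = ip x z) -> y = z.
Proof.
move=> h; apply/eqP; rewrite -subr_eq0; apply/eqP/hsq0_eq0/complexI.
by rewrite -ipxx ipBr h subrr.
Qed.

Lemma l2_fast_limit (u : nat -> H) :
  (forall n m, hn (u n - u m) <= r n + r m) -> exists x, forall n, hn (u n - x) <= r n.
Proof.
move=> h.
have [z hz] : exists z : Y -> C^o, forall i n, nrm (u n i - z i : C) <= r n.
  have hi i : exists z : C^o, forall n, nrm (u n i - z : C) <= r n.
    apply: complex_fast_limit => n m; apply: le_trans (h n m).
    exact: (nrm_coord (u n - u m)).
  by have [z hz] := choice hi; exists z.
have r1 n : r n <= 1 by rewrite /inv_succ invf_le1// ler1n.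
(* On a fixed finite set, replacing [z] by [u m] costs a multiple of [r m] that depends on the size
   of [A] but vanishes as [m] grows, which leaves a bound independent of [A]. *)
have bnd n A : sqsum A (l2val (u n) - z) <= 2 * r n ^+ 2.
  apply: (@le_inv_succ _ (2 * (3 + (size A)%:R))) => m.
  have -> : l2val (u n) - z = l2val (u n - u m) + (l2val (u m) - z).
    by apply/funext => i; exact: (esym (subrKA (u m i) (u n i) (- z i))).
  apply: (le_trans (sqsumD _ _ _)).
  have h1 : sqsum A (l2val (u n - u m)) <= (r n + r m) ^+ 2.
    apply: (le_trans (sqsum_le_hsq _ _)); rewrite -hn_sqr.
    by rewrite ler_pXn2r ?nnegrE ?hn_ge0 ?addr_ge0 ?inv_succ_ge0.
  have h2 : sqsum A (l2val (u m) - z) <= (size A)%:R * r m.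
    rewrite /sqsum -sum1_size natr_sum mulr_suml; apply: ler_sum => i _.
    rewrite mul1r (@le_trans _ _ (r m ^+ 2))//.
      by rewrite ler_pXn2r ?nnegrE ?nrm_ge0 ?inv_succ_ge0//; exact: hz.
    by rewrite expr2 ler_piMr// inv_succ_ge0.
  have h3 : (r n + r m) ^+ 2 <= r n ^+ 2 + 3 * r m.
    have := r1 n; have := r1 m; have := inv_succ_gt0 R n; have := inv_succ_gt0 R m.
    rewrite !expr2; nra.
  by move: h1 h2 h3; rewrite mulrDr mulrDl; lra.
have uz n : l2val (u n) - z \in @l2_pred R Y.
  by apply/asboolP; exists (2 * r n ^+ 2); exact: bnd.
have zl : z \in @l2_pred R Y.
  rewrite (_ : z = l2val (u 0%N) - (l2val (u 0%N) - z)); last by rewrite subKr.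
  by rewrite rpredB// l2valP.
pose x : H := L2 zl.
have h2 m : hn (u m - x) <= 2 * r m.
  apply: sqr_le_le; first by rewrite mulr_ge0// inv_succ_ge0.
  rewrite hn_sqr; apply: (@le_trans _ _ (2 * r m ^+ 2)); first exact/hsq_le/bnd.
  by have := sqr_ge0 (r m); rewrite exprMn !expr2; lra.
exists x => n; apply: (@le_inv_succ _ 3) => m.
apply: (le_trans (hn_dist _ (u m) _)).
by apply: (le_trans (lerD (h n m) (h2 m))); rewrite -addrA lerD2l; lra.
Qed.

End hilbert.

(** * The C*-algebra of bounded operators *)

Section bounded_operators.
Variables (R : realType) (Y : choiceType).
Local Notation C := R[i].
Local Notation H := (l2 R Y).
Local Notation r := (@inv_succ R).
Implicit Types x y z : H.

(* Linearity is not required: it follows from the existence of the adjoint. *)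
Record bop := Bop {
  bfun :> H -> H;
  badj : H -> H;
  bop_bounded : exists2 c : R, 0 <= c & forall x, hn (bfun x) <= c * hn x;
  bop_adj : forall x y, ip (bfun x) y = ip x (badj y) }.
HB.instance Definition _ := gen_eqMixin bop.
HB.instance Definition _ := gen_choiceMixin bop.

Implicit Types S T U : bop.

(** The adjoint is determined by the operator, so the additional field [badj] does not affect
    equality. *)
Lemma bopP S T : (forall x, S x = T x) -> S = T.
Proof.
case: S T => f f' fb fa [g g' gb ga] /= /funext fg; subst g.
have e : f' = g' by apply/funext => y; apply: ip_ext => x; rewrite -fa ga.
by subst g'; congr Bop; exact: Prop_irrelevance.
Qed.

Lemma ip_extl y z : (forall x, ip y x = ip z x) -> y = z.
Proof. by move=> h; apply: ip_ext => x; rewrite ip_conj h -ip_conj. Qed.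

Lemma bopD T x y : T (x + y) = T x + T y.
Proof. by apply: ip_extl => z; rewrite !(bop_adj, ipDl). Qed.
Lemma bopZ T (c : C) x : T (c *: x) = c *: T x.
Proof. by apply: ip_extl => z; rewrite !(bop_adj, ipZl). Qed.

(** Divide [|T^* y|^2 = <T T^* y, y> <= c |T^* y| |y|] by [|T^* y|]. *)
Lemma badj_bounded T (c : R) : 0 <= c -> (forall x, hn (T x) <= c * hn x) ->
  forall x, hn (badj T x) <= c * hn x.
Proof.
move=> c0 h y; have [->|y0] := eqVneq (hn (badj T y)) 0.
  by rewrite mulr_ge0 ?hn_ge0.
have yp : 0 < hn (badj T y) by rewrite lt_neqAle eq_sym y0 hn_ge0.
rewrite -(ler_pM2l yp) -expr2 hn_sqr -(ger0_norm (hsq_ge0 _)) -nrm_real -ipxx -bop_adj.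
apply: (le_trans (nrm_ip _ _)); rewrite mulrA (mulrC (hn _) c).
by rewrite ler_wpM2r ?hn_ge0.
Qed.

Lemma bop_adjC T x y : ip (badj T x) y = ip x (T y).
Proof. by rewrite ip_conj -bop_adj -ip_conj. Qed.

Fact bop_star_bounded T : exists2 c : R, 0 <= c & forall x, hn (badj T x) <= c * hn x.
Proof. by have [c c0 h] := bop_bounded T; exists c => //; exact: badj_bounded. Qed.
Definition bop_star T := Bop (bop_star_bounded T) (bop_adjC T).

Fact bop_mul_bounded S T : exists2 c : R, 0 <= c & forall x, hn (S (T x)) <= c * hn x.
Proof.
have [c c0 h] := bop_bounded S; have [e e0 k] := bop_bounded T.
exists (c * e); rewrite ?mulr_ge0// => x.
by rewrite (le_trans (h _))// -mulrA ler_wpM2l.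
Qed.
Fact bop_mul_adj S T x y : ip (S (T x)) y = ip x (badj T (badj S y)).
Proof. by rewrite !bop_adj. Qed.
Definition bop_mul S T := Bop (bop_mul_bounded S T) (bop_mul_adj S T).

Fact bop_add_bounded S T : exists2 c : R, 0 <= c & forall x, hn (S x + T x) <= c * hn x.
Proof.
have [c c0 h] := bop_bounded S; have [e e0 k] := bop_bounded T.
exists (c + e); rewrite ?addr_ge0// => x.
by rewrite (le_trans (hnD _ _))// mulrDl lerD.
Qed.
Fact bop_add_adj S T x y : ip (S x + T x) y = ip x (badj S y + badj T y).
Proof. by rewrite ipDl ipDr !bop_adj. Qed.
Definition bop_add S T := Bop (bop_add_bounded S T) (bop_add_adj S T).

Fact bop_scale_bounded (c : C) T :
  exists2 e : R, 0 <= e & forall x, hn (c *: T x) <= e * hn x.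
Proof.
have [e e0 k] := bop_bounded T; exists (nrm c * e); rewrite ?mulr_ge0 ?nrm_ge0// => x.
by rewrite hnZ -mulrA ler_wpM2l ?nrm_ge0.
Qed.
Fact bop_scale_adj (c : C) T x y : ip (c *: T x) y = ip x (Num.conj c *: badj T y).
Proof. by rewrite ipZl ipZr !bop_adj. Qed.
Definition bop_scale c T := Bop (bop_scale_bounded c T) (bop_scale_adj c T).

Fact bop_zero_bounded : exists2 c : R, 0 <= c & forall x, hn (0 : H) <= c * hn x.
Proof. by exists 0 => // x; rewrite hn0 mul0r. Qed.
Fact bop_zero_adj x y : ip 0 y = ip x 0.
Proof. by rewrite ip0l ip0r. Qed.
Definition bop_zero := Bop bop_zero_bounded bop_zero_adj.

Fact bop_addA : associative bop_add.
Proof. by move=> S T U; apply: bopP => x; exact: addrA. Qed.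
Fact bop_addC : commutative bop_add.
Proof. by move=> S T; apply: bopP => x; exact: addrC. Qed.
Fact bop_add0 : left_id bop_zero bop_add.
Proof. by move=> S; apply: bopP => x; exact: add0r. Qed.
Fact bop_addN : left_inverse bop_zero (bop_scale (-1)) bop_add.
Proof. by move=> S; apply: bopP => x; rewrite /= scaleN1r addNr. Qed.
HB.instance Definition _ := GRing.isZmodule.Build bop bop_addA bop_addC bop_add0 bop_addN.

Fact bop_scaleA (c e : C) T : bop_scale c (bop_scale e T) = bop_scale (c * e) T.
Proof. by apply: bopP => x; exact: scalerA. Qed.
Fact bop_scale1 : left_id 1 bop_scale.
Proof. by move=> T; apply: bopP => x; exact: scale1r. Qed.
Fact bop_scaleDr : right_distributive bop_scale +%R.
Proof. by move=> c S T; apply: bopP => x; exact: scalerDr. Qed.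
Fact bop_scaleDl T : {morph bop_scale^~ T : c e / c + e}.
Proof. by move=> c e; apply: bopP => x; exact: scalerDl. Qed.
HB.instance Definition _ := GRing.Zmodule_isLmodule.Build C bop
  bop_scaleA bop_scale1 bop_scaleDr bop_scaleDl.

Fact bop_mulA : associative bop_mul.
Proof. by move=> S T U; apply: bopP. Qed.
Fact bop_mulDl : left_distributive bop_mul +%R.
Proof. by move=> S T U; apply: bopP. Qed.
Fact bop_mulDr : right_distributive bop_mul +%R.
Proof. by move=> S T U; apply: bopP => x; exact: bopD. Qed.
Fact bop_mulZl (c : C) S T : bop_mul (c *: S) T = c *: bop_mul S T.
Proof. exact: bopP. Qed.
Fact bop_mulZr (c : C) S T : bop_mul S (c *: T) = c *: bop_mul S T.
Proof. by apply: bopP => x; exact: bopZ. Qed.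
Fact bop_starK : involutive bop_star.
Proof. by move=> T; apply: bopP. Qed.
Fact bop_starD : {morph bop_star : S T / S + T}.
Proof. by move=> S T; apply: bopP. Qed.
Fact bop_starZ (c : C) T : bop_star (c *: T) = Num.conj c *: bop_star T.
Proof. exact: bopP. Qed.
Fact bop_starM S T : bop_star (bop_mul S T) = bop_mul (bop_star T) (bop_star S).
Proof. exact: bopP. Qed.
HB.instance Definition _ := Lmodule_isStarAlgebra.Build C bop
  bop_mulA bop_mulDl bop_mulDr bop_mulZl bop_mulZr
  bop_starK bop_starD bop_starZ bop_starM.

Lemma bop_subE S T x : (S - T) x = S x - T x.
Proof. by rewrite [LHS]/= scaleN1r. Qed.

Lemma badj_sub S T x : badj (S - T) x = badj S x - badj T x.
Proof. by rewrite [LHS]/= rmorphN1 scaleN1r. Qed.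

Definition opn T : R := inf [set c | 0 <= c /\ forall x, hn (T x) <= c * hn x].

Lemma opn_has_inf T : has_inf [set c | 0 <= c /\ forall x, hn (T x) <= c * hn x].
Proof.
split; first by have [c c0 h] := bop_bounded T; exists c.
by exists 0 => c [].
Qed.

Lemma opn_ge0 T : 0 <= opn T.
Proof. by apply: lb_le_inf; [case: (opn_has_inf T) | move=> c []]. Qed.

Lemma opn_le T c : 0 <= c -> (forall x, hn (T x) <= c * hn x) -> opn T <= c.
Proof. by move=> c0 h; apply: ge_inf => //; case: (opn_has_inf T). Qed.

Lemma le_opn T x : hn (T x) <= opn T * hn x.
Proof.
have [x0|x0] := eqVneq (hn x) 0.
  by have [c c0 h] := bop_bounded T; apply: le_trans (h x) _; rewrite x0 !mulr0.
have xp : 0 < hn x by rewrite lt_neqAle eq_sym x0 hn_ge0.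
rewrite -ler_pdivrMr//; apply: lb_le_inf; first by case: (opn_has_inf T).
by move=> c [c0 h]; rewrite ler_pdivrMr.
Qed.

Lemma opnD S T : opn (S + T) <= opn S + opn T.
Proof.
apply: opn_le => [|x]; first by rewrite addr_ge0 ?opn_ge0.
by apply: (le_trans (hnD _ _)); rewrite mulrDl lerD ?le_opn.
Qed.

Lemma opnZ_le (c : C) T : opn (c *: T) <= nrm c * opn T.
Proof.
apply: opn_le => [|x]; first by rewrite mulr_ge0 ?nrm_ge0 ?opn_ge0.
by rewrite /= hnZ -mulrA ler_wpM2l ?nrm_ge0 ?le_opn.
Qed.

Lemma opn0 : opn 0 = 0.
Proof.
apply/eqP; rewrite eq_le opn_ge0 andbT; apply: opn_le => // x.
by rewrite /= hn0 mul0r.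
Qed.

Lemma opnZ (c : C) T : opn (c *: T) = nrm c * opn T.
Proof.
have [->|c0] := eqVneq c 0; first by rewrite scale0r opn0 nrm0 mul0r.
apply/eqP; rewrite eq_le opnZ_le /=.
have h := opnZ_le c^-1 (c *: T); rewrite scalerA mulVf// scale1r in h.
have cp : 0 < nrm c.
  by rewrite lt_neqAle nrm_ge0 andbT eq_sym; apply: contraNneq c0 => /nrm0_eq0 ->.
rewrite mulrC -ler_pdivlMr// (le_trans h)// mulrC.
suff -> : nrm c^-1 = (nrm c)^-1 by [].
by apply: (mulIf (lt0r_neq0 cp)); rewrite -nrmM mulVf// mulVf ?lt0r_neq0// /nrm normr1.
Qed.

Lemma opn0_eq0 T : opn T = 0 -> T = 0.
Proof.
move=> T0; apply: bopP => x; apply: hn0_eq0; apply/eqP.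
by rewrite eq_le hn_ge0 andbT (le_trans (le_opn T x))// T0 mul0r.
Qed.

Fact bop_normD S T : (opn (S + T))%:C <= (opn S)%:C + (opn T)%:C.
Proof. by rewrite -rmorphD lecR opnD. Qed.
Fact bop_normZ (c : C) T : (opn (c *: T))%:C = `|c| * (opn T)%:C.
Proof. by rewrite opnZ rmorphM nrmE. Qed.
Fact bop_norm0 T : (opn T)%:C = 0 -> T = 0.
Proof. by move/complexI/opn0_eq0. Qed.
HB.instance Definition _ := Lmodule_isNormed.Build C bop bop_normD bop_normZ bop_norm0.

Lemma nrm_bop T : nrm T = opn T. Proof. by []. Qed.

Lemma opn_star T : opn (star T) = opn T.
Proof.
have h S : opn (star S) <= opn S.
  apply: opn_le => [|x]; first exact: opn_ge0.
  by apply: badj_bounded => [|y]; rewrite ?opn_ge0 ?le_opn.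
by apply/eqP; rewrite eq_le h -[X in opn X <= _]starK h.
Qed.

Lemma opnM S T : opn (S ** T) <= opn S * opn T.
Proof.
apply: opn_le => [|x]; first by rewrite mulr_ge0 ?opn_ge0.
by apply: (le_trans (le_opn S (T x))); rewrite -mulrA ler_wpM2l ?opn_ge0 ?le_opn.
Qed.

(** The nontrivial half comes from [|T x|^2 = <x, T^* T x>] and the Cauchy-Schwarz inequality. *)
Lemma opn_cstar T : opn (star T ** T) = opn T ^+ 2.
Proof.
apply/eqP; rewrite eq_le; apply/andP; split.
  by apply: (le_trans (opnM _ _)); rewrite opn_star.
have p0 := opn_ge0 (star T ** T).
rewrite -[leRHS]sqr_sqrtr// ler_pXn2r ?nnegrE ?opn_ge0 ?sqrtr_ge0//.
apply: opn_le => [|x]; first exact: sqrtr_ge0.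
apply: sqr_le_le; first by rewrite mulr_ge0 ?sqrtr_ge0 ?hn_ge0.
rewrite hn_sqr exprMn sqr_sqrtr// -[leLHS](ger0_norm (hsq_ge0 _)) -nrm_real -ipxx bop_adj.
apply: (le_trans (nrm_ip _ _)); rewrite mulrC expr2 mulrA.
by rewrite ler_wpM2r ?hn_ge0//; exact: (le_opn (star T ** T)).
Qed.

(** The involution preserves the operator norm, so the adjoints converge pointwise at the same rate.
    The two pointwise limits are adjoint to each other, which makes the limit an element of
    [bop]. *)
Lemma bop_fast_limit (u : nat -> bop) :
  (forall n m, nrm (u n - u m) <= r n + r m) ->
  exists T, forall n, nrm (u n - T) <= r n.
Proof.
move=> h.
(* The rate at [x] carries the factor [hn x]; dividing by it brings the sequence to the fixed rate
   of [l2_fast_limit]. *)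
have lim (v : nat -> H -> H) x : (forall n m, hn (v n x - v m x) <= (r n + r m) * hn x) ->
    exists y, forall n, hn (v n x - y) <= r n * hn x.
  have [x0|x0] := eqVneq (hn x) 0.
    move=> hv; exists (v 0%N x) => n.
    by apply: (le_trans (hv _ _)); rewrite x0 !mulr0.
  have xp : 0 < hn x by rewrite lt_neqAle eq_sym x0 hn_ge0.
  have nx : nrm ((hn x)^-1%:C : C) = (hn x)^-1.
    by rewrite nrm_real ger0_norm// invr_ge0 ltW.
  move=> hv; have [n m|y hy] := @l2_fast_limit R Y (fun n => (hn x)^-1%:C *: v n x).
    rewrite -scalerBr hnZ nx -(ler_pM2r xp) mulrAC mulVf// mul1r; exact: hv.
  exists ((hn x)%:C *: y) => n.
  have -> : v n x - (hn x)%:C *: y = (hn x)%:C *: ((hn x)^-1%:C *: v n x - y).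
    by rewrite scalerBr scalerA -rmorphM mulfV// scale1r.
  rewrite hnZ nrm_real ger0_norm ?(ltW xp)// mulrC.
  by apply: ler_wpM2r; [exact: ltW | exact: hy].
have h1 x n m : hn (u n x - u m x) <= (r n + r m) * hn x.
  rewrite -bop_subE; apply: (le_trans (le_opn (u n - u m) x)).
  by rewrite ler_wpM2r ?hn_ge0//; exact: h.
have h2 x n m : hn (badj (u n) x - badj (u m) x) <= (r n + r m) * hn x.
  rewrite -badj_sub; apply: (le_trans (le_opn (star (u n - u m)) x)).
  by rewrite ler_wpM2r ?hn_ge0// opn_star; exact: h.
have [T hT] := choice (fun x => lim (fun n => u n) x (h1 x)).
have [T' hT'] := choice (fun x => lim (fun n => badj (u n)) x (h2 x)).
have Tb : exists2 c : R, 0 <= c & forall x, hn (T x) <= c * hn x.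
  exists (opn (u 0%N) + r 0); first by rewrite addr_ge0 ?opn_ge0 ?inv_succ_ge0.
  move=> x; rewrite -[T x](subrK (u 0%N x)) addrC mulrDl.
  apply: (le_trans (hnD _ _)); apply: lerD; first exact: le_opn.
  by rewrite hnB; exact: hT.
have Ta x y : ip (T x) y = ip x (T' y).
  apply/eqP; rewrite -subr_eq0; apply/eqP/nrm0_eq0/eqP.
  rewrite eq_le nrm_ge0 andbT; apply: (@le_inv_succ _ (2 * hn x * hn y)) => n.
  have -> : ip (T x) y - ip x (T' y) = ip (T x - u n x) y + ip x (badj (u n) y - T' y).
    by rewrite ipDl ipNl ipBr bop_adj addrA subrK.
  have e1 := nrm_ip (T x - u n x) y; have e2 := nrm_ip x (badj (u n) y - T' y).
  apply: (le_trans (nrmD _ _)); apply: (le_trans (lerD e1 e2)).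
  have f1 : hn (T x - u n x) * hn y <= r n * hn x * hn y.
    by rewrite ler_wpM2r ?hn_ge0// hnB.
  have f2 : hn x * hn (badj (u n) y - T' y) <= hn x * (r n * hn y).
    by rewrite ler_wpM2l ?hn_ge0.
  apply: (le_trans (lerD f1 f2)); rewrite add0r le_eqVlt; apply/orP; left.
  by apply/eqP; ring.
exists (Bop Tb Ta) => n; rewrite nrm_bop; apply: opn_le; first exact: inv_succ_ge0.
by move=> x; rewrite bop_subE; exact: hT.
Qed.

HB.instance Definition _ := Uniform_isComplete.Build bop (fast_complete bop_fast_limit).

Fact bop_norm_mul S T : `|S ** T| <= `|S| * `|T|.
Proof. by rewrite !nrmE -rmorphM lecR opnM. Qed.
Fact bop_norm_star T : `|star T ** T| = `|T| ^+ 2.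
Proof. by rewrite !nrmE nrm_bop opn_cstar rmorphXn. Qed.
HB.instance Definition _ := StarAlgebra_isCStarAlgebra.Build R bop
  bop_norm_mul bop_norm_star.

End bounded_operators.

(** * Isometry of injective representations of C(X) *)

Lemma smulNl (C : numClosedFieldType) (A : starAlgType C) (x y : A) :
  (- x) ** y = - (x ** y).
Proof. by rewrite -scaleN1r smulZl scaleN1r. Qed.

Lemma smulNr (C : numClosedFieldType) (A : starAlgType C) (x y : A) :
  x ** (- y) = - (x ** y).
Proof. by rewrite -scaleN1r smulZr scaleN1r. Qed.

Lemma starN (C : numClosedFieldType) (A : starAlgType C) (x : A) : star (- x) = - star x.
Proof. by rewrite -scaleN1r starZ rmorphN1 scaleN1r. Qed.

Section cstar_norm.
Variables (R : realType) (O : cstarAlgType R).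
Implicit Types x y : O.

Lemma nrm_smul x y : nrm (x ** y) <= nrm x * nrm y.
Proof. by have := norm_smul_le x y; rewrite !nrmE -rmorphM lecR. Qed.

Lemma nrm_cstar x : nrm (star x ** x) = nrm x ^+ 2.
Proof. by apply: complexI; rewrite -nrmE norm_star_smul nrmE rmorphXn. Qed.

Lemma nrm_star x : nrm (star x) = nrm x.
Proof.
have h y : nrm y <= nrm (star y).
  have [->|y0] := eqVneq (nrm y) 0; first exact: nrm_ge0.
  have yp : 0 < nrm y by rewrite lt_neqAle eq_sym y0 nrm_ge0.
  by rewrite -(ler_pM2r yp) -expr2 -nrm_cstar nrm_smul.
by apply/eqP; rewrite eq_le h -[X in _ <= nrm X]starK h.
Qed.

Lemma star_smul_eq0 x : star x ** x = 0 -> x = 0.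
Proof.
move=> h; apply: nrm0_eq0; apply/eqP.
by rewrite -sqrf_eq0 -nrm_cstar h nrm0.
Qed.

End cstar_norm.

Section star_hom_theory.
Variables (C : numClosedFieldType) (A B : starAlgType C) (f : A -> B).
Hypothesis fh : star_hom f.

Lemma homM x y : f (x ** y) = f x ** f y.
Proof. by case: fh => _ ->. Qed.
Lemma homS x : f (star x) = star (f x).
Proof. by case: fh => _ _ ->. Qed.
Lemma homD x y : f (x + y) = f x + f y.
Proof. by case: fh => l _ _; have := l 1 x y; rewrite !scale1r. Qed.
Lemma hom0 : f 0 = 0.
Proof. by case: fh => l _ _; have := l (-1) 0 0; rewrite scaler0 addr0 scaleN1r addNr. Qed.
Lemma homZ c x : f (c *: x) = c *: f x.
Proof. by case: fh => l _ _; have := l c x 0; rewrite hom0 !addr0. Qed.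
Lemma homN x : f (- x) = - f x.
Proof. by rewrite -scaleN1r homZ scaleN1r. Qed.
Lemma homB x y : f (x - y) = f x - f y.
Proof. by rewrite homD homN. Qed.
Lemma hom_sum (I : Type) (s : seq I) (F : I -> A) :
  f (\sum_(i <- s) F i) = \sum_(i <- s) f (F i).
Proof. exact: (big_morph f homD hom0). Qed.
End star_hom_theory.

Section function_algebra.
Variables (R : realType) (X : topologicalType).
Local Notation C := R[i].
Local Notation A := (cfun R X).
Local Notation r := (@inv_succ R).
Implicit Types f g : A.

Lemma cfunDE f g x : (f + g) x = f x + g x. Proof. by []. Qed.
Lemma cfunNE f x : (- f) x = - f x. Proof. by []. Qed.
Lemma cfunZE (c : C) f x : (c *: f) x = (c * f x : C). Proof. by []. Qed.
Lemma cfunME f g x : (f ** g) x = (f x * g x : C). Proof. by []. Qed.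
Lemma cfunSE f x : star f x = Num.conj (f x : C). Proof. by []. Qed.
Lemma cfun_sumE (I : Type) (s : seq I) (F : I -> A) x :
  (\sum_(i <- s) F i) x = \sum_(i <- s) F i x.
Proof. by elim: s => [|i s IH]; rewrite ?big_nil ?big_cons// cfunDE IH. Qed.

Lemma cfun_mulC f g : f ** g = g ** f.
Proof. by apply: cfunP => x; exact: (@mulrC C). Qed.
Lemma cfun_mul1 f : cfun_const 1 ** f = f.
Proof. by apply: cfunP => x; exact: (@mul1r C). Qed.

Lemma real_fun_continuous (h : X -> R) :
  continuous h -> continuous (fun x => (h x)%:C : C^o).
Proof.
by move=> ch x; apply: (@continuous_comp _ _ _ h (real_complex R : R -> C^o));
  [exact: ch | exact: rc_continuous].
Qed.
Definition real_cfun (h : X -> R) (ch : continuous h) : A := mkC (real_fun_continuous ch).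

Lemma nrm_sqr_continuous f : continuous (fun x => nrm (f x : C) ^+ 2).
Proof.
have -> : (fun x => nrm (f x : C) ^+ 2) = (fun x => complex.Re ((star f ** f) x)).
  by apply/funext => x; rewrite cfunME cfunSE conj_mul.
move=> x; apply: (@continuous_comp _ _ _ (star f ** f) (fun z : C^o => complex.Re z)).
  exact: cts_fun.
exact: Re_continuous.
Qed.

Lemma star_mul_real f : star f ** f = real_cfun (nrm_sqr_continuous (f := f)).
Proof. by apply: cfunP => x; exact: conj_mul. Qed.

Section representation.
Variables (O : cstarAlgType R) (pi : A -> O).
Hypothesis hpi : star_hom pi.

Lemma hom_one_le : nrm (pi (cfun_const 1)) <= 1.
Proof.
set e := pi _.
have ee : star e ** e = e.
  by rewrite /e -(homS hpi) -(homM hpi) cfun_mulC cfun_mul1; congr (pi _);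
    apply: cfunP => x; rewrite cfunSE conjC1.
have := nrm_cstar e; rewrite ee => h.
have [->//|e0] := eqVneq (nrm e) 0.
by rewrite -(mulfI e0 (etrans (mulr1 _) h)).
Qed.

Lemma hom_unitary_le f : (forall x, nrm (f x : C) = 1) -> nrm (pi f) <= 1.
Proof.
move=> f1; rewrite -(@ler_pXn2r _ 2) ?nnegrE ?nrm_ge0// -nrm_cstar expr1n.
rewrite -(homS hpi) -(homM hpi); have -> : star f ** f = cfun_const 1.
  by apply: cfunP => x; rewrite cfunME cfunSE conj_mul f1 expr1n.
exact: hom_one_le.
Qed.

(* A real function h with values in [-1,1] is the average of the unitary functions
   h + i sqrt(1-h^2) and h - i sqrt(1-h^2). *)
Lemma hom_real_le (h : X -> R) (ch : continuous h) :
  (forall x, `|h x| <= 1) -> nrm (pi (real_cfun ch)) <= 1.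
Proof.
move=> h1.
have cs : continuous (fun x => Num.sqrt (1 - h x ^+ 2)).
  move=> x; apply: (@continuous_comp _ _ _ (fun x => 1 - h x ^+ 2) Num.sqrt); last first.
    exact: sqrt_continuous.
  apply: cvgB; first exact: cvg_cst.
  by rewrite expr2; apply: cvgM; exact: ch.
pose u := real_cfun ch + 'i *: real_cfun cs.
have nu x : nrm (u x : C) = 1.
  have -> : u x = h x +i* Num.sqrt (1 - h x ^+ 2) :> C.
    by apply/eqP; rewrite eq_complex /=; apply/andP; split; apply/eqP; ring.
  rewrite /nrm normc_def /= sqr_sqrtr; first by rewrite addrCA subrr addr0 sqrtr1.
  by rewrite subr_ge0 -real_normK ?num_real// exprn_ile1.
have -> : real_cfun ch = 2^-1 *: (u + star u).
  apply: cfunP => x; rewrite cfunZE cfunDE cfunSE.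
  by apply/eqP; rewrite eq_complex /=; apply/andP; split; apply/eqP; field.
rewrite (homZ hpi) nrmZ (homD hpi).
have n2 : nrm (2^-1 : C) = 2^-1.
  by rewrite (_ : 2^-1 = (2^-1 : R)%:C) ?nrm_real ?ger0_norm ?invr_ge0// fmorphV rmorph_nat.
rewrite n2 ler_pdivrMl// mulr1; apply: (le_trans (nrmD _ _)).
have hu := hom_unitary_le nu.
have hu' : nrm (pi (star u)) <= 1 by rewrite (homS hpi) nrm_star.
by rewrite -[leRHS]natr1 lerD.
Qed.

(** The C*-identity replaces [f] by [star f ** f], which is [c ^+ 2] times a real function with
    values in [0,1]. *)
Lemma hom_le f (c : R) : 0 <= c -> (forall x, nrm (f x : C) <= c) -> nrm (pi f) <= c.
Proof.
move=> c0 fc; have [cz|cz] := eqVneq c 0.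
  suff -> : f = 0 by rewrite (hom0 hpi) nrm0.
  apply: cfunP => x; apply: nrm0_eq0; apply/eqP.
  by rewrite eq_le nrm_ge0 andbT -cz fc.
have cp : 0 < c by rewrite lt_neqAle eq_sym cz.
have ch : continuous (fun x => (c ^- 2) * nrm (f x : C) ^+ 2).
  by move=> x; apply: cvgM; [exact: cvg_cst | exact: nrm_sqr_continuous].
rewrite -(@ler_pXn2r _ 2) ?nnegrE ?nrm_ge0// -nrm_cstar -(homS hpi) -(homM hpi).
have -> : star f ** f = (c ^+ 2)%:C *: real_cfun ch.
  apply: cfunP => x; rewrite cfunME cfunSE conj_mul cfunZE /= -rmorphM /=.
  by rewrite mulrA mulfV ?mul1r// expf_neq0.
rewrite (homZ hpi) nrmZ nrm_real ger0_norm ?sqr_ge0// ler_piMr ?sqr_ge0//.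
apply: hom_real_le => x; rewrite ger0_norm; last first.
  by apply: mulr_ge0; rewrite ?invr_ge0 sqr_ge0.
by rewrite mulrC ler_pdivrMr ?exprn_gt0// mul1r ler_pXn2r ?nnegrE ?nrm_ge0.
Qed.

Hypothesis pi_inj : injective pi.

(* If the norm of pi g is less than c < g x for some g >= 0, the bump
   (m - c) / m with m = max(g, c) equals g ^ n times a function bounded by c ^ - n,
   so that pi maps it to 0. *)
Lemma le_hom f x : nrm (f x : C) <= nrm (pi f).
Proof.
rewrite -(@ler_pXn2r _ 2) ?nnegrE ?nrm_ge0// -nrm_cstar -(homS hpi) -(homM hpi).
rewrite leNgt; apply/negP; set G := star f ** f; set p := nrm (pi G).
pose g y := nrm (f y : C) ^+ 2; rewrite -/(g x) => pg.
have p0 : 0 <= p by exact: nrm_ge0.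
pose c := (p + g x) / 2.
have pc : p < c by rewrite /c; lra.
have cg : c < g x by rewrite /c; lra.
have c0 : 0 < c by exact: le_lt_trans pc.
pose m y := Num.max (g y) c.
have mc y : c <= m y by rewrite le_max lexx orbT.
have m0 y : 0 < m y by exact: lt_le_trans (mc y).
have cm : continuous m.
  move=> y; apply: (@continuous_max _ _ g (fun=> c)).
    exact: nrm_sqr_continuous.
  exact: cvg_cst.
have cq n : continuous (fun y => (m y - c) * (m y)^-1 ^+ n.+1).
  move=> y; apply: cvgM; first by apply: cvgB; [exact: cm | exact: cvg_cst].
  apply: (@continuous_comp _ _ _ (fun y => (m y)^-1) (fun t => t ^+ n.+1)).
    by apply: cvgV; [exact: lt0r_neq0 | exact: cm].
  exact: exprn_continuous.
pose q n := real_cfun (cq n).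
have qS n : q n = G ** q n.+1.
  apply: cfunP => y; rewrite cfunME /G star_mul_real /= -rmorphM /= -/(g y).
  congr (_%:C); rewrite [X in _ = _ * (_ * X)]exprSr /m; have [gc|gc] := leP (g y) c.
    by rewrite subrr !mul0r mulr0.
  by move: ((g y)^-1 ^+ n.+1) => P; field; rewrite lt0r_neq0// (lt_trans c0).
have qb n : nrm (pi (q n)) <= c^-1 ^+ n.
  apply: hom_le => [|y]; first by rewrite exprn_ge0// invr_ge0 ltW.
  rewrite /= nrm_real ger0_norm; last first.
    by rewrite mulr_ge0 ?subr_ge0// exprn_ge0// invr_ge0 ltW.
  rewrite exprS mulrA -[leRHS]mul1r; apply: ler_pM.
  - by rewrite divr_ge0 ?subr_ge0// ltW.
  - by rewrite exprn_ge0// invr_ge0 ltW.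
  - by rewrite ler_pdivrMr// mul1r gerBl ltW.
  by rewrite lerXn2r ?nnegrE ?invr_ge0 ?(ltW c0) ?(ltW (m0 y))// lef_pV2 ?posrE.
pose t := p / c.
have t0 : 0 <= t by rewrite divr_ge0// ltW.
have t1 : t < 1 by rewrite ltr_pdivrMr// mul1r.
have q0 n : nrm (pi (q 0%N)) <= t ^+ n.
  have : nrm (pi (q 0%N)) <= p ^+ n * nrm (pi (q n)).
    elim: n => [|n IH]; first by rewrite expr0 mul1r.
    rewrite (le_trans IH)// exprSr -mulrA ler_wpM2l ?exprn_ge0//.
    by rewrite {1}qS (homM hpi) nrm_smul.
  by move/le_trans; apply; rewrite exprMn ler_wpM2l ?exprn_ge0.
have pq0 : pi (q 0%N) = pi 0.
  rewrite (hom0 hpi); apply: nrm0_eq0; apply/eqP; rewrite eq_le nrm_ge0 andbT leNgt.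
  apply/negP => qp.
  have /cvgrPdist_lt /(_ _ qp) [n _ hn] : (fun n => t ^+ n) @ \oo --> 0.
    by apply: cvg_expr; rewrite ger0_norm.
  have := hn n (leqnn n); rewrite sub0r normrN ger0_norm ?exprn_ge0//.
  by rewrite ltNge q0.
(* At [x] the bump has the value [(g x - c) / g x], which is positive. *)
have /complexI := congr1 (fun f : A => f x : C) (pi_inj pq0).
rewrite /= /m expr1 max_l ?(ltW cg)// => /eqP.
by rewrite mulf_eq0 invr_eq0 subr_eq0 !gt_eqF// (lt_trans c0).
Qed.

(** By [le_hom] the preimages of the approximants are uniformly Cauchy. Their pointwise limit is
    continuous by the usual three-term estimate, and [hom_le] carries the convergence back to
    [O]. *)
Lemma hom_range_closed (x : O) :
  (forall n, exists f, nrm (pi f - x) <= r n) -> exists f, pi f = x.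
Proof.
move=> /choice[u hu].
have cu n m y : nrm (u n y - u m y : C) <= r n + r m.
  apply: le_trans (le_hom (u n - u m) y) _; rewrite (homB hpi).
  by apply: (le_trans (nrm_dist _ x _)); rewrite lerD// nrmB.
have hf y : exists z : C^o, forall n, nrm (u n y - z : C) <= r n.
  by apply: complex_fast_limit => n m; exact: cu.
have [f {}hf] := choice hf.
have cf : continuous f.
  move=> y; apply/cvgrPdist_lt => e e0.
  have e0' : 0 < complex.Re e by move: e0; rewrite ltcE => /andP[].
  have eE : e = (complex.Re e)%:C by rewrite RRe_real// gtr0_real.
  have [n rn] := inv_succ_lt (divr_gt0 e0' (ltr0n _ 3)).
  have /cvgrPdist_lt /(_ _ e0) := @cts_fun _ _ (u n) y.
  have e30 : 0 < (complex.Re e / 3)%:C by rewrite ltcR divr_gt0.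
  have /cvgrPdist_lt /(_ _ e30) := @cts_fun _ _ (u n) y.
  apply: filterS2 => z; rewrite eE !nrmE !ltcR => h1 _.
  have h2 := hf y n; have h3 := hf z n; rewrite nrmB in h2.
  apply: (le_lt_trans (nrm_dist _ (u n y : C) _)).
  have := nrm_dist (u n y : C) (u n z) (f z).
  by move: h1 h2 h3 rn; lra.
exists (mkC cf); apply/eqP; rewrite -subr_eq0; apply/eqP/nrm0_eq0/eqP.
rewrite eq_le nrm_ge0 andbT; apply: (@le_inv_succ _ 2) => n.
rewrite add0r mulr_natl mulr2n; apply: (le_trans (nrm_dist _ (pi (u n)) _)).
rewrite lerD// nrmB -(homB hpi); apply: hom_le; first exact: inv_succ_ge0.
by move=> y; exact: hf.
Qed.

End representation.
End function_algebra.

(** * Density of Laurent polynomials on the torus *)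

Section roots_of_unity.
Variable R : realType.
Local Notation C := R[i].

(** The real part is [1 - 2 sin^2 (pi s)], and the sine is positive on the open interval from 0 to
    [pi]. *)
Lemma cis_neq1 (s : R) : 0 < s < 1 -> cis s != 1.
Proof.
move=> /andP[s0 s1]; apply/eqP => /(congr1 (@complex.Re R)) /=.
have -> : 2 * pi * s = (pi * s) *+ 2 by rewrite -[RHS]mulr_natl mulrA.
rewrite cos_mulr2n => h.
have sp : 0 < sin (pi * s).
  by apply: sin_gt0_pi; rewrite mulr_gt0 ?pi_gt0//= -[ltRHS]mulr1 ltr_pM2l ?pi_gt0.
have := cos2Dsin2 (pi * s); have := exprn_gt0 2 sp; move: h.
by rewrite mulr2n; lra.
Qed.

Lemma conj_cis (s : R) : Num.conj (cis s) = cis (- s).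
Proof. by apply/eqP; rewrite eq_complex /= mulrN cosN sinN !eqxx. Qed.

Lemma unity_root_sum (m : nat) (z : C) : z ^+ m = 1 -> z != 1 -> \sum_(i < m) z ^+ i = 0.
Proof.
move=> zm z1; have := subrX1 z m; rewrite zm subrr => /esym/eqP.
by rewrite mulf_eq0 subr_eq0 (negbTE z1) => /eqP.
Qed.

Lemma cis_div_neq1 (m k : nat) : (0 < k < m)%N -> cis (k%:R / m%:R : R) != 1.
Proof.
move=> /andP[k0 km]; have m0 : (0 < m)%N by exact: leq_trans km.
apply: cis_neq1; rewrite divr_gt0 ?ltr0n//=.
by rewrite ltr_pdivrMr ?ltr0n// mul1r ltr_nat.
Qed.

Lemma cis_nat (n : nat) : cis (n%:R : R) = 1.
Proof.
rewrite -[n%:R]mulr1 cisMn (_ : cis 1 = 1) ?expr1n//.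
by apply/eqP; rewrite eq_complex /= mulr1 mulr_natl cos2pi sin2pi !eqxx.
Qed.

(** Orthogonality of the characters of Z/m. The rotation [c] contributes a common factor which is 1
    for [k = l]; it is included because the fibres and the Fejer averages involve rotated roots of
    unity. *)
Lemma cis_root_sum (m k l : nat) (c : C) : nrm c = 1 -> (k < m)%N -> (l < m)%N ->
  \sum_(i < m) (c * cis (i%:R / m%:R)) ^+ k * Num.conj (c * cis (i%:R / m%:R)) ^+ l
  = if k == l then m%:R else 0.
Proof.
move=> c1 km lm; have m0 : (0 < m)%N by exact: leq_trans km.
have mR : (m%:R : R) != 0 by rewrite pnatr_eq0 -lt0n.
have cc : c * Num.conj c = 1 by rewrite mulrC conj_mul c1 expr1n.
pose z : C := cis ((k%:R - l%:R) / m%:R).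
have -> : \sum_(i < m) (c * cis (i%:R / m%:R)) ^+ k * Num.conj (c * cis (i%:R / m%:R)) ^+ l
    = (c ^+ k * Num.conj c ^+ l) * \sum_(i < m) z ^+ i.
  rewrite mulr_sumr; apply: eq_bigr => i _.
  rewrite rmorphM /= conj_cis !exprMn -!cisMn mulrACA; congr (_ * _).
  by rewrite -cisD; congr cis; field.
have [kl|kl] := eqVneq k l.
  rewrite /z -kl -exprMn cc expr1n mul1r subrr mul0r cis0.
  by under eq_bigr do rewrite expr1n; rewrite sumr_const card_ord.
rewrite unity_root_sum ?mulr0//.
  rewrite /z -cisMn mulrC mulfVK// cisD cisN !cis_nat invr1 mulr1//.
have [lk|lk] := ltnP l k.
  by rewrite /z -natrB ?(ltnW lk)// cis_div_neq1// subn_gt0 lk (leq_ltn_trans (leq_subr _ _)).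
rewrite /z -opprB mulNr cisN invr_eq1 -natrB// cis_div_neq1//.
by rewrite subn_gt0 ltn_neqAle kl lk (leq_ltn_trans (leq_subr _ _)).
Qed.

Definition fejer (n : nat) (z : C) : R := n%:R^-1 * nrm (\sum_(k < n) z ^+ k) ^+ 2.

Lemma fejer_ge0 n z : 0 <= fejer n z.
Proof. by rewrite mulr_ge0 ?invr_ge0 ?sqr_ge0. Qed.

Lemma fejerE n z :
  (fejer n z)%:C = n%:R^-1 * \sum_(k < n) \sum_(l < n) z ^+ k * Num.conj z ^+ l.
Proof.
rewrite /fejer rmorphM /= -conj_mul fmorphV rmorph_nat; congr (_ * _).
rewrite rmorph_sum mulr_suml exchange_big; apply: eq_bigr => k _ /=.
by rewrite mulr_sumr; apply: eq_bigr => l _; rewrite mulrC rmorphXn.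
Qed.

Section averages.
Variables (n m : nat) (c : C).
Hypotheses (n0 : (0 < n)%N) (nm : (n < m)%N) (c1 : nrm c = 1).
Local Notation w i := (c * cis (i%:R / m%:R)).

(** All exponents stay below [m], so averaging over the [m] rotated roots of unity is as exact as
    integration over the circle: only the [n] diagonal terms survive. *)
Lemma fejer_sum : \sum_(i < m) fejer n (w i) = m%:R.
Proof.
apply: complexI; rewrite rmorph_sum rmorph_nat /=.
under eq_bigr do rewrite fejerE.
rewrite -mulr_sumr exchange_big /=.
under eq_bigr => k _ do rewrite exchange_big /=.
under eq_bigr => k _.
  under eq_bigr => l _ do rewrite cis_root_sum ?(ltn_trans (ltn_ord _))//.
  rewrite (bigD1 k)//= eqxx big1 ?addr0; last first.
    by move=> l /negbTE lk; rewrite eq_sym [X in if X then _ else _]lk.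
  over.
by rewrite sumr_const card_ord -[m%:R *+ n]mulr_natl mulKf// pnatr_eq0 -lt0n.
Qed.

(* Since (1 - z) (1 + z + ... + z^(n-1)) = 1 - z^n. *)
Lemma fejer_sum_dist :
  \sum_(i < m) fejer n (w i) * nrm (1 - w i) ^+ 2 = m%:R * (2 / n%:R).
Proof.
have e i : fejer n (w i) * nrm (1 - w i) ^+ 2 = n%:R^-1 * nrm (1 - w i ^+ n) ^+ 2.
  rewrite /fejer -mulrA -exprMn -nrmM; congr (_ * nrm _ ^+ 2).
  by rewrite -opprB mulrN mulrC -subrX1 opprB.
under eq_bigr do rewrite e.
rewrite -mulr_sumr [RHS]mulrA [RHS]mulrC; congr (_ * _).
apply: complexI; rewrite rmorph_sum /=.
pose q i k l := w i ^+ k * Num.conj (w i) ^+ l.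
have -> : \sum_(i < m) (nrm (1 - w i ^+ n) ^+ 2)%:C =
    \sum_(i < m) (q i 0%N 0%N - q i n 0%N - q i 0%N n + q i n n).
  apply: eq_bigr => i _; rewrite -conj_mul /q rmorphB rmorph1 rmorphXn /=.
  by move: (w i) => z; ring.
(* The exponents are [0] and [n], both below [m]. The mixed terms vanish since [n] is positive, and
   the other two contribute [m] each. *)
rewrite big_split sumrB sumrB /= !cis_root_sum ?(ltn_trans n0)//.
have nz : (n == 0%N) = false by rewrite eqn0Ngt n0.
rewrite !eqxx (eq_sym 0%N) nz.
by rewrite !subr0 mulr_natr mulr2n rmorphD /= !rmorph_nat.
Qed.

End averages.
End roots_of_unity.

Section trigonometric_polynomials.
Variables (R : realType) (d : nat).
Local Notation C := R[i].
Local Notation T := (torus R d).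
Local Notation A := (cfun R T).

Lemma chi_continuous (nu : 'rV[int]_d) :
  continuous (fun t : T => \prod_(j < d) (set_val (t j) : C) ^ nu 0 j : C^o).
Proof.
apply: cprod_continuous => j; apply: cexpz_continuous; first exact: (@Defs.coord_continuous R d j).
by move=> t; exact: circle_neq0.
Qed.
Definition chi nu : A := mkC (@chi_continuous nu).

Lemma chiE nu t : chi nu t = \prod_(j < d) (set_val (t j) : C) ^ nu 0 j.
Proof. by []. Qed.

Lemma chiD mu nu : chi (mu + nu) = chi mu ** chi nu.
Proof.
apply: cfunP => t; rewrite cfunME !chiE -big_split; apply: eq_bigr => j _.
by rewrite mxE expfzDr ?circle_neq0.
Qed.

Definition trig : set A := lspan (range chi).

End trigonometric_polynomials.
Arguments chi {R d} nu.
Arguments trig {R d}.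

Section linear_span.
Variables (C : numClosedFieldType) (V : lmodType C) (X : set V).

Lemma lspan_sub x : X x -> lspan X x.
Proof.
move=> Xx; exists [:: (1, x)]; first by move=> p; rewrite inE => /eqP ->.
by rewrite big_seq1 scale1r.
Qed.
Lemma lspan0 : lspan X 0.
Proof. by exists [::]; rewrite ?big_nil. Qed.
Lemma lspanD x y : lspan X x -> lspan X y -> lspan X (x + y).
Proof.
move=> [s hs ->] [t ht ->]; exists (s ++ t); last by rewrite big_cat.
by move=> p; rewrite mem_cat => /orP[/hs|/ht].
Qed.
Lemma lspanZ c x : lspan X x -> lspan X (c *: x).
Proof.
move=> [s hs ->]; exists [seq (c * p.1, p.2) | p <- s].
  by move=> _ /mapP[p /hs hp ->].
by rewrite big_map scaler_sumr; apply: eq_bigr => p _; rewrite scalerA.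
Qed.
Lemma lspan_sum (I : Type) (s : seq I) (P : pred I) (F : I -> V) :
  (forall i, P i -> lspan X (F i)) -> lspan X (\sum_(i <- s | P i) F i).
Proof. by move=> h; apply: big_ind => //; [exact: lspan0 | exact: lspanD]. Qed.

Lemma lspan_min (W : set V) : W 0 -> (forall x y, W x -> W y -> W (x + y)) ->
  (forall c x, W x -> W (c *: x)) -> X `<=` W -> lspan X `<=` W.
Proof.
move=> W0 WD WZ XW _ [s hs ->]; elim: s hs => [|p s IH] hs; first by rewrite big_nil.
rewrite big_cons; apply: WD; first by apply/WZ/XW/hs; rewrite mem_head.
by apply: IH => q qs; apply: hs; rewrite inE qs orbT.
Qed.
End linear_span.

Section trig_theory.
Variables (R : realType) (d : nat).
Local Notation C := R[i].
Local Notation T := (torus R d).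
Local Notation A := (cfun R T).

Lemma trigM (f g : A) : trig f -> trig g -> trig (f ** g).
Proof.
move=> hf hg; move: f hf; apply: lspan_min.
- by rewrite smul0r; exact: lspan0.
- by move=> x y hx hy; rewrite smulDl; exact: lspanD.
- by move=> c x hx; rewrite smulZl; exact: lspanZ.
move=> _ [mu _ <-]; move: g hg; apply: lspan_min.
- by rewrite smul0; exact: lspan0.
- by move=> x y hx hy; rewrite smulDr; exact: lspanD.
- by move=> c x hx; rewrite smulZr; exact: lspanZ.
by move=> _ [nu _ <-]; apply: lspan_sub; exists (mu + nu); rewrite ?chiD.
Qed.

Lemma chi0 : chi (0 : 'rV[int]_d) = cfun_const 1 :> A.
Proof. by apply: cfunP => t; rewrite chiE big1// => j _; rewrite mxE expr0z. Qed.

Lemma trig_const c : trig (cfun_const c : A).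
Proof.
have -> : cfun_const c = c *: chi 0 :> A.
  by rewrite chi0; apply: cfunP => t; exact/esym/(@mulr1 C).
by apply: lspanZ; apply: lspan_sub; exists 0.
Qed.

Lemma chi_delta (j : 'I_d) (m : int) (t : T) :
  chi (m *: delta_mx 0 j) t = (set_val (t j) : C) ^ m.
Proof.
rewrite chiE (bigD1 j)//= big1 ?mulr1; last first.
  by move=> i ij; rewrite !mxE (negbTE ij) mulr0 expr0z.
by rewrite !mxE !eqxx mulr1.
Qed.

Lemma conj_circle (z : @circle R) : Num.conj (set_val z : C) = (set_val z : C)^-1.
Proof.
apply: (mulfI (circle_neq0 z)); rewrite mulfV ?circle_neq0//.
by rewrite mulrC conj_mul /nrm circleP expr1n.
Qed.

Lemma trig_prod (I : Type) (s : seq I) (F : I -> A) : (forall i, trig (F i)) ->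
  trig (\big[smul/cfun_const 1]_(i <- s) F i).
Proof. by move=> h; apply: big_ind => //; [exact: trig_const | exact: trigM]. Qed.

Lemma prod_cfunE (I : Type) (s : seq I) (F : I -> A) t :
  (\big[smul/cfun_const 1]_(i <- s) F i) t = \prod_(i <- s) (F i t : C).
Proof. by elim: s => [|i s IH]; rewrite ?big_nil ?big_cons// cfunME IH. Qed.

(** On the circle conjugation is inversion, so the double sum in [fejerE] is a Laurent polynomial in
    [t j] with exponents [l - k]. *)
Lemma trig_fejer n (w : C) (j : 'I_d) :
  exists2 K : A, trig K & forall t, K t = (fejer n (Num.conj (set_val (t j) : C) * w))%:C.
Proof.
pose c k l : C := n%:R^-1 * (w ^+ k * Num.conj w ^+ l).
exists (\sum_(k < n) \sum_(l < n) c k l *: chi ((l%:Z - k%:Z) *: delta_mx 0 j)).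
  by do 2![apply: lspan_sum => ? _]; apply: lspanZ; apply: lspan_sub; eexists.
move=> t; rewrite fejerE mulr_sumr cfun_sumE; apply: eq_bigr => k _.
rewrite mulr_sumr cfun_sumE; apply: eq_bigr => l _.
rewrite cfunZE chi_delta /c -mulrA; congr (_ * _).
rewrite rmorphM /= conjCK !exprMn conj_circle expfzDr ?circle_neq0//.
rewrite -exprnN exprVn -!exprnP; set z : C := set_val _.
by move: (z ^- k) (z ^+ l) => x y; ring.
Qed.

(** The squared Euclidean distance is used because it is a sum over coordinates, whose average
    against the Fejer weights [fejer_sum_dist] computes exactly. *)
Definition tdist (s t : T) : R := \sum_j nrm (set_val (t j) - set_val (s j) : C) ^+ 2.

Lemma tdist_ge0 s t : 0 <= tdist s t.
Proof. by apply: sumr_ge0 => j _; exact: sqr_ge0. Qed.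

Lemma tdist_eq0 s t : tdist s t = 0 -> s = t.
Proof.
move=> /eqP; rewrite psumr_eq0 => [/allP h|j _]; last exact: sqr_ge0.
apply: torusP => j; apply/eqP; rewrite eq_sym -subr_eq0; apply/eqP/nrm0_eq0/eqP.
by have := h j (mem_index_enum j); rewrite sqrf_eq0.
Qed.

Lemma nrm_sqr_comp_continuous (X : topologicalType) (h : X -> C^o) : continuous h ->
  continuous (fun x => nrm (h x : C) ^+ 2).
Proof. by move=> ch; exact: (@nrm_sqr_continuous R X (mkC ch)). Qed.

Lemma tdist_continuous : continuous (fun p : T * T => tdist p.1 p.2).
Proof.
rewrite /tdist; elim: (index_enum _) => [|j s IH].
  by under eq_fun do rewrite big_nil; exact: cst_continuous.
under eq_fun do rewrite big_cons.
move=> p; apply: cvgD; last exact: IH.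
apply: (@nrm_sqr_comp_continuous _ (fun p : T * T => set_val (p.2 j) - set_val (p.1 j) : C^o)).
move=> q; apply: cvgB.
  apply: (@continuous_comp _ _ _ snd (fun t : T => set_val (t j) : C^o)).
    exact: cvg_snd.
  exact: Defs.coord_continuous.
apply: (@continuous_comp _ _ _ fst (fun t : T => set_val (t j) : C^o)).
  exact: cvg_fst.
exact: Defs.coord_continuous.
Qed.

Lemma torus_bounded (f : A) : exists2 B : R, 0 <= B & forall t, nrm (f t : C) <= B.
Proof.
have [t _ h] := compact_EVT_max (ex_intro _ (tone d) I : [set: T] !=set0) (@torus_compact R d)
  (continuous_subspaceT (nrm_sqr_continuous (f := f))).
exists (nrm (f t : C)); first exact: nrm_ge0.
move=> s; rewrite -(@ler_pXn2r _ 2) ?nnegrE ?nrm_ge0//.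
by apply: h; exact/mem_set.
Qed.

(** Uniform continuity in a form that can be averaged. The pairs where [f] varies by at least [e]
    form a compact set [K] on which [tdist] has a positive minimum [D]; there the variation is at
    most [2 * B], whence the constant [2 * B / D]. *)
Lemma modulus (f : A) (e : R) : 0 < e ->
  exists2 M : R, 0 <= M & forall s t, nrm (f t - f s : C) <= e + M * tdist s t.
Proof.
move=> e0; have [B B0 hB] := torus_bounded f.
pose K := [set p : T * T | e ^+ 2 <= nrm (f p.2 - f p.1 : C) ^+ 2].
have cf : continuous (fun p : T * T => nrm (f p.2 - f p.1 : C) ^+ 2).
  apply: (@nrm_sqr_comp_continuous _ (fun p : T * T => f p.2 - f p.1 : C^o)).
  move=> q; apply: cvgB.
    by apply: (@continuous_comp _ _ _ snd f); [exact: cvg_snd | exact: cts_fun].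
  by apply: (@continuous_comp _ _ _ fst f); [exact: cvg_fst | exact: cts_fun].
have cK : compact K.
  apply: (@subclosed_compact _ _ [set: T * T]) => //.
    exact: (@closed_comp _ _ _ [set x | e ^+ 2 <= x] (fun p _ => cf p) (@closed_ge _ _)).
  by rewrite -setXTT; apply: compact_setX; exact: torus_compact.
have small s t : ~ K (s, t) -> nrm (f t - f s : C) <= e.
  by move=> /negP; rewrite -ltNge ltr_pXn2r ?nnegrE ?nrm_ge0 ?(ltW e0)// => /ltW.
have [[p0 Kp0]|K0] := pselect (K !=set0); last first.
  exists 0 => // s t; rewrite mul0r addr0; apply: small => Kst.
  by apply: K0; exists (s, t).
have [p /set_mem Kp h] := compact_EVT_min (ex_intro _ p0 Kp0) cK
  (continuous_subspaceT tdist_continuous).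
set D := tdist p.1 p.2 in h.
have D0 : 0 < D.
  rewrite lt_neqAle tdist_ge0 andbT eq_sym; apply/eqP => /tdist_eq0 pp.
  move: Kp; rewrite /K /= pp subrr nrm0 expr0n /= leNgt.
  by rewrite exprn_gt0.
exists (2 * B / D); first by rewrite divr_ge0 ?mulr_ge0 ?(ltW D0).
move=> s t; have [Kst|/small h'] := pselect (K (s, t)); last first.
  by rewrite (le_trans h')// lerDl mulr_ge0 ?tdist_ge0// divr_ge0 ?mulr_ge0 ?(ltW D0).
have hD := h (s, t) (mem_set Kst); rewrite /= in hD.
apply: (@le_trans _ _ (2 * B)).
  rewrite mulr_natl mulr2n; apply: (le_trans (nrmD _ _)).
  by rewrite lerD// /nrm normrN; exact: hB.
rewrite -[leLHS]add0r lerD ?(ltW e0)// mulrAC ler_pdivlMr//.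
by rewrite ler_wpM2l// mulr_ge0.
Qed.

(* Discretized Fejer means: f t is compared with an average of the values of f at the
   points whose coordinates are (n+2)-th roots of unity. The weights are Laurent
   polynomials in t, and their second moment is 2 / (n+1) in each coordinate. *)
Lemma trig_dense (f : A) (e : R) : 0 < e ->
  exists2 g : A, trig g & forall t, nrm (f t - g t : C) <= e.
Proof.
move=> e0; have e2 : 0 < e / 2 by rewrite divr_gt0.
have [M M0 hM] := modulus f e2.
have B0 : 0 <= M * (d%:R * 2) by rewrite !mulr_ge0.
have B1 : 0 < M * (d%:R * 2) + 1 by rewrite ltr_wpDl.
(* The total error will be [e / 2 + M * (d * 2) / (n + 1)]; the added 1 in the divisor keeps it
   positive. *)
have [n hn] := inv_succ_lt (divr_gt0 e2 B1).
pose m := n.+2; pose W := {ffun 'I_d -> 'I_m}.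
pose pt (w : W) : T := fun j => mkcircle (norm_cis ((w j)%:R / m%:R)).
have mR : (m%:R : R) != 0 by rewrite pnatr_eq0.
pose F (t : T) (j : 'I_d) (i : 'I_m) :=
  fejer n.+1 (Num.conj (set_val (t j) : C) * cis (i%:R / m%:R)).
have tj1 (t : T) (j : 'I_d) : nrm (Num.conj (set_val (t j) : C)) = 1.
  by rewrite nrm_conj /nrm circleP.
have sF t j : \sum_(i < m) F t j i = m%:R by exact: fejer_sum.
have sFd t j : \sum_(i < m) F t j i * nrm (set_val (t j) - cis (i%:R / m%:R) : C) ^+ 2
    = m%:R * (2 / n.+1%:R).
  rewrite -(@fejer_sum_dist R n.+1 m (Num.conj (set_val (t j) : C)))//.
  apply: eq_bigr => i _; congr (_ * _ ^+ 2).
  rewrite -[LHS]mul1r -(tj1 t j) -nrmM mulrBr conj_mul.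
  by rewrite /nrm circleP expr1n.
pose P (w : W) t := m%:R ^- d * \prod_j F t j (w j).
have P0 w t : 0 <= P w t.
  by rewrite mulr_ge0 ?invr_ge0 ?exprn_ge0 ?prodr_ge0// => j _; exact: fejer_ge0.
have sP t : \sum_w P w t = 1.
  rewrite -mulr_sumr -(bigA_distr_bigA (F t)) (eq_bigr (fun=> m%:R)) => [|j _]; last exact: sF.
  by rewrite prodr_const card_ord mulVf// expf_neq0.
have sPd t : \sum_w P w t * tdist (pt w) t = d%:R * 2 * (n.+1%:R)^-1.
  under eq_bigr do rewrite mulr_sumr.
  rewrite exchange_big -mulrA -[d in RHS]card_ord -sum1_card natr_sum mulr_suml.
  apply: eq_bigr => j _; rewrite mul1r.
  pose D i := nrm (set_val (t j) - cis (i%:R / m%:R) : C) ^+ 2.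
  (* The [j]-th term of the squared distance is absorbed into the [j]-th factor of the weight, so
     that the sum over grid points still factors over the coordinates. *)
  pose E l i := F t l i * (if l == j then D i else 1).
  rewrite (eq_bigr (fun w : W => m%:R ^- d * \prod_l E l (w l))) => [|w _]; last first.
    have -> : \prod_l E l (w l) = \prod_l F t l (w l) * \prod_l (if l == j then D (w l) else 1).
      by rewrite -big_split.
    have -> : \prod_l (if l == j then D (w l) else 1) = D (w j).
      by rewrite (bigD1 j)//= eqxx big1 ?mulr1// => l /negbTE ->.
    by rewrite /P -mulrA.
  rewrite -mulr_sumr -(bigA_distr_bigA E) (bigD1 j)//=.
  rewrite {1}/E; under eq_bigr do rewrite eqxx.
  rewrite sFd (eq_bigr (fun=> m%:R)) => [|l /negbTE lj]; last first.
    by rewrite -(sF t l); apply: eq_bigr => i _; rewrite /E lj mulr1.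
  rewrite prodr_const cardC1 card_ord.
  have -> : (m%:R : R) ^+ d = m%:R * m%:R ^+ d.-1.
    by rewrite -exprS prednK// (leq_ltn_trans _ (ltn_ord j)).
  have : (m%:R : R) ^+ d.-1 != 0 by rewrite expf_neq0.
  have n1 : (n.+1%:R : R) != 0 by rewrite pnatr_eq0.
  have e3 (x y z : R) : y != 0 -> z != 0 -> x != 0 -> (y * x)^-1 * (y * (2 / z) * x) = 2 / z.
    by move=> y0 z0 x0; field; rewrite x0 y0 z0.
  exact: e3.
have hK (i : 'I_m) j := trig_fejer n.+1 (cis (i%:R / m%:R)) j.
pose K i j := s2val (cid2 (hK i j)).
have KT i j : trig (K i j) by rewrite /K; case: cid2.
have KE i j t : K i j t = (F t j i)%:C by rewrite /K; case: cid2.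
exists (\sum_(w : W) (m%:R ^- d * f (pt w) : C) *:
    \big[smul/cfun_const 1]_(j < d) K (w j) j).
  by apply: lspan_sum => w _; apply: lspanZ; exact: trig_prod.
move=> t.
have -> : f t - (\sum_(w : W) (m%:R ^- d * f (pt w) : C) *:
    \big[smul/cfun_const 1]_(j < d) K (w j) j) t
    = \sum_w (P w t)%:C * (f t - f (pt w)) :> C.
  rewrite cfun_sumE; under [in RHS]eq_bigr do rewrite mulrBr.
  rewrite sumrB -mulr_suml -rmorph_sum sP mul1r; congr (_ - _).
  apply: eq_bigr => w _; rewrite cfunZE prod_cfunE /P.
  under eq_bigr do rewrite KE.
  by rewrite rmorphM fmorphV rmorphXn rmorph_nat rmorph_prod /= mulrAC.
apply: (le_trans (nrm_sum _ _)).
apply: (@le_trans _ _ (\sum_w (P w t * (e / 2) + P w t * tdist (pt w) t * M))).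
  apply: ler_sum => w _; rewrite nrmM nrm_real ger0_norm//.
  by rewrite -mulrA -mulrDr ler_wpM2l// [_ * M]mulrC.
rewrite big_split /= -!mulr_suml sP sPd mul1r [leRHS]splitr lerD2l.
move: hn; rewrite ltr_pdivlMr// /inv_succ => hn; apply: le_trans (ltW hn).
have e4 (v x : R) : v * (M * (x * 2) + 1) = x * 2 * v * M + v by ring.
by rewrite e4 lerDl invr_ge0.
Qed.

End trig_theory.

(** * Fibres of the correspondence *)

(** The dependent form of distributivity is required because the range of the [j]-th digit varies
    with [j]. *)
Lemma fprod_distr (R : comPzSemiRingType) (I : finType) (T_ : I -> finType)
    (P : forall i, T_ i -> R) :
  \sum_(t : fprod T_) \prod_i P i (t i) = \prod_i \sum_(k : T_ i) P i k.
Proof.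
pose Q i := [ffun k => P i k].
transitivity (\sum_(t : fprod T_) \prod_(i in I) Q i (t i)).
  by apply: eq_bigr => t _; apply: eq_bigr => i _; rewrite ffunE.
rewrite big_fprod -(bigA_distr_big_dep (fun i => tagged_with T_ i)
  (fun i g => untag 0 (Q i) g)).
apply: eq_bigr => i _.
rewrite -(big_tag (fun i : I => Q i : T_ i -> R)).
by under eq_bigr do rewrite ffunE.
Qed.

Section fibres.
Variables (R : realType) (d : nat) (a : 'rV[int]_d).
Hypothesis ha : forall j : 'I_d, 0 < a 0 j.
Variable G : 'M[int]_d.
Local Notation C := R[i].
Local Notation T := (torus R d).
Local Notation A := (cfun R T).
Local Notation F := (diag_mx a).
Local Notation E := (corr R F G).
Local Notation Om := (set_type (@Omega R d F G)).

Definition absa (j : 'I_d) : nat := absz (a 0 j).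

(* The index set I(F) of the paper as a finite type; see vec for its elements. *)
Definition digits := fprod (fun j : 'I_d => 'I_(absa j)).

Lemma absaE j : a 0 j = (absa j)%:Z.
Proof. by rewrite /absa gez0_abs// ltW. Qed.

Lemma absa_gt0 j : (0 < absa j)%N.
Proof. by rewrite -ltz_nat -absaE. Qed.

Lemma det_diag_absa : \det F = (\prod_j absa j)%N%:Z.
Proof.
rewrite det_diag (eq_bigr (fun j => (absa j)%:Z)) => [|j _]; last exact: absaE.
by elim/big_rec2: _ => // j m n _ ->; rewrite PoszM.
Qed.

Lemma card_digits : #|{: digits}| = `|\det F|%N.
Proof.
by rewrite card_fprod det_diag_absa absz_nat; apply: eq_bigr => j _; rewrite card_ord.
Qed.

Lemma det_neq0 : \det F != 0.
Proof.
by rewrite det_diag_absa eqz_nat -lt0n prodn_cond_gt0// => j _; exact: absa_gt0.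
Qed.

Definition vec (k : digits) : 'rV[int]_d := \row_j (k j : nat)%:Z.

Lemma vec_frakI nu : frakI a nu -> exists k, vec k = nu.
Proof.
move=> h; pose n j := absz (nu 0 j).
have lt j : (n j < absa j)%N.
  have /andP[h0 h1] := h j; rewrite -ltz_nat -absaE /n gez0_abs//; move: h1; lia.
exists [fprod j => Ordinal (lt j)]; apply/rowP => j; rewrite mxE fprodE /=.
by have /andP[h0 _] := h j; rewrite /n gez0_abs.
Qed.

Lemma frakI_vec k : frakI a (vec k).
Proof.
move=> j; rewrite mxE absaE /=; have := ltn_ord (k j); lia.
Qed.

Lemma sigma_diag (t : T) j : set_val (sigma F t j) = (set_val (t j) : C) ^+ absa j.
Proof.
rewrite mkcircleK (bigD1 j)//= big1 ?mulr1 => [|i ij].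
  by rewrite mxE eqxx mulr1n absaE.
by rewrite mxE eq_sym (negbTE ij) expr0z.
Qed.

(** An arbitrary preimage, chosen without regard to continuity in [x]: it only serves to label the
    points of one fibre at a time. *)
Definition base (x : T) : T := sval (cid (sigma_surj (sigma G x) det_neq0)).
Lemma sigma_base x : sigma F (base x) = sigma G x.
Proof. by rewrite /base; case: cid. Qed.

Definition root (i : digits) (j : 'I_d) : C := cis ((i j)%:R / (absa j)%:R).
Lemma root_pow i j : root i j ^+ absa j = 1.
Proof.
rewrite /root -cisMn mulrC divfK ?cis_nat// pnatr_eq0 -lt0n; exact: absa_gt0.
Qed.

(** The fibre over [x] is a coset of the product of the groups of [a_j]-th roots of unity. The
    digits that number the monomials therefore number its points as well. *)
Definition branch (i : digits) (x : T) : T :=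
  tmul (base x) (fun j => mkcircle (norm_cis ((i j)%:R / (absa j)%:R))).

Lemma branchE i x j : set_val (branch i x j) = (set_val (base x j) : C) * root i j.
Proof. by []. Qed.

Lemma sigma_branch i x : sigma F (branch i x) = sigma G x.
Proof.
rewrite -sigma_base; apply: torusP => j; rewrite !sigma_diag branchE exprMn.
by rewrite root_pow mulr1.
Qed.

Lemma nrm_circle (z : @circle R) : nrm (set_val z : C) = 1.
Proof. by rewrite /nrm circleP. Qed.

(** Orthogonality of two characters on the kernel of [sigma F], coordinate by coordinate; this is
    the orthonormality of the frame. *)
Lemma branch_sum (x : T) (k l : digits) :
  \sum_(i : digits) \prod_j ((set_val (branch i x j) : C) ^+ k j *
     Num.conj (set_val (branch i x j) : C) ^+ l j)
  = if k == l then (\prod_j absa j)%N%:R else 0.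
Proof.
pose P j (i : 'I_(absa j)) := ((set_val (base x j) : C) * cis (i%:R / (absa j)%:R)) ^+ k j *
   Num.conj ((set_val (base x j) : C) * cis (i%:R / (absa j)%:R)) ^+ l j.
rewrite (fprod_distr P).
under eq_bigr do rewrite /P cis_root_sum ?nrm_circle//.
have [<-|kl] := eqVneq k l.
  by under eq_bigr do rewrite eqxx; rewrite natr_prod.
have [j kj] : exists j, k j != l j.
  apply: contrapT => h; move/eqP: kl; apply; apply/fprodP => j; apply/eqP.
  by apply: contrapT => /negP kj; apply: h; exists j.
rewrite (bigD1 j)//= ifF ?mul0r//; apply: contraNF kj => /eqP kj.
exact/eqP/val_inj.
Qed.

(** The dual relation, a sum over characters at two points: it gives the completeness of the frame
    and the injectivity of [branch]. *)
Lemma digit_sum (x : T) (i l : digits) :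
  \sum_(k : digits) \prod_j ((set_val (branch i x j) : C) ^+ k j *
     Num.conj (set_val (branch l x j) : C) ^+ k j)
  = if i == l then (\prod_j absa j)%N%:R else 0.
Proof.
(* The modulus of [base x j] is 1 and cancels, and [cis (i/m) ^ k = cis (k/m) ^ i] lets node and
   exponent exchange roles, so that [cis_root_sum] applies with [c = 1]. *)
pose P j (k : 'I_(absa j)) := (1 * cis (k%:R / (absa j)%:R) : C) ^+ i j *
   Num.conj (1 * cis (k%:R / (absa j)%:R) : C) ^+ l j.
transitivity (\sum_(k : digits) \prod_j P j (k j)).
  apply: eq_bigr => k _; apply: eq_bigr => j _; rewrite /P !mul1r !branchE /root.
  rewrite !conj_cis rmorphM /= conj_cis !exprMn mulrACA -exprMn.
  rewrite [X in X ^+ _]mulrC conj_mul nrm_circle !expr1n mul1r.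
  by rewrite -!cisMn; congr (_ * _); congr cis; ring.
rewrite (fprod_distr P).
under eq_bigr do rewrite /P cis_root_sum ?/nrm ?normr1//.
have [<-|il] := eqVneq i l.
  by under eq_bigr do rewrite eqxx; rewrite natr_prod.
have [j ij] : exists j, i j != l j.
  apply: contrapT => h; move/eqP: il; apply; apply/fprodP => j; apply/eqP.
  by apply: contrapT => /negP ij; apply: h; exists j.
rewrite (bigD1 j)//= ifF ?mul0r//; apply: contraNF ij => /eqP ij.
exact/eqP/val_inj.
Qed.

(** If two different digits gave the same point, the sum in [digit_sum] would be both 0 and the
    determinant. *)
Lemma branch_inj x : injective (branch^~ x).
Proof.
move=> i l il; have := digit_sum x i l; have [//|_] := eqVneq i l.
rewrite -il digit_sum eqxx => /eqP; rewrite pnatr_eq0 -leqn0 leqNgt.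
by rewrite prodn_cond_gt0// => j _; exact: absa_gt0.
Qed.

(* Otherwise z / (w cis (i/m)) is a nontrivial m-th root of unity for every i, so that
   the double sum over i and k of its k-th powers vanishes; but this sum is m. *)
Lemma branch_coord (z w : C) (m : nat) : (0 < m)%N -> nrm w = 1 -> z ^+ m = w ^+ m ->
  exists i : 'I_m, z = w * cis (i%:R / m%:R).
Proof.
move=> m0 w1 zw; apply: contrapT => h.
have w0 : w != 0.
  apply: contraTneq isT => w0; move: w1; rewrite w0 nrm0 => /eqP.
  by rewrite eq_sym oner_eq0.
pose u (i : 'I_m) := z / w * Num.conj (cis (i%:R / m%:R) : C).
have u0 i : \sum_(k < m) u i ^+ k = 0.
  apply: unity_root_sum.
    rewrite /u exprMn conj_cis -cisMn mulrN (mulrC m%:R) divfK ?pnatr_eq0 -?lt0n//.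
    by rewrite cisN cis_nat invr1 mulr1 expr_div_n zw divff// expf_neq0.
  apply/eqP => ui; apply: h; exists i.
  move: ui; rewrite /u conj_cis cisN => /(canRL (mulfVK (cis_neq0 _))).
  by rewrite mul1r => /(canRL (mulfVK w0)) ->; rewrite mulrC.
have : \sum_(k < m) (z / w) ^+ k * (\sum_(i < m) (1 * cis (i%:R / m%:R)) ^+ 0 *
    Num.conj (1 * cis (i%:R / m%:R) : C) ^+ k) = 0.
  under eq_bigr do rewrite mulr_sumr.
  rewrite exchange_big big1// => i _; rewrite -[RHS](u0 i); apply: eq_bigr => k _.
  by rewrite expr0 !mul1r; exact/esym/exprMn.
under eq_bigr do rewrite cis_root_sum ?/nrm ?normr1//.
rewrite (bigD1 (Ordinal m0))//= big1 => [|k k0]; last first.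
  rewrite ifF ?mulr0//; apply: contraNF k0 => /eqP k0; exact/eqP/val_inj/esym.
by rewrite expr0 mul1r addr0 => /eqP; rewrite pnatr_eq0 -leqn0 leqNgt m0.
Qed.

Lemma branch_surj x y : sigma F y = sigma G x -> exists i, y = branch i x.
Proof.
rewrite -sigma_base => h.
have hj j : exists i : 'I_(absa j),
    set_val (y j) = (set_val (base x j) : C) * cis (i%:R / (absa j)%:R).
  apply: branch_coord; [exact: absa_gt0 | exact: nrm_circle |].
  by rewrite -!sigma_diag h.
exists [fprod j => sval (cid (hj j))]; apply: torusP => j.
by rewrite branchE /root fprodE; case: cid.
Qed.

Definition fpt (x : T) (i : digits) : Om :=
  exist (fun q => q \in @Omega R d F G) (x, branch i x) (mem_set (sigma_branch i x)).

Lemma fptP (p : Om) : exists i, p = fpt (pr1 p) i.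
Proof.
have [i hi] := branch_surj (set_valP p : sigma F (pr2 p) = sigma G (pr1 p)).
exists i; apply: val_inj => /=; rewrite -hi.
exact: (surjective_pairing (set_val p)).
Qed.

Lemma fibre_sum (x : T) (g : Om -> C) :
  \sum_(p \in [set p : Om | pr1 p = x]) g p = \sum_(i : digits) g (fpt x i).
Proof.
rewrite (@reindex_fsbig _ _ _ _ _ (fpt x) [set: digits]); last first.
  split=> //.
    by move=> i l _ _ /(congr1 (@pr2 R d F G)) /= /branch_inj.
  by move=> p <-; have [i ->] := fptP p; exists i.
rewrite (fsbig_seq _ _ (index_enum_uniq _)); congr (\sum_(i \in _) _).
by apply/seteqP; split => i _ //=; exact: mem_index_enum.
Qed.

Notation N := ((\prod_j absa j)%N%:R : C).

Lemma N_neq0 : N != 0.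
Proof. by rewrite pnatr_eq0 -lt0n prodn_cond_gt0// => j _; exact: absa_gt0. Qed.

Lemma innerE (xi eta : E) x :
  inner xi eta x = N^-1 * \sum_(i : digits) Num.conj (xi (fpt x i) : C) * eta (fpt x i).
Proof.
transitivity (inner_fun xi eta x); first by [].
rewrite /inner_fun det_diag_absa ger0_norm//; congr (_ * _).
exact: (fibre_sum x (fun p => Num.conj (xi p : C) * eta p)).
Qed.

Definition one_corr : E := cfun_const 1.

(** These vectors are mapped by [T] to the generators [S_ T pi (vec k)], see [S_frame]. *)
Definition frame (k : digits) : E := lact (chi (vec k)) one_corr.

Lemma frameE k x i : frame k (fpt x i) = \prod_j (set_val (branch i x j) : C) ^+ k j.
Proof.
transitivity (chi (vec k) (branch i x) * 1 : C); first by [].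
by rewrite mulr1 chiE; apply: eq_bigr => j _; rewrite mxE.
Qed.

Lemma frame_orthonormal k l : inner (frame k) (frame l) = cfun_const (k == l)%:R.
Proof.
apply: cfunP => x; rewrite innerE.
have -> : \sum_(i : digits) Num.conj (frame k (fpt x i) : C) * frame l (fpt x i)
    = if l == k then N else 0.
  rewrite -(branch_sum x); apply: eq_bigr => i _; rewrite !frameE rmorph_prod -big_split.
  by apply: eq_bigr => j _; rewrite /= rmorphXn mulrC.
rewrite (eq_sym l); case: eqP => _; first by rewrite mulVf// N_neq0.
by rewrite mulr0.
Qed.

(** Stated for arbitrary values on one fibre, because it is applied both to elements of the module
    and to the coordinates of an l^2 vector at the paths with a common tail. *)
Lemma frame_fibre_expansion x i (z : digits -> C) :
  \sum_k (frame k (fpt x i) : C) * (N^-1 * \sum_l Num.conj (frame k (fpt x l) : C) * z l)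
  = z i.
Proof.
pose f k l : C := frame k (fpt x l).
change (\sum_k f k i * (N^-1 * \sum_l Num.conj (f k l) * z l) = z i).
rewrite (eq_bigr (fun k => N^-1 * \sum_l f k i * Num.conj (f k l) * z l)) => [|k _]; last first.
  by rewrite mulrCA mulr_sumr; congr (_ * _); apply: eq_bigr => l _; rewrite mulrA.
rewrite -mulr_sumr exchange_big /=.
have e l : \sum_k f k i * Num.conj (f k l) = if i == l then N else 0.
  rewrite -(digit_sum x); apply: eq_bigr => k _; rewrite /f !frameE rmorph_prod -big_split.
  by apply: eq_bigr => j _; rewrite /= rmorphXn.
rewrite (eq_bigr (fun l => (if i == l then N else 0) * z l)) => [|l _]; last first.
  by rewrite -(e l) mulr_suml.
rewrite (bigD1 i)//= eqxx [X in _ + X]big1 ?addr0 ?mulKf ?N_neq0// => l li.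
by rewrite eq_sym (negbTE li) mul0r.
Qed.

Lemma frame_expansion (zeta : E) : \sum_k ract (frame k) (inner (frame k) zeta) = zeta.
Proof.
apply: cfunP => p; have [i ->] := fptP p; move: (pr1 p) => x.
rewrite cfun_sumE; apply: etrans (frame_fibre_expansion x i (fun l => zeta (fpt x l) : C)).
by apply: eq_bigr => k _; rewrite -innerE.
Qed.

End fibres.

(** * Compact operators and covariance through the orthonormal basis *)

Section correspondence_theory.
Variables (R : realType) (d : nat) (a : 'rV[int]_d).
Hypothesis ha : forall j : 'I_d, 0 < a 0 j.
Variable G : 'M[int]_d.
Local Notation C := R[i].
Local Notation A := (cfun R (torus R d)).
Local Notation E := (corr R (diag_mx a) G).
Local Notation fpt := (@fpt R d a ha G).
Local Notation frame := (@frame R d a G).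
Implicit Types (xi eta zeta : E) (b : A).

Lemma ractE xi b p : ract xi b p = (xi p * b (pr1 p) : C). Proof. by []. Qed.
Lemma lactE b xi p : lact b xi p = (b (pr2 p) * xi p : C). Proof. by []. Qed.

Lemma inner_ractr xi eta b : inner xi (ract eta b) = inner xi eta ** b.
Proof.
apply: cfunP => x; rewrite cfunME !(innerE ha) -mulrA mulr_suml; congr (_ * _).
by apply: eq_bigr => i _; rewrite ractE mulrA.
Qed.

Lemma inner_star xi eta : star (inner xi eta) = inner eta xi.
Proof.
apply: cfunP => x; rewrite cfunSE !(innerE ha) rmorphM rmorph_sum fmorphV rmorph_nat /=.
by congr (_ * _); apply: eq_bigr => i _; rewrite rmorphM /= conjCK mulrC.
Qed.

Lemma inner_ractl xi eta b : inner (ract xi b) eta = star b ** inner xi eta.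
Proof. by rewrite -inner_star inner_ractr starM inner_star. Qed.

Lemma innerDr xi eta zeta : inner xi (eta + zeta) = inner xi eta + inner xi zeta.
Proof.
apply: cfunP => x; rewrite cfunDE !(innerE ha) -mulrDr -big_split; congr (_ * _).
by apply: eq_bigr => i _; exact: mulrDr.
Qed.

Lemma ractDl xi eta b : ract (xi + eta) b = ract xi b + ract eta b.
Proof. by apply: cfunP => p; exact: (@mulrDl C). Qed.
Lemma ractDr xi b c : ract xi (b + c) = ract xi b + ract xi c.
Proof. by apply: cfunP => p; exact: (@mulrDr C). Qed.
Lemma ractA xi b c : ract xi (b ** c) = ract (ract xi b) c.
Proof. by apply: cfunP => p; exact: (@mulrA C). Qed.
Lemma ract0l b : ract (0 : E) b = 0.
Proof. by apply: cfunP => p; exact: (@mul0r C). Qed.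

Lemma supnorm_ge b x : nrm (b x : C) <= supnorm b.
Proof.
have [B B0 hB] := torus_bounded b.
apply: sup_upper_bound; last by exists x.
by split; [exists (nrm (b x : C)), x | exists B => _ [y _ <-]; exact: hB].
Qed.

Lemma supnorm_ge0 b : 0 <= supnorm b.
Proof. exact: le_trans (nrm_ge0 _) (supnorm_ge b (tone d)). Qed.

Local Notation N := ((\prod_j absa a j)%N%:R : R).

(** A single term of a fibre sum is at most the whole sum, which is [N] times the inner product.
    Approximation in [Enorm] is therefore pointwise approximation. *)
Lemma nrm_le_Enorm xi p : nrm (xi p : C) <= Num.sqrt N * Enorm xi.
Proof.
apply: sqr_le_le; first by rewrite mulr_ge0 ?sqrtr_ge0.
rewrite exprMn !sqr_sqrtr ?supnorm_ge0 ?ler0n//.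
have N0 : (0 : R) < N by rewrite ltr0n prodn_cond_gt0// => j _; exact: absa_gt0.
have [i ->] := fptP ha p; move: (pr1 p) => x.
apply: (@le_trans _ _ (N * nrm (inner xi xi x : C))); last first.
  by rewrite ler_wpM2l ?(ltW N0)// supnorm_ge.
have -> : inner xi xi x = (N^-1 * \sum_l nrm (xi (fpt x l) : C) ^+ 2)%:C.
  rewrite (innerE ha) rmorphM fmorphV rmorph_nat rmorph_sum; congr (_ * _).
  by apply: eq_bigr => l _; rewrite conj_mul.
have s0 : 0 <= \sum_l nrm (xi (fpt x l) : C) ^+ 2 by apply: sumr_ge0 => l _; exact: sqr_ge0.
rewrite nrm_real ger0_norm ?mulr_ge0 ?invr_ge0 ?(ltW N0)// mulrA mulfV ?lt0r_neq0// mul1r.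
by rewrite (bigD1 i)//= lerDl sumr_ge0// => l _; exact: sqr_ge0.
Qed.

(** The definition of [compact_op] does not mention additivity or right linearity; [k] inherits both
    from these approximants, in [compactD] and [compact_ract]. *)
Lemma compact_approx (k : E -> E) (e : R) : compact_op k -> 0 < e ->
  exists K : E -> E, [/\ {morph K : xi eta / xi + eta},
    forall xi b, K (ract xi b) = ract (K xi) b &
    forall xi p, nrm ((k xi - K xi) p : C) <= e * Enorm xi].
Proof.
move=> hk e0; pose c := Num.sqrt N + 1.
have c0 : 0 < c by rewrite ltr_wpDl ?sqrtr_ge0.
have [s hs] := hk _ (divr_gt0 e0 c0).
exists (fun zeta => \sum_(p <- s) theta p.1 p.2 zeta); split.
- move=> xi eta; rewrite -big_split; apply: eq_bigr => p _.
  by rewrite /theta innerDr ractDr.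
- move=> xi b; rewrite (big_morph (fun x : E => ract x b) (op1 := +%R) (id1 := 0)) => [|x y|].
  + by apply: eq_bigr => p _; rewrite /theta inner_ractr ractA.
  + exact: ractDl.
  exact: ract0l.
move=> xi p; apply: (le_trans (nrm_le_Enorm _ p)).
apply: (@le_trans _ _ (c * (e / c * Enorm xi))); last first.
  by rewrite mulrA mulrCA mulfV ?mulr1 ?lt0r_neq0.
apply: ler_pM; rewrite ?sqrtr_ge0//.
by rewrite lerDl.
Qed.

Lemma le_small (x c : R) : (forall e, 0 < e -> x <= e * c) -> x <= 0.
Proof.
move=> h; apply: (@le_inv_succ _ c) => n; rewrite add0r mulrC.
exact/h/inv_succ_gt0.
Qed.

Lemma compactD (k : E -> E) : compact_op k -> {morph k : xi eta / xi + eta}.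
Proof.
move=> hk xi eta; apply: cfunP => p; apply/eqP; rewrite -subr_eq0; apply/eqP/nrm0_eq0/eqP.
rewrite eq_le nrm_ge0 andbT.
apply: (@le_small _ (Enorm (xi + eta) + (Enorm xi + Enorm eta))) => e e0.
have [K [KD _ hK]] := compact_approx hk e0.
have -> : k (xi + eta) p - (k xi + k eta) p =
  (k (xi + eta) - K (xi + eta)) p - ((k xi - K xi) p + (k eta - K eta) p).
  rewrite KD !(cfunDE, cfunNE) /=; move: (k (xi + eta) p : C) (k xi p : C) (k eta p : C).
  by move: (K xi p : C) (K eta p : C) => x y u v w; ring.
apply: (le_trans (nrmD _ _)); rewrite !mulrDr lerD// nrmN.
by apply: (le_trans (nrmD _ _)); rewrite lerD.
Qed.

Lemma compact_ract (k : E -> E) xi b : compact_op k -> k (ract xi b) = ract (k xi) b.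
Proof.
move=> hk; apply: cfunP => p; apply/eqP; rewrite -subr_eq0; apply/eqP/nrm0_eq0/eqP.
rewrite eq_le nrm_ge0 andbT.
apply: (@le_small _ (Enorm (ract xi b) + Enorm xi * nrm (b (pr1 p) : C))) => e e0.
have [K [_ Kr hK]] := compact_approx hk e0.
have -> : k (ract xi b) p - ract (k xi) b p =
  (k (ract xi b) - K (ract xi b)) p - (k xi - K xi) p * b (pr1 p).
  rewrite Kr !(cfunDE, cfunNE) !ractE /=; move: (k (ract xi b) p : C) (k xi p : C).
  by move: (K xi p : C) (b (pr1 p) : C) => x y u v; ring.
apply: (le_trans (nrmD _ _)); rewrite mulrDr lerD// nrmN.
by rewrite nrmM mulrA ler_wpM2r ?nrm_ge0.
Qed.

Lemma compact_sum (k : E -> E) (I : Type) (s : seq I) (f : I -> E) : compact_op k ->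
  k (\sum_(i <- s) f i) = \sum_(i <- s) k (f i).
Proof.
move=> hk; have k0 : k 0 = 0.
  by apply: (addrI (k 0)); rewrite -(compactD hk) !addr0.
exact: (big_morph k (compactD hk) k0).
Qed.

Section pair.
Variables (O : cstarAlgType R) (T : E -> O) (pi : A -> O).
Hypotheses (Tl : linear T) (hpi : star_hom pi).
Hypothesis Tin : forall xi eta, star (T xi) ** T eta = pi (inner xi eta).

Lemma T_D xi eta : T (xi + eta) = T xi + T eta.
Proof. by have := Tl 1 xi eta; rewrite !scale1r. Qed.
Lemma T_0 : T 0 = 0.
Proof. by have := Tl (-1) 0 0; rewrite scaler0 addr0 scaleN1r addNr. Qed.
Lemma T_Z c xi : T (c *: xi) = c *: T xi.
Proof. by have := Tl c xi 0; rewrite T_0 !addr0. Qed.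
Lemma T_sum (I : Type) (s : seq I) (f : I -> E) :
  T (\sum_(i <- s) f i) = \sum_(i <- s) T (f i).
Proof. exact: (big_morph T T_D T_0). Qed.

(** Compatibility with the right action follows from the inner product: the four products
    [star x ** x], [star x ** y], [star y ** x], [star y ** y] coincide, so
    [star (x - y) ** (x - y)] is 0. *)
Lemma T_ract xi b : T (ract xi b) = T xi ** pi b.
Proof.
set x := T _; set y := _ ** _.
pose q := pi (star b ** inner xi xi ** b).
have xx : star x ** x = q by rewrite Tin inner_ractl inner_ractr smulA.
have xy : star x ** y = q by rewrite smulA Tin inner_ractl -(homM hpi).
have yx : star y ** x = q by rewrite starM -smulA Tin inner_ractr -(homS hpi) -(homM hpi) smulA.
have yy : star y ** y = q.
  by rewrite starM -smulA (smulA (star (T xi))) Tin -(homS hpi) -!(homM hpi) smulA.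
apply/eqP; rewrite -subr_eq0; apply/eqP/star_smul_eq0.
by rewrite starD starN smulDl !smulDr !(smulNl, smulNr) xx xy yx yy subrr opprK addNr addr0.
Qed.

Local Notation frameprod := (\sum_k T (frame k) ** star (T (frame k))).

Lemma frame_smul xi : frameprod ** T xi = T xi.
Proof.
rewrite -[in RHS](frame_expansion ha xi) T_sum smul_suml; apply: eq_bigr => k _.
by rewrite -smulA Tin T_ract.
Qed.

Lemma star_frame : star frameprod = frameprod.
Proof. by rewrite star_sum; apply: eq_bigr => k _; rewrite starM starK. Qed.

Lemma smul_frame xi : star (T xi) ** frameprod = star (T xi).
Proof. by rewrite -{1}star_frame -starM frame_smul. Qed.

(* The vectors frame l form an orthonormal basis of the right module, so that a compact
   operator k is the sum of the rank one operators theta (k (frame l)) (frame l). *)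
Definition frame_Psi (k : E -> E) : O := \sum_l T (k (frame l)) ** star (T (frame l)).

Lemma T_compact k xi : compact_op k -> T (k xi) = frame_Psi k ** T xi.
Proof.
move=> hk; rewrite -{1}(frame_expansion ha xi) (compact_sum _ _ hk) T_sum smul_suml.
by apply: eq_bigr => l _; rewrite (compact_ract _ _ hk) T_ract -smulA Tin.
Qed.

Lemma frame_is_Psi : is_Psi T frame_Psi.
Proof.
split.
- move=> k l _ _; rewrite -big_split; apply: eq_bigr => i _ /=.
  by rewrite T_D smulDl.
- move=> c k _; rewrite scaler_sumr; apply: eq_bigr => i _ /=.
  by rewrite T_Z smulZl.
- move=> k l hk _; rewrite smul_sumr; apply: eq_bigr => i _ /=.
  by rewrite (T_compact _ hk) smulA.
- move=> k k' _ hkk.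
  (* Compactness is known for [k] and not for its adjoint [k'], so [T_compact] is replaced by the
     adjoint relation inside the frame expansion of [k' xi]. *)
  have h xi : T (k' xi) = star (frame_Psi k) ** T xi.
    rewrite -[in LHS](frame_expansion ha (k' xi)) T_sum /frame_Psi star_sum smul_suml.
    by apply: eq_bigr => l _; rewrite T_ract -hkk starM starK -smulA Tin.
  rewrite [in LHS]/frame_Psi; under eq_bigr do rewrite h -smulA.
  rewrite -smul_sumr /frame_Psi star_sum smul_suml; apply: eq_bigr => l _.
  by rewrite starM starK -smulA smul_frame.
move=> xi eta; rewrite /frame_Psi /theta.
under eq_bigr do rewrite T_ract -Tin -!smulA.
by rewrite -!smul_sumr smul_frame.
Qed.

Hypothesis Tla : forall b xi, T (lact b xi) = pi b ** T xi.

(** As [T] intertwines the left actions, [frame_Psi (lact b)] is [pi b ** frameprod]. *)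
Lemma frame_covariant : (forall b, pi b ** frameprod = pi b) -> covariant_pair T pi.
Proof.
move=> h; split=> //; exists frame_Psi; first exact: frame_is_Psi.
move=> b _ _; rewrite -[RHS]h smul_sumr; apply: eq_bigr => l _.
by rewrite Tla smulA.
Qed.

End pair.
End correspondence_theory.

(** * The representation on paths *)

Section l2_operators.
Variables (R : realType) (Y : choiceType).
Local Notation C := R[i].
Local Notation H := (l2 R Y).
Local Notation B := (bop R Y).
#[local] Existing Instance totally_filter.

Lemma l2_predP (x : Y -> C^o) (M : R) : (forall A, sqsum A x <= M) -> x \in @l2_pred R Y.
Proof. by move=> h; apply/asboolP; exists M. Qed.

Lemma hn_le (x : H) (M : R) : 0 <= M -> (forall A, sqsum A x <= M ^+ 2) -> hn x <= M.
Proof. by move=> M0 h; apply: sqr_le_le => //; rewrite hn_sqr; exact: hsq_le. Qed.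

Section diagonal.
Variables (g : Y -> C) (c : R).
Hypotheses (c0 : 0 <= c) (gc : forall y, nrm (g y) <= c).

Lemma sqsum_diag A (x : H) : sqsum A (fun y => (g y * x y : C) : C^o) <= (c * hn x) ^+ 2.
Proof.
rewrite exprMn hn_sqr; apply: (@le_trans _ _ (c ^+ 2 * sqsum A x)); last first.
  by rewrite ler_wpM2l ?sqr_ge0// sqsum_le_hsq.
rewrite /sqsum mulr_sumr; apply: ler_sum => y _; rewrite nrmM exprMn.
by rewrite ler_wpM2r ?sqr_ge0// ler_pXn2r ?nnegrE ?nrm_ge0.
Qed.
Definition diag_fun (x : H) : H := L2 (l2_predP (sqsum_diag ^~ x)).
Lemma diag_bounded : exists2 e : R, 0 <= e & forall x, hn (diag_fun x) <= e * hn x.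
Proof.
exists c => // x; apply: hn_le => [|A]; first by rewrite mulr_ge0 ?hn_ge0.
exact: sqsum_diag.
Qed.
End diagonal.

Lemma conj_bound (g : Y -> C) (c : R) :
  (forall y, nrm (g y) <= c) -> forall y, nrm (Num.conj (g y)) <= c.
Proof. by move=> gc y; rewrite nrm_conj. Qed.

Section diagonal_operator.
Variables (g : Y -> C) (c : R).
Hypotheses (c0 : 0 <= c) (gc : forall y, nrm (g y) <= c).

Lemma diag_adj x z : ip (diag_fun c0 gc x) z = ip x (diag_fun c0 (conj_bound gc) z).
Proof.
apply: ip_unique.
rewrite (_ : (fun A => _) = (fun A => ipsum A x (diag_fun c0 (conj_bound gc) z))).
  exact: ip_cvg.
apply/funext => A; apply: eq_bigr => y _ /=.
by rewrite rmorphM mulrCA mulrA.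
Qed.
Definition diag_bop : B := Bop (diag_bounded c0 gc) diag_adj.

End diagonal_operator.

Section isometry.
Variables (c e : Y -> Y).
Hypothesis ce : cancel c e.
(* P is the range of c. *)
Let P (y : Y) : bool := c (e y) == y.

Lemma sqsum_pull A (x : H) : sqsum A (fun y => x (c y)) <= hsq x.
Proof.
apply: le_trans (sqsum_le_hsq x (c @` A)%fset); rewrite /sqsum big_imfset//=.
by move=> y z _ _ /(can_inj ce).
Qed.
Definition pull (x : H) : H := L2 (l2_predP (sqsum_pull ^~ x)).

(** This is the preimage of [A] under [c]: a sum over [A] of a function supported on the range of
    [c] becomes a sum over it. *)
Definition retract (A : {fset Y}) : {fset Y} := (e @` [fset y in A | P y])%fset.

Lemma big_retract (V : nmodType) (A : {fset Y}) (h : Y -> V) :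
  \sum_(y <- A) (if P y then h (e y) else 0) = \sum_(y <- retract A) h y.
Proof.
rewrite big_imfset /=; last first.
  by move=> y z; rewrite !inE /= => /andP[_ /eqP {2}<-] /andP[_ /eqP {2}<-] ->.
by rewrite -big_mkcond [RHS]big_fset.
Qed.

Definition push_fun (x : H) (y : Y) : C^o := if P y then x (e y) else 0.

Lemma sqsum_push A (x : H) : sqsum A (push_fun x) <= hsq x.
Proof.
apply: le_trans (sqsum_le_hsq x (retract A)); rewrite /sqsum -big_retract.
apply: ler_sum => y _; rewrite /push_fun; case: ifP => // _.
by rewrite nrm0 expr0n.
Qed.
Definition push (x : H) : H := L2 (l2_predP (sqsum_push ^~ x)).

Lemma push_bounded : exists2 b : R, 0 <= b & forall x, hn (push x) <= b * hn x.
Proof.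
exists 1 => // x; rewrite mul1r; apply: hn_le => [|A]; first exact: hn_ge0.
by rewrite hn_sqr; exact: sqsum_push.
Qed.

(** Once [A] contains the image of [A0] under [c], its retract contains [A0]. Hence the partial sums
    over retracts in [push_adj] have the same limit as those over all finite sets. *)
Lemma retract_cvg : retract @ totally --> totally.
Proof.
move=> U [A0 _ hA0]; exists (c @` A0)%fset => // A /= hA; apply: hA0 => /=.
apply/fsubsetP => y yA; apply/imfsetP; exists (c y); rewrite ?ce//=.
by rewrite !inE /= (fsubsetP hA) ?in_imfset// /P ce eqxx.
Qed.

Lemma push_adj x z : ip (push x) z = ip x (pull z).
Proof.
apply: ip_unique.
rewrite (_ : (fun A => _) = (fun A => ipsum A x (pull z)) \o retract).
  by apply: cvg_comp; [exact: retract_cvg | exact: ip_cvg].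
apply/funext => A; rewrite /= /ipsum -big_retract; apply: eq_bigr => y _ /=.
rewrite /push_fun; case: ifP => [/eqP ->//|_].
by rewrite rmorph0 mul0r.
Qed.
Definition push_bop : B := Bop push_bounded push_adj.

Lemma push_bopE x y : push_bop x (c y) = x y.
Proof. by rewrite /= /push_fun /P ce eqxx. Qed.
Lemma push_bop0 x y : (forall z, y != c z) -> push_bop x y = 0.
Proof. by move=> h; rewrite /= /push_fun /P eq_sym (negbTE (h _)). Qed.

End isometry.
End l2_operators.

Section path_representation.
Variables (R : realType) (d : nat) (a : 'rV[int]_d).
Hypothesis ha : forall j : 'I_d, 0 < a 0 j.
Variable G : 'M[int]_d.
Hypothesis hG : \det G != 0.
Local Notation C := R[i].
Local Notation T := (torus R d).
Local Notation A := (cfun R T).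
Local Notation F := (diag_mx a).
Local Notation E := (corr R F G).
Local Notation fpt := (@fpt R d a ha G).
Local Notation frame := (@frame R d a G).
Local Notation I := (digits a).
Local Notation branch := (@branch R d a ha G).

Record tpath := TPath {
  pseq : nat -> T;
  tpathP : forall n, sigma F (pseq n) = sigma G (pseq n.+1) }.
HB.instance Definition _ := gen_eqMixin tpath.
HB.instance Definition _ := gen_choiceMixin tpath.
Local Notation B := (bop R tpath).
Implicit Types (y z : tpath) (f : A) (xi eta : E).

Lemma tpath_eq y z : (forall n, pseq y n = pseq z n) -> y = z.
Proof.
case: y z => p hp [q hq] /= /funext pq; subst q.
by congr TPath; exact: Prop_irrelevance.
Qed.

Definition hd y : T := pseq y 0.
Definition tl y : tpath := TPath (fun n => tpathP y n.+1).

Lemma consP (i : I) y n :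
  sigma F (if n is m.+1 then pseq y m else branch i (hd y)) = sigma G (pseq y n).
Proof. by case: n => [|n]; [exact: sigma_branch | exact: tpathP]. Qed.
Definition cons_path (i : I) y : tpath :=
  @TPath (fun n => if n is m.+1 then pseq y m else branch i (hd y)) (consP i y).

Lemma cons_pathK i : cancel (cons_path i) tl.
Proof. by move=> y; apply: tpath_eq. Qed.

(** With [cons_path_inj], this makes the path space the disjoint union of the ranges of the
    injections [cons_path i], so that operators can be compared on coordinates of this form. *)
Lemma tpath_case y : exists i z, y = cons_path i z.
Proof.
have [i hi] := branch_surj ha (tpathP y 0).
by exists i, (tl y); apply: tpath_eq => -[].
Qed.

Lemma cons_path_inj i l y z : cons_path i y = cons_path l z -> i = l.
Proof.
move=> e; have yz : y = z by rewrite -(cons_pathK i y) e cons_pathK.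
by subst z; exact: (@branch_inj R d a ha G (hd y) _ _ (congr1 hd e)).
Qed.

(** A section [g] of [sigma G] along [sigma F] is iterated from [t]; its existence is where
    [\det G != 0] enters. *)
Lemma hd_surj t : exists y, hd y = t.
Proof.
have [g hg] := choice (fun t : T => sigma_surj (sigma F t) hG).
by exists (@TPath (fun n => iter n g t) (fun n => esym (hg _))).
Qed.

Definition fun_bound f : R := s2val (cid2 (torus_bounded f)).
Lemma fun_bound_ge0 f : 0 <= fun_bound f.
Proof. by rewrite /fun_bound; case: cid2. Qed.
Lemma fun_boundP f y : nrm (f (hd y) : C) <= fun_bound f.
Proof. by rewrite /fun_bound; case: cid2. Qed.
Definition rep f : B := diag_bop (fun_bound_ge0 f) (fun_boundP f).

Local Notation N := ((\prod_j absa a j)%N%:R : R).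
Definition norm_factor : C := (Num.sqrt N)^-1%:C.

Lemma norm_factor_sqr : norm_factor * norm_factor = ((\prod_j absa a j)%N%:R : C)^-1.
Proof. by rewrite -rmorphM -invfM -expr2 sqr_sqrtr ?ler0n// fmorphV rmorph_nat. Qed.

Lemma corr_bound_ge0 xi : 0 <= Num.sqrt N * Enorm xi.
Proof. by rewrite mulr_ge0 ?sqrtr_ge0. Qed.
Lemma corr_boundP xi i y : nrm (xi (fpt (hd y) i) : C) <= Num.sqrt N * Enorm xi.
Proof. exact: nrm_le_Enorm. Qed.

Definition Trep xi : B := norm_factor *:
  \sum_i push_bop R (cons_pathK i) ** diag_bop (corr_bound_ge0 xi) (corr_boundP xi i).

Lemma bop_sumE (J : finType) (u : J -> B) x : (\sum_i u i) x = \sum_i u i x.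
Proof. by apply: (big_morph (fun S : B => S x)). Qed.

Lemma bop_scaleE (c : C) (S : B) x y : (c *: S) x y = (c * S x y : C).
Proof. by []. Qed.
Lemma bop_addE (S U : B) x y : (S + U) x y = S x y + U x y.
Proof. by []. Qed.

Lemma TrepE xi x i z :
  Trep xi x (cons_path i z) = (norm_factor * (xi (fpt (hd z) i) * x z) : C).
Proof.
rewrite /Trep bop_scaleE bop_sumE l2_sumE; congr (_ * _).
rewrite (bigD1 i)//= [X in _ + X]big1 ?addr0 => [|l li]; last first.
  apply: (push_bop0 (cons_pathK l)) => w.
  by apply: contraNneq li => /cons_path_inj ->.
exact: (push_bopE (cons_pathK i)).
Qed.

Lemma star_TrepE xi x z : star (Trep xi) x z =
  (norm_factor * \sum_i Num.conj (xi (fpt (hd z) i) : C) * x (cons_path i z) : C).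
Proof.
rewrite /Trep starZ conj_real star_sum bop_scaleE bop_sumE l2_sumE; congr (_ * _).
Qed.

Lemma bop_ext (S U : B) : (forall x i z, S x (cons_path i z) = U x (cons_path i z)) -> S = U.
Proof.
move=> h; apply: bopP => x; apply: l2P => y.
by have [i [z ->]] := tpath_case y.
Qed.

Lemma repE f x y : rep f x y = (f (hd y) * x y : C). Proof. by []. Qed.

Lemma rep_hom : star_hom rep.
Proof.
split.
- move=> c f g; apply: bopP => x; apply: l2P => y.
  rewrite bop_addE bop_scaleE !repE cfunDE cfunZE mulrA; exact: (@mulrDl C).
- move=> f g; apply: bopP => x; apply: l2P => y; exact/esym/(@mulrA C).
by move=> f; apply: bopP => x; apply: l2P => y.
Qed.

Lemma l2_delta_subproof y : (fun z => (z == y)%:R : C^o) \in @l2_pred R tpath.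
Proof.
apply: (@l2_predP _ _ _ 1) => S; rewrite /sqsum.
have [yS|yS] := boolP (y \in S).
  rewrite (big_fsetD1 y)//= eqxx big_seq big1 => [|z].
    by rewrite addr0 /nrm normr1 expr1n.
  by rewrite !inE => /andP[/negbTE -> _]; rewrite nrm0 expr0n.
rewrite big_seq big1// => z zS; rewrite (negbTE (_ : z != y)) ?nrm0 ?expr0n//.
by apply: contraNneq yS => <-.
Qed.
Definition l2_delta y : l2 R tpath := L2 (l2_delta_subproof y).

Lemma rep_inj : injective rep.
Proof.
move=> f g fg; apply: cfunP => t; have [y <-] := hd_surj t.
have := congr1 (fun S : B => S (l2_delta y) y : C) fg.
by rewrite !repE /= eqxx !mulr1.
Qed.

Lemma Trep_linear : linear Trep.
Proof.
move=> c xi eta; apply: bop_ext => x i z.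
rewrite TrepE bop_addE (bop_scaleE c (Trep xi)) !TrepE.
set p := fpt _ _.
have e (n u v w : C) : n * ((c * u + v) * w) = c * (n * (u * w)) + n * (v * w) by ring.
exact: (e norm_factor (xi p) (eta p) (x z)).
Qed.

Lemma Trep_inner xi eta : star (Trep xi) ** Trep eta = rep (inner xi eta).
Proof.
apply: bopP => x; apply: l2P => z.
rewrite repE (innerE ha).
transitivity (star (Trep xi) (Trep eta x) z); first by [].
rewrite star_TrepE -norm_factor_sqr.
under eq_bigr do rewrite TrepE mulrCA (mulrA (Num.conj _)).
by rewrite -mulr_sumr -mulr_suml !mulrA.
Qed.

Lemma Trep_lact f xi : Trep (lact f xi) = rep f ** Trep xi.
Proof.
apply: bop_ext => x i z.
transitivity (rep f (Trep xi x) (cons_path i z)); last by [].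
by rewrite repE !TrepE lactE -[in RHS]mulrCA -mulrA.
Qed.

(** At [cons_path i z] only the coordinates of [x] at paths with tail [z] are involved. These form a
    function on the fibre over [hd z], which the frame expands. *)
Lemma Trep_frame x : (\sum_k Trep (frame k) ** star (Trep (frame k))) x = x.
Proof.
apply: l2P => y; have [i [z ->]] := tpath_case y.
rewrite bop_sumE l2_sumE.
rewrite -[RHS](frame_fibre_expansion ha G (hd z) i (fun l => x (cons_path l z) : C)).
apply: eq_bigr => k _.
transitivity (Trep (frame k) (star (Trep (frame k)) x) (cons_path i z)); first by [].
by rewrite TrepE star_TrepE -norm_factor_sqr; ring.
Qed.

Lemma path_covariant_pair : covariant_pair Trep rep.
Proof.
apply: (frame_covariant ha) => //.
- exact: Trep_linear.
- exact: rep_hom.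
- exact: Trep_inner.
- exact: Trep_lact.
move=> f; apply: bopP => x.
have mulE (U S : B) : (U ** S) x = U (S x) by [].
by rewrite mulE Trep_frame.
Qed.

End path_representation.

(** * Matrices and orthogonal isometries *)

Section closure_norm.
Variables (R : realType) (V : normedModType R[i]) (S : set V).

Lemma closure_nrmP x : closure S x <-> forall e : R, 0 < e -> exists2 y, S y & nrm (y - x) <= e.
Proof.
split=> [Sx e e0|h U].
  have e0' : 0 < e%:C by rewrite ltcR.
  have [y [Sy]] := Sx _ (nbhsx_ballx x _ e0').
  by rewrite -ball_normE /= nrmE ltcR nrmB => /ltW; exists y.
move=> /nbhs_ballP [e /= e0 eU].
have e0' : 0 < complex.Re e by move: e0; rewrite ltcE => /andP[].
have eE : e = (complex.Re e)%:C by rewrite RRe_real// gtr0_real.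
have [y Sy xy] := h _ (divr_gt0 e0' (ltr0n _ 2)).
exists y; split=> //; apply: eU; rewrite -ball_normE /= eE nrmE ltcR nrmB.
by rewrite (le_lt_trans xy)// ltr_pdivrMr// ltr_pMr// ltr1n.
Qed.
End closure_norm.

Lemma smul_sandwichB (C : numClosedFieldType) (A : starAlgType C) (x y u v : A) :
  x ** u ** y - x ** v ** y = x ** (u - v) ** y.
Proof. by rewrite smulDr smulDl smulNr smulNl. Qed.

Section matrix_units.
Variables (R : realType) (d : nat) (O : cstarAlgType R).
Local Notation C := R[i].
Local Notation A := (cfun R (torus R d)).
Local Notation r := (@inv_succ R).
Variable pi : A -> O.
Hypotheses (hpi : star_hom pi) (pi_inj : injective pi).
Local Notation e := (unitO pi).
Variables (n : nat) (W : 'I_n -> O).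
Hypothesis hW : forall i j, star (W i) ** W j = if i == j then e else 0.
Local Notation MA := (mxalg n A).

Lemma cfun_smul1 (f : A) : f ** cfun_const 1 = f.
Proof. by rewrite cfun_mulC cfun_mul1. Qed.
Lemma pi_unitr f : pi f ** e = pi f.
Proof. by rewrite -(homM hpi) cfun_smul1. Qed.
Lemma pi_unitl f : e ** pi f = pi f.
Proof. by rewrite -(homM hpi) cfun_mul1. Qed.
Lemma star_unit : star e = e.
Proof. by rewrite -(homS hpi); congr (pi _); apply: cfunP => x; rewrite cfunSE conjC1. Qed.
Definition mxrep (M : MA) : O := \sum_i \sum_j W i ** pi (M i j) ** star (W j).

(** Recovering the entries by compression reduces the injectivity and the closed range of [mxrep] to
    those of [pi]. *)
Lemma mxrep_entry M i j : star (W i) ** mxrep M ** W j = pi (M i j).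
Proof.
rewrite /mxrep smul_sumr smul_suml (bigD1 i)//= [X in _ + X]big1 ?addr0 => [|k ki]; last first.
  rewrite smul_sumr smul_suml big1// => l _.
  by rewrite !smulA hW eq_sym (negbTE ki) !smul0r.
rewrite smul_sumr smul_suml (bigD1 j)//= [X in _ + X]big1 ?addr0 => [|k kj]; last first.
  by rewrite -!smulA hW (negbTE kj) !smul0.
by rewrite -!smulA hW eqxx pi_unitr smulA hW eqxx pi_unitl.
Qed.

Lemma mxrep_inj : injective mxrep.
Proof.
move=> M P MP; apply/matrixP => i j; apply: pi_inj.
by rewrite -!mxrep_entry MP.
Qed.

Lemma mxrepD M P : mxrep (M + P) = mxrep M + mxrep P.
Proof.
rewrite /mxrep -big_split; apply: eq_bigr => i _; rewrite -big_split; apply: eq_bigr => j _.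
by rewrite !mxE (homD hpi) smulDr smulDl.
Qed.

Lemma mxrepZ c M : mxrep (c *: M) = c *: mxrep M.
Proof.
rewrite /mxrep scaler_sumr; apply: eq_bigr => i _; rewrite scaler_sumr; apply: eq_bigr => j _.
by rewrite !mxE (homZ hpi) smulZr smulZl.
Qed.

Lemma mxrep_hom : star_hom mxrep.
Proof.
split.
- by move=> c M P; rewrite mxrepD mxrepZ.
- move=> M P; rewrite /mxrep smul_suml; apply: eq_bigr => i _; rewrite smul_suml.
  transitivity (\sum_l \sum_j W i ** pi (M i j) ** pi (P j l) ** star (W l)).
    apply: eq_bigr => l _; rewrite mxE (hom_sum hpi) smul_sumr smul_suml.
    by apply: eq_bigr => j _; rewrite (homM hpi) smulA.
  rewrite exchange_big; apply: eq_bigr => j _ /=.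
  rewrite smul_sumr [RHS](bigD1 j)//= [X in _ + X]big1 ?addr0 => [|k kj]; last first.
    rewrite smul_sumr big1// => l _.
    by rewrite -!smulA (smulA (star (W j))) hW eq_sym (negbTE kj) smul0r !smul0.
  rewrite smul_sumr; apply: eq_bigr => l _.
  by rewrite -!smulA (smulA (star (W j))) hW eqxx (smulA e) pi_unitl.
move=> M; rewrite /mxrep star_sum exchange_big; apply: eq_bigr => i _ /=.
rewrite star_sum; apply: eq_bigr => j _.
by rewrite mxE (homS hpi) !starM starK smulA.
Qed.

Definition monomials : set O :=
  [set x | exists i j nu, x = W i ** pi (chi nu) ** star (W j)].

Lemma mxrep_delta i j f :
  mxrep (\matrix_(k, l) if (k == i) && (l == j) then f else 0) = W i ** pi f ** star (W j).
Proof.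
rewrite /mxrep (bigD1 i)//= [X in _ + X]big1 ?addr0 => [|k ki]; last first.
  by rewrite big1// => l _; rewrite mxE (negbTE ki) (hom0 hpi) smul0 smul0r.
rewrite (bigD1 j)//= [X in _ + X]big1 ?addr0 => [|l lj]; last first.
  by rewrite mxE (negbTE lj) andbF (hom0 hpi) smul0 smul0r.
by rewrite mxE !eqxx.
Qed.

Lemma lspan_monomials : lspan monomials `<=` range mxrep.
Proof.
apply: lspan_min.
- by exists 0; rewrite // (hom0 mxrep_hom).
- by move=> _ _ [M _ <-] [P _ <-]; exists (M + P); rewrite ?mxrepD.
- by move=> c _ [M _ <-]; exists (c *: M); rewrite ?mxrepZ.
by move=> _ [i [j [nu ->]]]; rewrite -mxrep_delta; eexists.
Qed.

Lemma mxrep_closure M : closure (lspan monomials) (mxrep M).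
Proof.
apply/closure_nrmP => eps eps0.
(* A Lipschitz constant of [mxrep] with respect to the largest sup norm of an entry. *)
pose K := \sum_i \sum_j nrm (W i) * nrm (W j).
have K0 : 0 <= K by apply: sumr_ge0 => i _; apply: sumr_ge0 => j _; rewrite mulr_ge0 ?nrm_ge0.
have K1 : 0 < K + 1 by rewrite ltr_wpDl.
have del0 := divr_gt0 eps0 K1; set del := eps / (K + 1) in del0.
pose P i j := s2val (cid2 (trig_dense (M i j) del0)).
have PT i j : trig (P i j) by rewrite /P; case: cid2.
have PM i j t : nrm (M i j t - P i j t : C) <= del by rewrite /P; case: cid2.
exists (mxrep (\matrix_(i, j) P i j)).
  apply: lspan_sum => i _; apply: lspan_sum => j _; rewrite mxE.
  move: (P i j) (PT i j); apply: lspan_min.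
  - by rewrite (hom0 hpi) smul0 smul0r; exact: lspan0.
  - by move=> x y hx hy; rewrite (homD hpi) smulDr smulDl; exact: lspanD.
  - by move=> c x hx; rewrite (homZ hpi) smulZr smulZl; exact: lspanZ.
  by move=> _ [nu _ <-]; apply: lspan_sub; exists i, j, nu.
rewrite nrmB -(homB mxrep_hom).
apply: (@le_trans _ _ (del * K)); last first.
  by rewrite /del mulrAC ler_pdivrMr// ler_wpM2l ?(ltW eps0)// lerDl.
apply: (le_trans (nrm_sum _ _)); rewrite mulr_sumr; apply: ler_sum => i _.
apply: (le_trans (nrm_sum _ _)); rewrite mulr_sumr; apply: ler_sum => j _.
apply: (le_trans (nrm_smul _ _)); rewrite nrm_star mulrA ler_wpM2r ?nrm_ge0//.
apply: (le_trans (nrm_smul _ _)); rewrite mulrC ler_wpM2r ?nrm_ge0//.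
apply: (hom_le hpi); first exact: ltW.
by move=> t; rewrite !mxE; exact: PM.
Qed.

(** The compressions of [x] are limits of elements of the range of [pi], which is closed, and so
    provide a candidate matrix [M]. Its image is [q ** x ** q], with [q] the sum of the
    [W i ** star (W i)]; this equals [x] since [q] fixes the range of [mxrep] and hence its
    limits. *)
Lemma closure_mxrep x : closure (lspan monomials) x -> range mxrep x.
Proof.
move=> /closure_nrmP hx.
have hx' eps : 0 < eps -> exists M, nrm (mxrep M - x) <= eps.
  by move=> /hx[_ /lspan_monomials[M _ <-] ?]; exists M.
have hg i j : exists g, pi g = star (W i) ** x ** W j.
  apply: (hom_range_closed hpi pi_inj) => m.
  pose c := nrm (W i) * nrm (W j) + 1.
  have c0 : 0 < c by rewrite ltr_wpDl ?mulr_ge0 ?nrm_ge0.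
  have [M hM] := hx' _ (divr_gt0 (inv_succ_gt0 R m) c0).
  exists (M i j); rewrite -mxrep_entry smul_sandwichB.
  apply: (le_trans (nrm_smul _ _)).
  apply: (le_trans (ler_wpM2r (nrm_ge0 _) (nrm_smul _ _))).
  rewrite nrm_star mulrAC.
  apply: (@le_trans _ _ (c * (r m / c))); last by rewrite mulrC divfK ?lt0r_neq0.
  by apply: ler_pM; rewrite ?mulr_ge0 ?nrm_ge0// lerDl.
pose M : MA := \matrix_(i, j) sval (cid (hg i j)).
have ME i j : pi (M i j) = star (W i) ** x ** W j by rewrite mxE; case: cid.
exists M => //.
pose q := \sum_i W i ** star (W i).
have qq P : q ** P ** q = \sum_i \sum_j W i ** (star (W i) ** P ** W j) ** star (W j).
  rewrite smul_suml smul_suml; apply: eq_bigr => i _; rewrite smul_sumr.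
  by apply: eq_bigr => j _; rewrite !smulA.
have Mq : mxrep M = q ** x ** q.
  by rewrite qq; apply: eq_bigr => i _; apply: eq_bigr => j _; rewrite ME.
have Pq P : mxrep P = q ** mxrep P ** q.
  by rewrite qq; apply: eq_bigr => i _; apply: eq_bigr => j _; rewrite mxrep_entry.
apply/eqP; rewrite -subr_eq0; apply/eqP/nrm0_eq0/eqP.
rewrite eq_le nrm_ge0 andbT; apply: (@le_inv_succ _ (nrm q * nrm q + 1)) => m.
have [P hP] := hx' _ (inv_succ_gt0 R m).
apply: (le_trans (nrm_dist _ (mxrep P) _)).
rewrite add0r mulrDl mul1r lerD// Mq [mxrep P]Pq smul_sandwichB.
apply: (le_trans (nrm_smul _ _)).
apply: (le_trans (ler_wpM2r (nrm_ge0 _) (nrm_smul _ _))).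
by rewrite mulrAC nrmB ler_wpM2l ?mulr_ge0 ?nrm_ge0.
Qed.

Lemma mxrep_iso : star_iso_onto MA (closure (lspan monomials)).
Proof.
exists mxrep; split; [exact: mxrep_hom | exact: mxrep_inj |].
apply/seteqP; split=> [_ [M _ <-]|x]; [exact: mxrep_closure | exact: closure_mxrep].
Qed.

End matrix_units.

(** * Words in the generators of the Cuntz-Pimsner algebra *)

Section cuntz_pimsner_words.
Variables (R : realType) (d : nat) (a : 'rV[int]_d).
Hypothesis ha : forall j : 'I_d, 0 < a 0 j.
Variable G : 'M[int]_d.
Hypothesis hG : \det G != 0.
Local Notation C := R[i].
Local Notation T1 := (torus R d).
Local Notation A := (cfun R T1).
Local Notation E := (corr R (diag_mx a) G).
Variables (O : cstarAlgType R) (T : E -> O) (pi : A -> O).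
Hypothesis hO : cuntz_pimsner T pi.
Local Notation e := (unitO pi).
Local Notation frame := (@frame R d a G).

Let hpi : star_hom pi := pi_hom (cp_pair hO).

Lemma cp_pi_inj : injective pi.
Proof.
have [rho [_ _ hrho]] := cp_universal hO (@path_covariant_pair R d a ha G).
move=> f g fg; apply: (@rep_inj R d a G hG); rewrite -!hrho fg //.
Qed.

Lemma upow_pi (j : 'I_d) (m : int) :
  upow pi (genU pi j) m = pi (chi (m *: delta_mx 0 j)).
Proof.
have e0 : e = pi (chi (0 *: delta_mx 0 j)) by rewrite scale0r chi0.
case: m => n; rewrite /upow.
  elim: n => [//|n IH]; rewrite iterS IH -(homM hpi); congr (pi _).
  apply: cfunP => t; rewrite cfunME !chi_delta -!exprnP exprS //.
(* Replacing [n.+1] by an arbitrary natural number lets the induction start at the unit. *)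
rewrite NegzE; elim: n.+1 => [|{}n IH]; first by rewrite oppr0.
rewrite iterS IH -(homS hpi) -(homM hpi); congr (pi _).
apply: cfunP => t; rewrite cfunME cfunSE !chi_delta -!exprnN.
by rewrite [Num.conj _]conj_circle -!exprVn exprS.
Qed.

Lemma Upow_pi nu : Upow pi nu = pi (chi nu).
Proof.
rewrite /Upow.
under eq_bigr do rewrite upow_pi.
rewrite -(big_morph pi (homM hpi) (erefl : pi (cfun_const 1) = e)); congr (pi _).
apply: cfunP => t; rewrite prod_cfunE chiE.
by apply: eq_bigr => j _; rewrite chi_delta.
Qed.

Lemma S_frame k : S_ T pi (vec k) = T (frame k).
Proof. by rewrite /S_ Upow_pi /genS -(T_lact (cp_pair hO)). Qed.

Lemma unit_T xi : e ** T xi = T xi.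
Proof.
rewrite -(T_lact (cp_pair hO)); congr (T _).
by apply: cfunP => p; exact: (@mul1r C).
Qed.

Lemma star_frame_mul k l : star (T (frame k)) ** T (frame l) = if k == l then e else 0.
Proof.
rewrite (T_inner (cp_pair hO)) (@frame_orthonormal R d a ha G); case: eqP => // _.
by rewrite -(hom0 hpi); congr (pi _); apply: cfunP.
Qed.

Definition word n (w : 'I_n -> digits a) : O := \big[smul/e]_(i < n) T (frame (w i)).

(** Used when equal first letters of two words cancel and leave [e] between the remaining ones. *)
Lemma unit_word n (w : 'I_n -> digits a) : e ** word w = word w.
Proof.
rewrite /word; case: n w => [|n] w; last by rewrite big_ord_recl smulA unit_T.
by rewrite big_ord0 -(homM hpi) cfun_mul1.
Qed.

Lemma star_word_mul n (v w : {ffun 'I_n -> digits a}) :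
  star (word v) ** word w = if v == w then e else 0.
Proof.
have -> : (v == w) = [forall i, v i == w i].
  apply/eqP/forallP => [-> i|h]; first exact: eqxx.
  by apply/ffunP => i; exact/eqP.
(* With equality expressed letter by letter, the induction runs over plain functions, for which
   dropping the first letter is composition with [lift ord0]. *)
move: (v : 'I_n -> _) (w : 'I_n -> _) => {v w}; elim: n => [|n IH] v w.
  rewrite /word !big_ord0 (star_unit hpi) -(homM hpi) cfun_mul1.
  by rewrite ifT//; apply/forallP => -[].
rewrite /word !big_ord_recl starM -smulA (smulA (star (T _))) star_frame_mul.
have [vw|vw] := eqVneq (v ord0) (w ord0); last first.
  rewrite smul0r smul0 ifF//; apply/negbTE/forallPn; by exists ord0.
have := unit_word (w \o lift ord0); rewrite /word /= => ->.
have := IH (v \o lift ord0) (w \o lift ord0); rewrite /word /= => ->.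
congr (if _ then _ else _); apply/forallP/forallP => h i; last exact: h.
by have [j ->|->] := unliftP ord0 i; [exact: h | rewrite vw].
Qed.

Lemma Sword_word k (alpha : k.-tuple 'rV[int]_d) (w : 'I_k -> digits a) :
  (forall i, tnth alpha i = vec (w i)) -> Sword T pi alpha = word w.
Proof. by move=> h; apply: eq_bigr => i _; rewrite h S_frame. Qed.

(** The size is a variable with an equation because the number of words and the power of the
    determinant are equal but not convertible. *)
Lemma calA_iso (k n : nat) : #|{: {ffun 'I_k -> digits a}}| = n ->
  star_iso_onto (mxalg n A) (calA T pi k).
Proof.
move=> cn; pose ev (i : 'I_n) : {ffun 'I_k -> digits a} := enum_val (cast_ord (esym cn) i).
have ev_inj : injective ev by move=> i j /enum_val_inj /cast_ord_inj.
have ev_surj w : exists i, ev i = w.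
  by exists (cast_ord cn (enum_rank w)); rewrite /ev cast_ordK enum_rankK.
pose W i := word (ev i).
suff -> : calA T pi k = closure (lspan (monomials pi W)).
  apply: (mxrep_iso hpi cp_pi_inj) => i j.
  by rewrite star_word_mul (inj_eq ev_inj).
congr (closure (lspan _)); apply/seteqP; split=> x.
  move=> [al [be [nu [hal hbe ->]]]].
  have [v hv] := choice (fun i => vec_frakI ha (hal i)).
  have [w hw] := choice (fun i => vec_frakI ha (hbe i)).
  have [i hi] := ev_surj (finfun v); have [j hj] := ev_surj (finfun w).
  exists i, j, nu; rewrite Upow_pi; congr (_ ** _ ** star _).
    by apply: Sword_word => l; rewrite hi ffunE hv.
  by apply: Sword_word => l; rewrite hj ffunE hw.
move=> [i [j [nu ->]]].
exists [tuple vec (ev i l) | l < k], [tuple vec (ev j l) | l < k], nu.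
split=> [l|l|]; rewrite ?tnth_mktuple; try exact: frakI_vec.
rewrite Upow_pi; congr (_ ** _ ** star _); apply/esym/Sword_word => l;
  by rewrite tnth_mktuple.
Qed.

End cuntz_pimsner_words.

Theorem theorem5p6 (R : realType) (d : nat)
    (a : 'rV[int]_d) (ha : forall j : 'I_d, 0 < a 0 j)
    (G : 'M[int]_d) (hG : \det G != 0)
    (O : cstarAlgType R)
    (T : corr R (diag_mx a) G -> O) (pi : cfun R (torus R d) -> O)
    (hO : cuntz_pimsner T pi) (k : nat) :
  star_iso_onto
    (mxalg (`|\det (diag_mx a)| ^ k)%N (cfun R (torus R d)))
    (calA T pi k).
Proof.
by apply: (calA_iso ha hG hO); rewrite card_ffun card_ord (card_digits ha).
Qed.
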